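(* Let $d \ge 1$ and let $f, \psi \in L^2(\mathbb{R}^d)$. Suppose that $$\langle f, \psi_{s,t} \rangle = 0 \qquad \text{for all } s>0,\ t \in \mathbb{R}^d .$$ Then $$\int_0^\infty |\widehat{f}(r\xi)|^2 r^{d-1}\, dr \, \int_0^\infty |\widehat{\psi}(s\xi)|^2 s^{d-1}\, ds = 0$$ for almost every unit vector $\xi$ in $\mathbb{R}^d$. In particular, if $\langle f, \psi_{s,t} \rangle = 0$ for all $s>0$, $t \in \mathbb{R}^d$, and $\widehat{\psi}$ is nontrivial in almost every direction, then $f = 0$ almost everywhere.
   Context: Functions are complex-valued on $\mathbb{R}^d$. For $s>0$ and $t \in \mathbb{R}^d$, $\psi_{s,t}(x) = s^{-d/2}\, \psi\big(\frac{x-t}{s}\big)$, and $\langle f, \psi_{s,t}\rangle = \int_{\mathbb{R}^d} f(x)\, \overline{\psi_{s,t}(x)}\, dx$ (the continuous wavelet transform of $f$ with respect to $\psi$ at $(s,t)$). The Fourier transform is normalized by $\widehat{\psi}(\omega) = \int_{\mathbb{R}^d} \psi(x) e^{-2\pi i \omega\cdot x}\, dx$ (extended to $L^2$ as usual). A function $\lambda$ on $\mathbb{R}^d$ is nontrivial in direction $\xi$, where $\xi$ is a unit vector, if the set $\{ r>0 : \lambda(r\xi) \neq 0\}$ has positive (one-dimensional Lebesgue) measure; it is nontrivial in almost every direction if this holds for almost every unit vector $\xi$. ''Almost every unit vector'' is with respect to surface measure on the unit sphere $S^{d-1}$; when $d=1$ the unit sphere is $\{1,-1\}$ and ''almost every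 unit vector'' means both $\xi = 1$ and $\xi=-1$. *)

(* Defs.v *)
From HB Require Import structures.
From mathcomp Require Import all_boot all_order all_algebra.
From mathcomp Require Import all_classical all_reals all_analysis.
From mathcomp Require Import measurable_realfun complex.

Set Implicit Arguments.
Unset Strict Implicit.
Unset Printing Implicit Defensive.

Import Order.TTheory GRing.Theory Num.Theory.
Import numFieldNormedType.Exports.

Local Open Scope classical_set_scope.
Local Open Scope ring_scope.

(* The product sigma-algebra on row vectors, as for n.-tuple T; on 'rV[R]_n
   it is the Borel sigma-algebra of R^n. *)
Section measurable_rV.
Context {disp : measure_display} {T : measurableType disp}.
Variable n : nat.

Let coors : 'I_n -> 'rV[T]_n -> T := fun i x => x ord0 i.

Let rV_set0 : g_sigma_preimage coors set0.
Proof. exact: sigma_algebra0. Qed.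

Let rV_setC A : g_sigma_preimage coors A -> g_sigma_preimage coors (~` A).
Proof. exact: sigma_algebraC. Qed.

Let rV_bigcup (F : _^nat) : (forall i, g_sigma_preimage coors (F i)) ->
  g_sigma_preimage coors (\bigcup_i (F i)).
Proof. exact: sigma_algebra_bigcup. Qed.

HB.instance Definition _ := @isMeasurable.Build (measure_tuple_display disp)
  'rV[T]_n (g_sigma_preimage coors) rV_set0 rV_setC rV_bigcup.

End measurable_rV.

Lemma measurable_rV_coord {disp : measure_display} {T : measurableType disp}
    n (i : 'I_n) :
  measurable_fun [set: 'rV[T]_n] (fun x => x ord0 i).
Proof.
move=> _ Y mY; rewrite setTI; apply: sub_sigma_algebra => /=.
rewrite -bigcup_seq/=; exists i; first exact: mem_index_enum.
by exists Y => //; rewrite setTI.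
Qed.

Lemma measurable_fun_rVP {disp disp' : measure_display}
    {S : measurableType disp} {T : measurableType disp'} n (f : S -> 'rV[T]_n) :
  measurable_fun [set: S] f <->
  forall i, measurable_fun [set: S] (fun s => f s ord0 i).
Proof.
split=> [mf i|mf].
  exact: (measurableT_comp (measurable_rV_coord i) mf).
move=> _ B mB; pose G := [set A : set 'rV[T]_n | measurable (f @^-1` A)].
rewrite setTI; suff: G B by [].
apply: (smallest_sub (G := \big[setU/set0]_(i < n)
   preimage_set_system setT (fun x : 'rV[T]_n => x ord0 i) measurable)) mB.
  split=> /=.
  - by rewrite /G/= preimage_set0.
  - by move=> A; rewrite /G/= setTD -preimage_setC => /measurableC.
  - by move=> F mF; rewrite /G/= preimage_bigcup; apply: bigcup_measurable => k _; exact: mF.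
move=> A; rewrite -bigcup_seq/= => -[i _ [Y mY <-]].
rewrite /G/= setTI -comp_preimage -[X in measurable X]setTI; exact: mf.
Qed.

Section lebesgue_rV.
Variable R : realType.

Definition rV_cons n (p : measurableTypeR R * 'rV[R]_n) : 'rV[R]_n.+1 :=
  \row_i oapp (p.2 ord0) p.1 (unlift ord0 i).

Definition rV_uncons n (x : 'rV[R]_n.+1) : measurableTypeR R * 'rV[R]_n :=
  (x ord0 ord0, \row_i x ord0 (lift ord0 i)).

Lemma rV_consK n : cancel (@rV_cons n) (@rV_uncons n).
Proof.
move=> [a x]; rewrite /rV_uncons /rV_cons mxE unlift_none/=; congr pair.
by apply/rowP => i; rewrite !mxE liftK.
Qed.

Lemma measurable_rV_cons n : measurable_fun setT (@rV_cons n).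
Proof.
apply/measurable_fun_rVP => i; under eq_fun do rewrite mxE.
case: unliftP => [j|] _ /=; last exact: measurable_fst.
exact: (measurableT_comp (measurable_rV_coord j) measurable_snd).
Qed.

Lemma measurable_rV_uncons n : measurable_fun setT (@rV_uncons n).
Proof.
apply/measurable_fun_pairP; split; first exact: measurable_rV_coord.
apply/measurable_fun_rVP => i /=; under eq_fun do rewrite mxE.
exact: measurable_rV_coord.
Qed.

Section step.
Variables (n : nat) (mu : {sigma_finite_measure set 'rV[R]_n -> \bar R}).

Definition lebesgue_rV_step : set 'rV[R]_n.+1 -> \bar R :=
  pushforward (lebesgue_measure \x mu)%E (@rV_cons n).

HB.instance Definition _ := Measure.copy lebesgue_rV_step
  (measure_function_pushforward__canonical__measure_function_Measure
    (lebesgue_measure \x mu)%E (@measurable_rV_cons n)).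

Let sigma_finite_step : sigma_finite setT lebesgue_rV_step.
Proof.
have /sigma_finiteP[F [FT ndF Foo]] := sigma_finiteT (@lebesgue_measure R).
have /sigma_finiteP[G [GT ndG Goo]] := sigma_finiteT mu.
exists (fun i => @rV_uncons n @^-1` (F i `*` G i)).
  rewrite -preimage_bigcup (_ : \bigcup_i _ = setT) ?preimage_setT//.
  rewrite -subTset => -[x y] _.
  have [i _ Fix] : (\bigcup_i F i) x by rewrite -FT.
  have [j _ Gjy] : (\bigcup_i G i) y by rewrite -GT.
  exists (maxn i j) => //; split => /=.
    by move: x Fix; exact/subsetPset/ndF/leq_maxl.
  by move: y Gjy; exact/subsetPset/ndG/leq_maxr.
move=> i; have [mF ltF] := Foo i; have [mG ltG] := Goo i; split.
  rewrite -[X in measurable X]setTI; apply: measurable_rV_uncons => //.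
  exact: measurableX.
rewrite /lebesgue_rV_step /pushforward -comp_preimage.
rewrite (_ : _ \o _ = id) ?preimage_id.
  by rewrite product_measure1E// lte_mul_pinfty// ge0_fin_numE.
by apply/funext => p /=; rewrite rV_consK.
Qed.

HB.instance Definition _ :=
  Measure_isSigmaFinite.Build _ _ _ lebesgue_rV_step sigma_finite_step.

End step.

Fixpoint lebesgue_rV n : {sigma_finite_measure set 'rV[R]_n -> \bar R} :=
  match n with
  | 0 => \d_ (0 : 'rV[R]_0)
  | m.+1 => lebesgue_rV_step (lebesgue_rV m)
  end.

End lebesgue_rV.
Arguments lebesgue_rV {R} n.

Section sphere.
Variables (R : realType) (n : nat).
Implicit Types x y : 'rV[R]_n.

Definition dot x y : R := \sum_i x ord0 i * y ord0 i.

(* The library's norm on 'rV[R]_n is the maximum norm. *)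
Definition enorm x : R := Num.sqrt (dot x x).

Definition normalize x : 'rV[R]_n := (enorm x)^-1 *: x.

Lemma measurable_enorm : measurable_fun setT enorm.
Proof.
have msqrt : measurable_fun setT (@Num.sqrt R).
  apply: continuous_measurable_fun; exact: (@sqrt_continuous R).
apply: (measurableT_comp msqrt); apply: measurable_sum => i.
by apply: measurable_funM; exact: measurable_rV_coord.
Qed.

Lemma measurable_normalize : measurable_fun setT normalize.
Proof.
apply/measurable_fun_rVP => i; under eq_fun do rewrite mxE.
apply: measurable_funM; last exact: measurable_rV_coord.
under eq_fun do rewrite -(powR_inv1 (sqrtr_ge0 _)).
exact: (measurableT_comp (measurable_powR _) measurable_enorm).
Qed.

Definition punctured_ball : set 'rV[R]_n := [set x | 0 < enorm x <= 1].

Lemma measurable_punctured_ball : measurable punctured_ball.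
Proof.
rewrite (_ : punctured_ball = setT `&` enorm @^-1` `]0, 1]); last first.
  by rewrite setTI; apply/seteqP; split=> x /=; rewrite in_itv.
by apply: measurable_enorm => //; exact: measurable_itv.
Qed.

(* Surface measure on the unit sphere, carried by the ambient space:
   sigma(A) = n * Leb {r xi | xi in A, |xi| = 1, 0 < r <= 1}.
   For n = 1 it is the counting measure on {1, -1}. *)
Definition surface_measure : set 'rV[R]_n -> \bar R :=
  pushforward
    (mscale n%:R%:nng (mrestr (lebesgue_rV n) measurable_punctured_ball))
    normalize.

HB.instance Definition _ := Measure.copy surface_measure
  (measure_function_pushforward__canonical__measure_function_Measure
    (mscale n%:R%:nng (mrestr (lebesgue_rV n) measurable_punctured_ball))
    measurable_normalize).

Definition ae_unit_vector (P : set 'rV[R]_n) : Prop :=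
  {ae surface_measure, forall xi, enorm xi = 1 -> P xi}.

End sphere.

Section complex_functions.
Variables (R : realType) (n : nat).
Local Notation V := 'rV[R]_n.
Local Notation mu := (lebesgue_rV n).
Implicit Types f g psi : V -> R[i].

Definition cmeasurable f : Prop :=
  measurable_fun setT (fun x => complex.Re (f x)) /\
  measurable_fun setT (fun x => complex.Im (f x)).

Definition cnorm (p : \bar R) f : \bar R :=
  Lnorm mu p (fun x => (Normc.normc (f x))%:E).

Definition memLp (p : \bar R) f : Prop :=
  cmeasurable f /\ (cnorm p f < +oo)%E.

Definition cintegral f : R[i] :=
  Complex (\int[mu]_x complex.Re (f x)) (\int[mu]_x complex.Im (f x)).

Definition inner f g : R[i] := cintegral (fun x => f x * conjc (g x)).

Definition dilate_translate psi (s : R) (t : V) : V -> R[i] :=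
  fun x => real_complex R (s `^ (- (n%:R / 2))) * psi (s^-1 *: (x - t)).

Definition expi (a : R) : R[i] := Complex (cos a) (sin a).

Definition fourier1 f : V -> R[i] :=
  fun w => cintegral (fun x => f x * expi (- (2 * pi * dot w x))).

(* The closure in L^2 x L^2 of the graph of fourier1 on L^1 and L^2. *)
Definition is_fourier2 f g : Prop :=
  memLp 2%:E g /\
  exists f_ : nat -> V -> R[i],
    [/\ forall k, memLp 1%:E (f_ k) /\ memLp 2%:E (f_ k),
        (fun k => cnorm 2%:E (f_ k - f)) @ \oo --> 0%E &
        (fun k => cnorm 2%:E (fourier1 (f_ k) - g)) @ \oo --> 0%E].

(* A representative of the Fourier transform of the class of f in L^2, which
   exists by Plancherel and is unique up to a null set; 0 is only a default
   for f outside L^2. *)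
Definition fourier2 f : V -> R[i] := xget 0 [set g | is_fourier2 f g].

Definition radial_energy f (xi : V) : \bar R :=
  (\int[lebesgue_measure]_(r in `]0%R, +oo[)
     (Normc.normc (f (r *: xi)) ^+ 2 * r ^+ n.-1)%:E)%E.

Definition nontrivial_in_direction f (xi : V) : Prop :=
  (0 < lebesgue_measure [set r : R | 0 < r /\ f (r *: xi) != 0%R]%R)%E.

End complex_functions.

(* Main.v *)
(* Write F and G for the Fourier transforms of f and psi.  For fixed s the map
   t |-> <f, psi_(s,t)> has Fourier transform F conj(G(s .)) up to a constant;
   tested against Gaussians this gives conj(G(s w)) F(w) = 0 for almost every w,
   for every s > 0, because the translated and dilated Gaussians determine an
   integrable function.  Polar coordinates are replaced by homogeneity: the
   integral over R^d of the product of the radial energies is, by Tonelli, an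
   integral over (r, s) of integrals over w of |F(r w)|^2 |G(s w)|^2 with powers
   of r and s, and these vanish.  Hence the product vanishes almost everywhere
   on R^d, and being homogeneous it vanishes in almost every direction.

   As for the L^2 theory, integrating |F|^2 against wider and wider Gaussians
   bounds the L^2 norm of F by twice that of f, which together with completeness
   gives the extension to L^2; the constant 2 is harmless.  If F = 0, then the
   multiplication formula makes f orthogonal to all Gaussians, so f = 0. *)

Require Import Defs.
From mathcomp Require Import all_boot all_order all_algebra.
From mathcomp Require Import all_classical all_reals all_analysis.
From mathcomp Require Import complex measurable_realfun ring lra.
Import Order.TTheory GRing.Theory Num.Theory.
Import numFieldNormedType.Exports.
Local Open Scope classical_set_scope.
Local Open Scope ring_scope.

Set Implicit Arguments.
Unset Strict Implicit.
Unset Printing Implicit Defensive.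

(** * Affine changes of variables *)

(** The correlation identity rests on Fubini and is proved for functions in both L^1 and L^2,
    whereas the coefficients that vanish are those of f and psi, which are merely in L^2. The
    approximants supplied by [is_fourier2] do not inherit the vanishing. What they inherit, by
    Cauchy-Schwarz, is that their correlations are small uniformly in t. The identity is therefore
    used as an inequality, [normc_fourier1_correlation], and the test function h must have an
    integrable transform, against which a uniform bound can be integrated. For a Gaussian of height
    1 the modulus of the transform has integral exactly 1, whatever its width and centre, so no
    constant degenerates when the Gaussians widen.

    The same inequality with psi = f and s = 1 yields the L^2 bound for the transform. The factor 2
    stems from estimating a complex integral through its real and imaginary parts; it is absorbed
    into the rate of approximation when the transform is extended to L^2. *)

Section lebesgue_rV_theory.
Variable R : realType.
Local Notation leb := (@lebesgue_measure R).
Local Open Scope ereal_scope.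

Lemma measurable_affine (a t : R) :
  measurable_fun [set: measurableTypeR R] (fun r : measurableTypeR R => (a * r + t)%R :
    measurableTypeR R).
Proof. by apply: measurable_funD => //; exact: measurable_funM. Qed.

(** The right-hand side is a measure in [A], so by uniqueness of Lebesgue measure a comparison on
    half-open intervals is enough. For negative [a] the preimage is half-open at the other end,
    hence the two cases. *)
Lemma lebesgue_measure_affine (a t : R) : a != 0%R -> forall A, measurable A ->
  leb A = `|a|%:E * leb ((fun r => (a * r + t)%R) @^-1` A).
Proof.
move=> a0 A mA; have na : (0 <= `|a|)%R by [].
pose m := mscale (NngNum na) (measure_function_pushforward__canonical__measure_function_Measure
    leb (measurable_affine a t)).
have -> : `|a|%:E * leb ((fun r => (a * r + t)%R) @^-1` A) = m A by [].
apply: lebesgue_measure_unique => //= _ [[u v] _ <-] /=.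
rewrite /m /mscale/= /pushforward.
have [a_gt0|a_lt0|/eqP] := ltgtP 0%R a; last by rewrite eq_sym (negbTE a0).
- rewrite (_ : _ @^-1` _ = `](u - t) / a, (v - t) / a]%classic)%R; last first.
    apply/seteqP; split => r /=; rewrite !in_itv/= ltr_pdivrMr// ler_pdivlMr//;
    by rewrite mulrC ltrBlDr lerBrDr.
  rewrite !lebesgue_measure_itv/= !lte_fin ltr_pM2r ?invr_gt0// ltrD2r.
  case: ifPn => _; last by rewrite mule0.
  by rewrite -!EFinD -EFinM gtr0_norm//; congr EFin; field.
- rewrite (_ : _ @^-1` _ = `[(v - t) / a, (u - t) / a[%classic)%R; last first.
    apply/seteqP; split => r /=; rewrite !in_itv/= ler_ndivrMr// ltr_ndivlMr//;
    by rewrite mulrC ltrBlDr lerBrDr andbC.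
  rewrite !lebesgue_measure_itv/= !lte_fin ltr_nM2r ?invr_lt0// ltrD2r.
  case: ifPn => _; last by rewrite mule0.
  by rewrite -!EFinD -EFinM ltr0_norm//; congr EFin; field.
Qed.

Lemma ge0_integral_affine (a t : R) (F : R -> \bar R) : a != 0%R ->
  measurable_fun setT F -> (forall r, 0 <= F r) ->
  \int[leb]_r F r = `|a|%:E * \int[leb]_r F (a * r + t)%R.
Proof.
move=> a0 mF F0; have na : (0 <= `|a|)%R by [].
pose p := measure_function_pushforward__canonical__measure_function_Measure
    leb (measurable_affine a t).
rewrite (@eq_measure_integral _ _ _ setT (mscale (NngNum na) p)); last first.
  by move=> A mA _; exact: (lebesgue_measure_affine t a0 mA).
rewrite ge0_integral_mscale//=; congr (_ * _).
by rewrite (ge0_integral_pushforward (measurable_affine a t))//= preimage_setT.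
Qed.

Lemma rV_cons_affine n (a : R) (p : measurableTypeR R * 'rV[R]_n) (t : 'rV[R]_n.+1) :
  (a *: rV_cons p + t)%R =
  rV_cons ((a * p.1 + (rV_uncons t).1)%R : measurableTypeR R, (a *: p.2 + (rV_uncons t).2)%R).
Proof.
apply/rowP => i; rewrite !mxE; case: unliftP => [j|] -> /=; last by [].
by rewrite !mxE.
Qed.

Lemma ge0_integral_rVS n (F : 'rV[R]_n.+1 -> \bar R) :
  measurable_fun setT F -> (forall x, 0 <= F x) ->
  \int[lebesgue_rV n.+1]_x F x =
  \int[leb]_r \int[lebesgue_rV n]_x F (rV_cons ((r : measurableTypeR R), x)).
Proof.
move=> mF F0.
rewrite (ge0_integral_pushforward (@measurable_rV_cons R n) (leb \x lebesgue_rV n))//.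
rewrite preimage_setT fubini_tonelli1//; last by move=> p; exact: F0.
exact: (measurableT_comp mF (@measurable_rV_cons R n)).
Qed.

Lemma measurable_rV_affine n (a : R) (t : 'rV[R]_n) :
  measurable_fun setT (fun x : 'rV[R]_n => a *: x + t)%R.
Proof.
apply/measurable_fun_rVP => i; under eq_fun do rewrite !mxE.
apply: measurable_funD => //; apply: measurable_funM => //.
exact: measurable_rV_coord.
Qed.

(** Induction on the dimension with [t] and [F] general: Tonelli splits off the first coordinate,
    which contributes one factor [|a|]. In dimension 0 there is a single point, and the factor is
    1. *)
Lemma ge0_integral_rV_affine n (a : R) (t : 'rV[R]_n) (F : 'rV[R]_n -> \bar R) :
  a != 0%R -> measurable_fun setT F -> (forall x, 0 <= F x) ->
  \int[lebesgue_rV n]_x F x =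
  (`|a| ^+ n)%:E * \int[lebesgue_rV n]_x F (a *: x + t)%R.
Proof.
move=> a0; elim: n t F => [|n IH] t F mF F0.
  rewrite expr0 mul1e; apply: eq_integral => x _.
  by congr F; apply/rowP; case.
have mFc : measurable_fun setT (F \o @rV_cons R n).
  exact: (measurableT_comp mF (@measurable_rV_cons R n)).
rewrite ge0_integral_rVS//.
rewrite (ge0_integral_rVS (F := fun x => F (a *: x + t)%R))//; last first.
  exact: (measurableT_comp mF (@measurable_rV_affine _ a t)).
rewrite (ge0_integral_affine (rV_uncons t).1 a0) /=; last 2 first.
- apply: (@measurable_fun_fubini_tonelli_F _ _ _ _ _ (lebesgue_rV n) (F \o @rV_cons R n)) => //.
  by move=> p; exact: F0.
- by move=> r; exact: integral_ge0.
rewrite exprS EFinM -muleA; congr (_ * _).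
under eq_integral => r _.
  rewrite (IH (rV_uncons t).2)//; last first.
    exact: (measurable_fun_pair2 _ mFc).
  over.
under [in RHS]eq_integral => r _ do under eq_integral => x _ do rewrite rV_cons_affine.
have mG : measurable_fun [set: measurableTypeR R] (fun r : measurableTypeR R =>
    \int[lebesgue_rV n]_x F (rV_cons (r, a *: x + (rV_uncons t).2)%R)).
  pose F' := (fun p : measurableTypeR R * 'rV[R]_n => F (rV_cons (p.1,
    a *: p.2 + (rV_uncons t).2)%R)).
  apply: (@measurable_fun_fubini_tonelli_F _ _ _ _ _ (lebesgue_rV n) F').
    apply: (measurableT_comp mFc); apply: measurable_fun_pair => //.
    exact: (measurableT_comp (measurable_rV_affine _ _)).
  by move=> p; exact: F0.
rewrite ge0_integralZl//=.
  exact: (measurableT_comp mG (measurable_affine _ _)).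
by move=> r _; exact: integral_ge0.
Qed.

End lebesgue_rV_theory.

(** * Complex integrals *)

Section complex_pointwise.
Variable R : realType.
Implicit Types (z w : R[i]) (a : R).
Local Notation Re := complex.Re.
Local Notation Im := complex.Im.
Local Notation normc := (@Normc.normc R).

Lemma ReM z w : Re (z * w) = Re z * Re w - Im z * Im w.
Proof. by case: z; case: w. Qed.

Lemma ImM z w : Im (z * w) = Re z * Im w + Im z * Re w.
Proof. by case: z; case: w. Qed.

Lemma ReD z w : Re (z + w) = Re z + Re w. Proof. by case: z; case: w. Qed.
Lemma ImD z w : Im (z + w) = Im z + Im w. Proof. by case: z; case: w. Qed.
Lemma ReB z w : Re (z - w) = Re z - Re w. Proof. by case: z; case: w. Qed.
Lemma ImB z w : Im (z - w) = Im z - Im w. Proof. by case: z; case: w. Qed.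
Lemma ReJ z : Re (conjc z) = Re z. Proof. by case: z. Qed.
Lemma ImJ z : Im (conjc z) = - Im z. Proof. by case: z. Qed.

Lemma complex_eq z w : Re z = Re w -> Im z = Im w -> z = w.
Proof. by case: z => a b; case: w => c e /= -> ->. Qed.

Lemma normc_ge0 z : 0 <= normc z.
Proof. by case: z => a b; exact: sqrtr_ge0. Qed.

Lemma normc_sqr z : normc z ^+ 2 = Re z ^+ 2 + Im z ^+ 2.
Proof. by case: z => a b /=; rewrite sqr_sqrtr// addr_ge0// sqr_ge0. Qed.

Lemma normcE z : normc z = Num.sqrt (Re z ^+ 2 + Im z ^+ 2).
Proof. by case: z. Qed.

Lemma ler_Re_normc z : `|Re z| <= normc z.
Proof. by rewrite normcE -sqrtr_sqr ler_wsqrtr// lerDl sqr_ge0. Qed.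

Lemma ler_Im_normc z : `|Im z| <= normc z.
Proof. by rewrite normcE -sqrtr_sqr ler_wsqrtr// lerDr sqr_ge0. Qed.

Lemma ler_normc_ReIm z : normc z <= `|Re z| + `|Im z|.
Proof.
rewrite -(ler_pXn2r (_ : 0 < 2)%N) ?nnegrE ?normc_ge0 ?addr_ge0//.
rewrite normc_sqr sqrrD !real_normK ?num_real// -addrA lerD2l lerDr.
by rewrite mulrn_wge0// mulr_ge0.
Qed.

Lemma normcJ z : normc (conjc z) = normc z.
Proof. by rewrite !normcE ReJ ImJ sqrrN. Qed.

Lemma normc_real a : normc (real_complex R a) = `|a|.
Proof. by rewrite normcE /= expr0n/= addr0 sqrtr_sqr. Qed.

Lemma normcN z : normc (- z) = normc z.
Proof. by rewrite !normcE; case: z => a b /=; rewrite !sqrrN. Qed.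

Lemma normc_expi a : normc (expi a) = 1.
Proof. by rewrite /expi /= cos2Dsin2 sqrtr1. Qed.

Lemma expiD a b : expi (a + b) = expi a * expi b :> R[i].
Proof. by apply: complex_eq; rewrite /= ?cosD ?sinD//; ring. Qed.

Lemma expi0 : expi 0 = 1 :> R[i].
Proof. by apply: complex_eq => /=; rewrite ?cos0 ?sin0. Qed.

Lemma conj_expi a : conjc (expi a) = expi (- a) :> R[i].
Proof. by apply: complex_eq => /=; rewrite ?cosN ?sinN. Qed.

Lemma mulr_real_complex a b : real_complex R (a * b) = real_complex R a * real_complex R b.
Proof. by rewrite rmorphM. Qed.

End complex_pointwise.

Section complex_integral.
Context {R : realType} {d : measure_display} {T : measurableType d}.
Local Notation Re := (@complex.Re R).
Local Notation Im := (@complex.Im R).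
Local Notation normc := (@Normc.normc R).
Implicit Types f g : T -> R[i].

(** The condition [cmeasurable] over an arbitrary measurable space, so that it also makes sense on
    products. On row vectors the two are convertible and are interchanged silently. *)
Definition cmeasurable_fun f :=
  measurable_fun setT (fun x => Re (f x)) /\ measurable_fun setT (fun x => Im (f x)).

Lemma cmeasurable_cst (c : R[i]) : cmeasurable_fun (cst c).
Proof. by split; exact: measurable_cst. Qed.

Lemma cmeasurable_real (h : T -> R) : measurable_fun setT h ->
  cmeasurable_fun (fun x => real_complex R (h x)).
Proof. by move=> mh; split => //=; exact: measurable_cst. Qed.

Lemma cmeasurable_expi (h : T -> R) : measurable_fun setT h ->
  cmeasurable_fun (fun x => expi (h x)).
Proof.
move=> mh; split => /=.
  apply: measurableT_comp mh.
  by apply: continuous_measurable_fun; exact: continuous_cos.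
apply: measurableT_comp mh.
by apply: continuous_measurable_fun; exact: continuous_sin.
Qed.

Lemma cmeasurableD f g : cmeasurable_fun f -> cmeasurable_fun g ->
  cmeasurable_fun (fun x => f x + g x).
Proof.
move=> [f1 f2] [g1 g2]; split.
  by under eq_fun do rewrite ReD; exact: measurable_funD.
by under eq_fun do rewrite ImD; exact: measurable_funD.
Qed.

Lemma cmeasurableB f g : cmeasurable_fun f -> cmeasurable_fun g ->
  cmeasurable_fun (fun x => f x - g x).
Proof.
move=> [f1 f2] [g1 g2]; split.
  by under eq_fun do rewrite ReB; exact: measurable_funB.
by under eq_fun do rewrite ImB; exact: measurable_funB.
Qed.

Lemma cmeasurableM f g : cmeasurable_fun f -> cmeasurable_fun g ->
  cmeasurable_fun (fun x => f x * g x).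
Proof.
move=> [f1 f2] [g1 g2]; split.
  by under eq_fun do rewrite ReM; apply: measurable_funB; exact: measurable_funM.
by under eq_fun do rewrite ImM; apply: measurable_funD; exact: measurable_funM.
Qed.

Lemma cmeasurableJ f : cmeasurable_fun f -> cmeasurable_fun (fun x => conjc (f x)).
Proof.
move=> [f1 f2]; split; first by under eq_fun do rewrite ReJ.
by under eq_fun do rewrite ImJ; exact: measurable_funN.
Qed.

Lemma measurable_normc f : cmeasurable_fun f ->
  measurable_fun setT (fun x => normc (f x)).
Proof.
move=> [f1 f2]; under eq_fun do rewrite normcE.
apply: measurableT_comp; last by apply: measurable_funD; exact: measurable_funX.
apply: continuous_measurable_fun; exact: (@sqrt_continuous R).
Qed.

Variable m : {measure set T -> \bar R}.

Definition cintegrable f :=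
  m.-integrable setT (fun x => (Re (f x))%:E) /\
  m.-integrable setT (fun x => (Im (f x))%:E).

(** [cintegral] for an arbitrary measure. At [lebesgue_rV n] the two are convertible, which is how
    [fourier1] and [inner] are brought under the lemmas below. *)
Definition cint f : R[i] :=
  Complex (\int[m]_x Re (f x)) (\int[m]_x Im (f x)).

Lemma cintegrable_measurable f : cintegrable f -> cmeasurable_fun f.
Proof. by move=> [/measurable_int/measurable_EFinP ? /measurable_int/measurable_EFinP ?]. Qed.

Lemma cintegrable_le f (g : T -> R) : cmeasurable_fun f ->
  m.-integrable setT (fun x => (g x)%:E) -> (forall x, normc (f x) <= g x) ->
  cintegrable f.
Proof.
move=> [f1 f2] ig fg; split; apply: le_integrable ig => //; try exact/measurable_EFinP;
move=> x _; rewrite /= lee_fin (le_trans _ (ler_norm _))// (le_trans _ (fg x))//.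
  exact: ler_Re_normc.
exact: ler_Im_normc.
Qed.

Lemma integrable_normc f : cintegrable f -> m.-integrable setT (fun x => (normc (f x))%:E).
Proof.
move=> cf; have mf := cintegrable_measurable cf; case: cf => f1 f2.
have := integrableD measurableT (integrable_abse f1) (integrable_abse f2).
apply: le_integrable => //; first exact/measurable_EFinP/measurable_normc.
move=> x _ /=; rewrite lee_fin ger0_norm ?normc_ge0// ger0_norm ?addr_ge0//.
exact: ler_normc_ReIm.
Qed.

Lemma cintegrableP f : cmeasurable_fun f ->
  cintegrable f <-> (\int[m]_x (normc (f x))%:E < +oo)%E.
Proof.
move=> mf; split=> [/integrable_normc/integrableP[_]|foo].
  by under eq_integral do rewrite gee0_abs ?lee_fin ?normc_ge0//.
apply: (cintegrable_le (g := fun x => normc (f x))) => //.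
apply/integrableP; split; first exact/measurable_EFinP/measurable_normc.
by under eq_integral do rewrite gee0_abs ?lee_fin ?normc_ge0//.
Qed.

Lemma cintegrableB f g : cintegrable f -> cintegrable g ->
  cintegrable (fun x => f x - g x).
Proof.
move=> [f1 f2] [g1 g2]; split.
  by under eq_fun do rewrite ReB EFinB; exact: integrableB.
by under eq_fun do rewrite ImB EFinB; exact: integrableB.
Qed.

Lemma cintegrableM f g (M : R) : cintegrable f -> cmeasurable_fun g ->
  (forall x, normc (g x) <= M) -> cintegrable (fun x => f x * g x).
Proof.
move=> cf mg gM.
have := integrableZl measurableT M (integrable_normc cf).
under eq_fun do rewrite -EFinM.
move=> iM; apply: (cintegrable_le _ iM).
  exact: (cmeasurableM (cintegrable_measurable cf)).
move=> x; rewrite Normc.normcM mulrC ler_wpM2r ?normc_ge0//.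
Qed.

Lemma cintegrableMl f g (M : R) : cintegrable f -> cmeasurable_fun g ->
  (forall x, normc (g x) <= M) -> cintegrable (fun x => g x * f x).
Proof. by move=> cf mg gM; under eq_fun do rewrite mulrC; exact: cintegrableM gM. Qed.

Lemma cintegrableZl c f : cintegrable f -> cintegrable (fun x => c * f x).
Proof.
by move=> cf; apply: (cintegrableMl cf (cmeasurable_cst c)) => x; exact: lexx.
Qed.

Lemma cintegrableJ f : cintegrable f -> cintegrable (fun x => conjc (f x)).
Proof.
move=> [f1 f2]; split; first by under eq_fun do rewrite ReJ.
by under eq_fun do rewrite ImJ EFinN; exact: integrableN.
Qed.

Lemma cintegrable_real (h : T -> R) : m.-integrable setT (fun x => (h x)%:E) ->
  cintegrable (fun x => real_complex R (h x)).
Proof. by move=> ih; split => //=; exact: integrable0. Qed.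

Lemma cintD f g : cintegrable f -> cintegrable g ->
  cint (fun x => f x + g x) = cint f + cint g.
Proof.
move=> [f1 f2] [g1 g2]; apply: complex_eq => /=.
  by under eq_Rintegral do rewrite ReD; rewrite RintegralD.
by under eq_Rintegral do rewrite ImD; rewrite RintegralD.
Qed.

Lemma cintB f g : cintegrable f -> cintegrable g ->
  cint (fun x => f x - g x) = cint f - cint g.
Proof.
move=> [f1 f2] [g1 g2]; apply: complex_eq => /=.
  by under eq_Rintegral do rewrite ReB; rewrite RintegralB.
by under eq_Rintegral do rewrite ImB; rewrite RintegralB.
Qed.

Lemma cintZl c f : cintegrable f -> cint (fun x => c * f x) = c * cint f.
Proof.
move=> [f1 f2]; have iZ k h : m.-integrable setT (fun x => (h x)%:E) ->
    m.-integrable setT (fun x => (k * h x)%:E).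
  by move=> ih; under eq_fun do rewrite EFinM; exact: integrableZl.
apply: complex_eq; rewrite ?ReM ?ImM /=.
  under eq_Rintegral do rewrite ReM.
  by rewrite RintegralB//; [rewrite !RintegralZl|exact: iZ..].
under eq_Rintegral do rewrite ImM.
by rewrite RintegralD//; [rewrite !RintegralZl|exact: iZ..].
Qed.

Lemma cintZr c f : cintegrable f -> cint (fun x => f x * c) = cint f * c.
Proof. by move=> cf; under eq_fun do rewrite mulrC; rewrite cintZl// mulrC. Qed.

Lemma cintJ f : cintegrable f -> conjc (cint f) = cint (fun x => conjc (f x)).
Proof.
move=> [f1 f2]; apply: complex_eq => /=.
  by under [in RHS]eq_Rintegral do rewrite ReJ.
under [in RHS]eq_Rintegral do rewrite ImJ -mulN1r.
by rewrite RintegralZl// mulN1r.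
Qed.

(** The real and the imaginary part each contribute at most the integral of the modulus, whence the
    2. It is the source of the constants 2 in all later estimates. *)
Lemma le_normc_cint f : cintegrable f ->
  ((normc (cint f))%:E <= 2%:E * \int[m]_x (normc (f x))%:E)%E.
Proof.
move=> cf; have inf := integrable_normc cf; have [f1 f2] := cf.
have -> : (\int[m]_x (normc (f x))%:E = (\int[m]_x normc (f x))%R%:E)%E.
  by rewrite -[LHS]fineK//; exact: integrable_fin_num.
rewrite -EFinM lee_fin (le_trans (ler_normc_ReIm _))//= mulr_natl mulr2n.
apply: lerD; apply: (le_trans (le_normr_Rintegral _ _)) => //; apply: le_Rintegral => //.
- exact: integrable_norm.
- by move=> x _; exact: ler_Re_normc.
- exact: integrable_norm.
- by move=> x _; exact: ler_Im_normc.
Qed.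

End complex_integral.

(** * Fubini's theorem for complex-valued functions *)

Section complex_fubini.
Context {R : realType} {d1 d2 : measure_display}.
Context {T1 : measurableType d1} {T2 : measurableType d2}.
Variables (m1 : {sigma_finite_measure set T1 -> \bar R}).
Variables (m2 : {sigma_finite_measure set T2 -> \bar R}).
Local Notation normc := (@Normc.normc R).

(** Integrability is asked of every section rather than of almost every one: the inner extended
    integrals are then finite everywhere, and [fine] can be undone pointwise without exceptional
    sets. *)
Lemma Rintegral_Fubini (f : T1 -> T2 -> R) :
  measurable_fun setT (fun p : T1 * T2 => f p.1 p.2) ->
  (\int[m1]_x \int[m2]_y `|f x y|%:E < +oo)%E ->
  (forall x, m2.-integrable setT (fun y => (f x y)%:E)) ->
  (forall y, m1.-integrable setT (fun x => (f x y)%:E)) ->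
  [/\ m1.-integrable setT (fun x => (\int[m2]_y f x y)%:E),
     (m1 \x m2)%E.-integrable setT (fun p => (f p.1 p.2)%:E),
     \int[(m1 \x m2)%E]_p f p.1 p.2 = \int[m1]_x \int[m2]_y f x y &
     \int[m1]_x \int[m2]_y f x y = \int[m2]_y \int[m1]_x f x y].
Proof.
move=> mf foo f1 f2.
pose F := fun p : T1 * T2 => (f p.1 p.2)%:E.
have mF : measurable_fun setT F by exact/measurable_EFinP.
have iF : (m1 \x m2)%E.-integrable setT F by exact/integrable12ltyP.
have E2 x : (\int[m2]_y F (x, y) = (\int[m2]_y f x y)%R%:E)%E.
  by rewrite -[LHS]fineK//; exact: (integrable_fin_num _ (f1 x)).
have E1 y : (\int[m1]_x F (x, y) = (\int[m1]_x f x y)%R%:E)%E.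
  by rewrite -[LHS]fineK//; exact: (integrable_fin_num _ (f2 y)).
split => //.
- by under eq_fun do rewrite -E2; exact: (integrable_fubini_F iF).
- rewrite /Rintegral; congr fine; rewrite -(integral12_prod_meas1 iF).
  by apply: eq_integral => x _; exact: E2.
- rewrite /Rintegral; congr fine.
  under eq_integral do rewrite -E2.
  under [RHS]eq_integral do rewrite -E1.
  exact: Fubini.
Qed.

Lemma cint_Fubini (f : T1 -> T2 -> R[i]) :
  cmeasurable_fun (fun p : T1 * T2 => f p.1 p.2) ->
  (\int[m1]_x \int[m2]_y (normc (f x y))%:E < +oo)%E ->
  (forall x, cintegrable m2 (fun y => f x y)) ->
  (forall y, cintegrable m1 (fun x => f x y)) ->
  [/\ cintegrable m1 (fun x => cint m2 (fun y => f x y)),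
     cintegrable (m1 \x m2)%E (fun p => f p.1 p.2),
     cint (m1 \x m2)%E (fun p => f p.1 p.2) = cint m1 (fun x => cint m2 (fun y => f x y)) &
     cint m1 (fun x => cint m2 (fun y => f x y)) =
     cint m2 (fun y => cint m1 (fun x => f x y))].
Proof.
move=> mf foo f1 f2; have mn := measurable_normc mf.
(* One bound on the double integral of the modulus serves both the real and the imaginary part. *)
have lty (h : T1 -> T2 -> R) : measurable_fun setT (fun p : T1 * T2 => h p.1 p.2) ->
    (forall x y, `|h x y| <= normc (f x y)) ->
    (\int[m1]_x \int[m2]_y `|h x y|%:E < +oo)%E.
  move=> mh hf; apply: le_lt_trans foo; apply: ge0_le_integral => //.
  - by move=> x _; exact: integral_ge0.
  - apply: (@measurable_fun_fubini_tonelli_F _ _ _ _ _ m2 (fun p => `|h p.1 p.2|%:E)) => //.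
    exact/measurable_EFinP/measurableT_comp.
  - apply: (@measurable_fun_fubini_tonelli_F _ _ _ _ _ m2 (fun p => (normc (f p.1 p.2))%:E)).
      exact/measurable_EFinP.
    by move=> p; rewrite lee_fin normc_ge0.
  - move=> x _; apply: ge0_le_integral => //.
    + apply/measurable_EFinP; apply: measurableT_comp => //.
      exact: (measurable_fun_pair2 x mh).
    + apply/measurable_EFinP; exact: (measurable_fun_pair2 x mn).
    + by move=> y _; rewrite lee_fin hf.
have [mr mi] := mf.
have [r1 r2 r3 r4] := @Rintegral_Fubini (fun x y => complex.Re (f x y)) mr
  (lty _ mr (fun x y => ler_Re_normc _)) (fun x => (f1 x).1) (fun y => (f2 y).1).
have [i1 i2 i3 i4] := @Rintegral_Fubini (fun x y => complex.Im (f x y)) mi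
  (lty _ mi (fun x y => ler_Im_normc _)) (fun x => (f1 x).2) (fun y => (f2 y).2).
by split; [split|split|apply: complex_eq|apply: complex_eq].
Qed.

Lemma cint_tensor (u : T1 -> R[i]) (v : T2 -> R[i]) :
  cintegrable m1 u -> cintegrable m2 v ->
  cintegrable (m1 \x m2)%E (fun p => u p.1 * v p.2) /\
  cint (m1 \x m2)%E (fun p => u p.1 * v p.2) = cint m1 u * cint m2 v.
Proof.
move=> iu iv; have mu := cintegrable_measurable iu; have mv := cintegrable_measurable iv.
have [] // := @cint_Fubini (fun x y => u x * v y).
- apply: cmeasurableM; split.
  + exact: (measurableT_comp mu.1 measurable_fst).
  + exact: (measurableT_comp mu.2 measurable_fst).
  + exact: (measurableT_comp mv.1 measurable_snd).
  + exact: (measurableT_comp mv.2 measurable_snd).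
- have iU := (cintegrableP m1 mu).1 iu; have iV := (cintegrableP m2 mv).1 iv.
  under eq_integral => x _.
    under eq_integral do rewrite Normc.normcM EFinM.
    rewrite ge0_integralZl_EFin ?normc_ge0//; last 2 first.
    - by move=> y _; rewrite lee_fin normc_ge0.
    - exact/measurable_EFinP/measurable_normc.
    over.
  rewrite ge0_integralZr//=; last 3 first.
  - exact/measurable_EFinP/measurable_normc.
  - by move=> y _; rewrite lee_fin normc_ge0.
  - by apply: integral_ge0 => x _; rewrite lee_fin normc_ge0.
  rewrite lte_mul_pinfty//; first by apply: integral_ge0 => x _; rewrite lee_fin normc_ge0.
  rewrite ge0_fin_numE//; by apply: integral_ge0 => x _; rewrite lee_fin normc_ge0.
- by move=> x; exact: cintegrableZl.
- by move=> y; under eq_fun do rewrite mulrC; exact: cintegrableZl.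
move=> _ iuv -> _; split => //.
under [X in cint m1 X]eq_fun do rewrite cintZl//.
by rewrite cintZr.
Qed.

End complex_fubini.

(** * Complex integrals over R^n: products of one-variable functions and affine substitutions *)

Section complex_integral_rV.
Variable R : realType.
Local Notation leb := (@lebesgue_measure R).
Local Notation normc := (@Normc.normc R).

Lemma cmeasurable_comp {d1 d2} {T1 : measurableType d1} {T2 : measurableType d2}
    (f : T2 -> R[i]) (g : T1 -> T2) :
  cmeasurable_fun f -> measurable_fun setT g -> cmeasurable_fun (fun x => f (g x)).
Proof. by move=> [f1 f2] mg; split; [exact: (measurableT_comp f1)|exact: (measurableT_comp f2)].
  Qed.

Lemma integrable_rVS n (f : 'rV[R]_n.+1 -> \bar R) : measurable_fun setT f ->
  (lebesgue_rV n.+1).-integrable setT f <->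
  (leb \x lebesgue_rV n)%E.-integrable setT (f \o @rV_cons R n).
Proof.
move=> mf; have mfc := measurableT_comp mf (@measurable_rV_cons R n).
have E : (\int[lebesgue_rV n.+1]_x `|f x| = \int[(leb \x lebesgue_rV n)]_x `|(f \o @rV_cons R n)
  x|)%E.
  rewrite (ge0_integral_pushforward (@measurable_rV_cons R n) (leb \x lebesgue_rV n)%E)//.
  exact: measurableT_comp.
split=> /integrableP[_ foo]; apply/integrableP; split => //.
  by rewrite -E.
by rewrite E.
Qed.

Lemma integral_rVS n (f : 'rV[R]_n.+1 -> \bar R) :
  (lebesgue_rV n.+1).-integrable setT f ->
  (\int[lebesgue_rV n.+1]_x f x = \int[(leb \x lebesgue_rV n)]_p f (rV_cons p))%E.
Proof.
move=> fi; have mf := measurable_int _ fi.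
by rewrite (integral_pushforward (@measurable_rV_cons R n))//; exact/integrable_rVS.
Qed.

Lemma cintegrable_rVS n (f : 'rV[R]_n.+1 -> R[i]) : cmeasurable_fun f ->
  cintegrable (lebesgue_rV n.+1) f <->
  cintegrable (leb \x lebesgue_rV n)%E (fun p => f (rV_cons p)).
Proof.
move=> [mr mi]; split=> -[ir ii]; split.
- exact: ((integrable_rVS ((measurable_EFinP _ _).2 mr)).1 ir).
- exact: ((integrable_rVS ((measurable_EFinP _ _).2 mi)).1 ii).
- by apply/integrable_rVS => //; exact/measurable_EFinP.
- by apply/integrable_rVS => //; exact/measurable_EFinP.
Qed.

Lemma cint_rVS n (f : 'rV[R]_n.+1 -> R[i]) : cintegrable (lebesgue_rV n.+1) f ->
  cint (lebesgue_rV n.+1) f = cint (leb \x lebesgue_rV n)%E (fun p => f (rV_cons p)).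
Proof.
by move=> [ir ii]; apply: complex_eq; rewrite /= /Rintegral integral_rVS.
Qed.

(** By induction through [cint_tensor]; it reduces the transform of a Gaussian on R^n to
    one-dimensional integrals. In dimension 0 the measure is a Dirac mass and both products are
    empty. *)
Lemma cint_prod n (h : 'I_n -> R -> R[i]) :
  (forall i, cintegrable leb (h i)) ->
  cintegrable (lebesgue_rV n) (fun x => \prod_(i < n) h i (x ord0 i)) /\
  cint (lebesgue_rV n) (fun x => \prod_(i < n) h i (x ord0 i)) =
  \prod_(i < n) cint leb (h i).
Proof.
elim: n h => [|n IH] h ih.
  under eq_fun do rewrite big_ord0; rewrite big_ord0.
  have E (r : R) : (\int[@lebesgue_rV R 0]_x (cst r%:E) x)%E = r%:E.
    by rewrite integral_dirac//= diracT mul1e.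
  have I (r : R) : (@lebesgue_rV R 0).-integrable setT (cst r%:E).
    by apply/integrableP; split; [exact: measurable_cst|rewrite (E `|r|) ltry].
  split; first by split; exact: I.
  by apply: complex_eq; rewrite /= /Rintegral; [rewrite (E 1)|rewrite (E 0)].
have [iP cP] := IH (fun i => h (lift ord0 i)) (fun i => ih (lift ord0 i)).
have [iT cT] := cint_tensor (ih ord0) iP.
have Eh p : \prod_(i < n.+1) h i ((@rV_cons R n p) ord0 i) =
    h ord0 p.1 * \prod_(i < n) h (lift ord0 i) (p.2 ord0 i).
  rewrite big_ord_recl !mxE unlift_none/=; congr (_ * _).
  by apply: eq_bigr => i _; rewrite !mxE liftK.
have iL : cintegrable (lebesgue_rV n.+1) (fun x => \prod_(i < n.+1) h i (x ord0 i)).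
  apply/cintegrable_rVS; last by under eq_fun do rewrite Eh.
  have mu := cmeasurable_comp (cintegrable_measurable iT) (@measurable_rV_uncons R n).
  rewrite (_ : (fun x => _) = (fun x => h ord0 (rV_uncons x).1 *
     \prod_(i < n) h (lift ord0 i) ((rV_uncons x).2 ord0 i)))//.
  apply/funext => x /=; rewrite big_ord_recl; congr (_ * _).
  by apply: eq_bigr => i _; rewrite mxE.
split => //; rewrite cint_rVS//; under [X in cint _ X]eq_fun do rewrite Eh.
by rewrite cT cP big_ord_recl.
Qed.

Lemma integrable_rV_affine n (a : R) (t : 'rV[R]_n) (f : 'rV[R]_n -> \bar R) : a != 0 ->
  (lebesgue_rV n).-integrable setT f ->
  (lebesgue_rV n).-integrable setT (fun x => f (a *: x + t)).
Proof.
move=> a0 /integrableP[mf foo]; apply/integrableP; split.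
  exact: (measurableT_comp mf (measurable_rV_affine _ _)).
move: foo; rewrite (ge0_integral_rV_affine t a0)//; last exact: measurableT_comp.
apply: contraTT; rewrite -!leNgt !leye_eq => /eqP ->.
by rewrite mulry gtr0_sg ?mul1e// exprn_gt0// normr_gt0.
Qed.

Lemma integral_rV_affine n (a : R) (t : 'rV[R]_n) (f : 'rV[R]_n -> \bar R) : a != 0 ->
  (lebesgue_rV n).-integrable setT f ->
  (\int[lebesgue_rV n]_x f x = (`|a| ^+ n)%:E * \int[lebesgue_rV n]_x f (a *: x + t)%R)%E.
Proof.
move=> a0 fi; have fi' := integrable_rV_affine t a0 fi.
have mf := measurable_int _ fi.
rewrite [LHS]integralE [in RHS]integralE (ge0_integral_rV_affine t a0)//;
  last exact: measurable_funepos.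
rewrite (ge0_integral_rV_affine t a0 (F := f^\-%E))//; last exact: measurable_funeneg.
rewrite [RHS]muleBr//; last exact: (integrable_add_def _ fi').
pose h := (fun x : 'rV[R]_n => a *: x + t).
by rewrite -[(fun x => f (a *: x + t))]/(f \o h) (funepos_comp f h) (funeneg_comp f h).
Qed.

Lemma cintegrable_rV_affine n (a : R) (t : 'rV[R]_n) (f : 'rV[R]_n -> R[i]) : a != 0 ->
  cintegrable (lebesgue_rV n) f ->
  cintegrable (lebesgue_rV n) (fun x => f (a *: x + t)).
Proof.
by move=> a0 [ir ii]; split;
 [exact: (integrable_rV_affine t a0 ir)|exact: (integrable_rV_affine t a0 ii)].
Qed.

Lemma cint_rV_affine n (a : R) (t : 'rV[R]_n) (f : 'rV[R]_n -> R[i]) : a != 0 ->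
  cintegrable (lebesgue_rV n) f ->
  cint (lebesgue_rV n) f =
  real_complex R (`|a| ^+ n) * cint (lebesgue_rV n) (fun x => f (a *: x + t)).
Proof.
move=> a0 [ir ii].
apply: complex_eq; rewrite ?ReM ?ImM /= mul0r ?subr0 ?addr0 /Rintegral.
  rewrite (integral_rV_affine t a0)// fineM//.
  exact: (integrable_fin_num _ (integrable_rV_affine t a0 ir)).
rewrite (integral_rV_affine t a0)// fineM//.
exact: (integrable_fin_num _ (integrable_rV_affine t a0 ii)).
Qed.

End complex_integral_rV.

(** * The Fourier transform of Gaussians *)

Section gauss_fourier1.
Variable R : realType.
Local Notation leb := (@lebesgue_measure R).
Local Notation g := (@gauss_fun R).

Lemma is_derive_mulrl (x w : R) : is_derive w (1 : R) (fun w => w * x) x.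
Proof. by apply: is_derive_eq; rewrite scaler0 add0r /GRing.scale/= mulr1. Qed.

Lemma is_derive_mulrr (x w : R) : is_derive w (1 : R) ( *%R x) x.
Proof.
rewrite [X in is_derive _ _ X _](_ : _ = (fun w => w * x)).
  exact: is_derive_mulrl.
by apply/funext => y; rewrite mulrC.
Qed.

Lemma is_derive_gauss (x : R) : is_derive x (1 : R) g (- (x * 2) * g x).
Proof.
have h : is_derive x (1 : R) (fun x : R => - x ^+ 2) (- (x * 2)).
  by apply: is_derive_eq; rewrite /GRing.scale/=; ring.
have h' := @is_derive1_comp R expR _ x _ _ (is_derive_expR _) h.
by rewrite mulrC; exact: h'.
Qed.

Lemma is_derive_gauss_sin (w x : R) :
  is_derive x (1 : R) (fun x => g x * sin (w * x))
    (w * (g x * cos (w * x)) - 2 * (g x * x * sin (w * x))).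
Proof.
have h := @is_derive1_comp R sin _ x _ _ (is_derive_sin _) (is_derive_mulrr w x).
apply: (is_derive_eq (is_deriveM (is_derive_gauss x) h)).
by rewrite /GRing.scale /=; ring.
Qed.

Lemma is_derive_gauss_cos (w x : R) :
  is_derive w (1 : R) (fun w => g x * cos (w * x)) (- (g x * x * sin (w * x))).
Proof.
have h := @is_derive1_comp R cos _ w _ _ (is_derive_cos _) (is_derive_mulrl x w).
apply: (is_derive_eq (is_deriveM (is_derive_cst (g x) w (1 : R)) h)).
by rewrite /GRing.scale /=; ring.
Qed.

Lemma integrable_gauss_scale (a : R) : a != 0 ->
  leb.-integrable setT (fun x => (g (a * x))%:E).
Proof.
move=> a0; have /integrableP[mg] := @integrableT_gauss R.
rewrite (ge0_integral_affine 0 a0)//; last exact: measurableT_comp.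
under eq_integral do rewrite addr0.
move=> foo; apply/integrableP; split.
  apply/measurable_EFinP/measurableT_comp; first exact: measurable_gauss_fun.
  exact: measurable_funM.
move: foo; apply: contraTT; rewrite -!leNgt !leye_eq => /eqP ->.
by rewrite mulry gtr0_sg ?mul1e// normr_gt0.
Qed.

(** Since [|x| <= 1 + x^2/2 <= exp(x^2/2)], the function is at most [exp(-x^2/2)], a rescaled
    Gaussian. It serves as the dominating function for differentiation under the integral sign. *)
Lemma integrable_gauss_mulr :
  leb.-integrable setT (fun x => (g x * `|x|)%:E).
Proof.
have s2 : (Num.sqrt 2)^-1 != 0 :> R by rewrite invr_eq0 gt_eqF// sqrtr_gt0.
apply: le_integrable (integrable_gauss_scale s2) => //.
  apply/measurable_EFinP; apply: measurable_funM; first exact: measurable_gauss_fun.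
  exact: normr_measurable.
move=> x _; rewrite lee_fin /= ger0_norm ?mulr_ge0 ?gauss_fun_ge0//.
rewrite [leRHS]ger0_norm ?gauss_fun_ge0// /gauss_fun exprMn exprVn sqr_sqrtr//.
have := expR_ge1Dx (2^-1 * x ^+ 2) => h.
have {h} : `|x| <= expR (2^-1 * x ^+ 2).
  apply: le_trans h; rewrite -[x ^+ 2]real_normK ?num_real//.
  by have := sqr_ge0 (`|x| - 1); nra.
move=> /(ler_wpM2l (expR_ge0 (- x ^+ 2))) /le_trans; apply.
by rewrite -expRD ler_expR; lra.
Qed.

Lemma integrable_gauss_bounded (h : R -> R) : measurable_fun setT h ->
  (forall x, `|h x| <= 1) -> leb.-integrable setT (fun x => (g x * h x)%:E).
Proof.
move=> mh h1; apply: le_integrable (@integrableT_gauss R) => //.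
  apply/measurable_EFinP; apply: measurable_funM => //; exact: measurable_gauss_fun.
by move=> x _; rewrite lee_fin normrM ler_piMr.
Qed.

Lemma measurable_cosM (w : R) : measurable_fun setT (fun x : R => cos (w * x)).
Proof.
apply: measurableT_comp; last exact: measurable_funM.
by apply: continuous_measurable_fun; exact: continuous_cos.
Qed.

Lemma measurable_sinM (w : R) : measurable_fun setT (fun x : R => sin (w * x)).
Proof.
apply: measurableT_comp; last exact: measurable_funM.
by apply: continuous_measurable_fun; exact: continuous_sin.
Qed.

Lemma integrable_gauss_cos (w : R) : leb.-integrable setT (fun x => (g x * cos (w * x))%:E).
Proof.
apply: integrable_gauss_bounded; first exact: measurable_cosM.
by move=> x; rewrite ler_norml cos_geN1 cos_le1.
Qed.

Lemma integrable_gauss_sin (w : R) : leb.-integrable setT (fun x => (g x * sin (w * x))%:E).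
Proof.
apply: integrable_gauss_bounded; first exact: measurable_sinM.
by move=> x; rewrite ler_norml sin_geN1 sin_le1.
Qed.

Lemma integrable_gauss_mulr_sin (w : R) :
  leb.-integrable setT (fun x => (g x * x * sin (w * x))%:E).
Proof.
apply: le_integrable integrable_gauss_mulr => //.
  apply/measurable_EFinP; apply: measurable_funM; last exact: measurable_sinM.
  by apply: measurable_funM => //; exact: measurable_gauss_fun.
move=> x _; rewrite lee_fin !normrM normr_id ler_piMr ?mulr_ge0//.
by rewrite ler_norml sin_geN1 sin_le1.
Qed.

(** The reflection [x |-> -x] exchanges the positive and the negative part. This kills the imaginary
    part of the transform of a Gaussian. *)
Lemma Rintegral_odd (h : R -> R) : leb.-integrable setT (fun x => (h x)%:E) ->
  (forall x, h (- x) = - h x) -> \int[leb]_x h x = 0.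
Proof.
move=> ih hN.
have mh : measurable_fun setT (EFin \o h) := measurable_int _ ih.
have N1 : -1 != 0 :> R by rewrite oppr_eq0 oner_eq0.
have E : (\int[leb]_x (EFin \o h)^\+ x = \int[leb]_x (EFin \o h)^\- x)%E.
  rewrite (ge0_integral_affine 0 N1)//; last exact: measurable_funepos.
  rewrite normrN1 mul1e; apply: eq_integral => x _.
  by rewrite funeposE funenegE /= addr0 mulN1r hN.
rewrite /Rintegral integralE -[fun x => (h x)%:E]/(EFin \o h) E subee//.
exact: (integrable_neg_fin_num _ ih).
Qed.

(* The derivative of g(x) sin(wx) has integral 0 over R. *)
Lemma gauss_by_parts (w : R) :
  2 * (\int[leb]_x (g x * x * sin (w * x))) = w * \int[leb]_x (g x * cos (w * x)).
Proof.
pose F x := g x * sin (w * x).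
pose f x := w * (g x * cos (w * x)) - 2 * (g x * x * sin (w * x)).
have dF x : derivable F x 1 by case: (is_derive_gauss_sin w x).
have dFf x : F^`()%classic x = f x.
  by rewrite derive1E; case: (is_derive_gauss_sin w x).
have i1 : leb.-integrable setT (fun x => (w * (g x * cos (w * x)))%:E).
  by under eq_fun do rewrite EFinM; apply: integrableZl => //; exact: integrable_gauss_cos.
have i2 : leb.-integrable setT (fun x => (2 * (g x * x * sin (w * x)))%:E).
  by under eq_fun do rewrite EFinM; apply: integrableZl => //; exact: integrable_gauss_mulr_sin.
have fi : leb.-integrable setT (fun x => (f x)%:E).
  by under eq_fun do rewrite EFinB; apply: integrableB.
have cF : continuous F.
  by move=> x; apply: differentiable_continuous; apply/derivable1_diffP.
have cf : continuous f.
  move=> x; have cg := @continuous_gauss_fun R.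
  have cs : {for x, continuous (fun x => sin (w * x))}.
    by apply: continuous_comp; [exact: mulrl_continuous|exact: continuous_sin].
  have cc : {for x, continuous (fun x => cos (w * x))}.
    by apply: continuous_comp; [exact: mulrl_continuous|exact: continuous_cos].
  apply: cvgB; apply: cvgM; try exact: cvg_cst.
    by apply: cvgM => //; exact: cg.
  by apply: cvgM => //; apply: cvgM; [exact: cg|exact: cvg_id].
(* The endpoints are [n.+1] and not [n] because the fundamental theorem of calculus is stated for
   nondegenerate intervals. *)
have FTC n : (\int[leb]_(x in `[(- n.+1%:R)%R,
  n.+1%:R%R]%classic) (f x)%:E = (F n.+1%:R - F (- n.+1%:R))%R%:E)%E.
  rewrite EFinB; apply: continuous_FTC2.
  - by rewrite (@lt_trans _ _ 0) ?oppr_lt0.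
  - exact: continuous_subspaceT.
  - split; first by move=> x _; exact: dF.
    + by apply: cvg_at_right_filter; exact: cF.
    + by apply: cvg_at_left_filter; exact: cF.
  - by move=> x _; exact: dFf.
have lim0 : (F n.+1%:R - F (- n.+1%:R))%:E @[n --> \oo] --> 0%:E.
  have gn : g n.+1%:R @[n --> \oo] --> (0 : R).
    apply: (@cvg_comp _ _ _ (fun n => n.+1%:R) g _ +oo _ _ (@cvg_gauss_fun R)).
    by apply/cvgryPge => A; near=> n; rewrite (@le_trans _ _ n%:R) ?ler_nat//; near: n;
      exact: nbhs_infty_ger.
  have Fb x : `|F x| <= g x.
    by rewrite /F normrM ger0_norm ?gauss_fun_ge0// ler_piMr ?gauss_fun_ge0// ler_norml sin_geN1
      sin_le1.
  have gN x : g (- x) = g x by rewrite /gauss_fun sqrrN.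
  apply: cvg_EFin; first exact: nearW.
  apply: (@squeeze_cvgr _ _ _ _ (fun n => - (2 * g n.+1%:R)) (fun n => 2 * g n.+1%:R)).
  - near=> n; have := Fb n.+1%:R; have := Fb (- n.+1%:R).
    by rewrite gN /= !ler_norml => /andP[? ?] /andP[? ?]; apply/andP; split; lra.
  - by rewrite -oppr0; apply: cvgN; rewrite -(mulr0 2); apply: cvgM gn; exact: cvg_cst.
  - by rewrite -(mulr0 2); apply: cvgM gn; exact: cvg_cst.
have limf : (\int[leb]_(x in `[(- n.+1%:R)%R, n.+1%:R%R]%classic) (f x)%:E)%E @[n --> \oo]
     --> (\int[leb]_x (f x)%:E)%E.
  pose fn n := (fun x => (f x)%:E) \_ `[(- n.+1%:R), n.+1%:R]%classic.
  under eq_fun do rewrite integral_mkcond.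
  have mf : measurable_fun setT (fun x => (f x)%:E) := measurable_int _ fi.
  have mfn n : measurable_fun setT (fn n).
    by apply/(measurable_restrictT _ _).1 => //; exact: measurable_funS mf.
  have [] // := @dominated_convergence _ _ _ leb setT measurableT fn
    (fun x => (f x)%:E) (fun x => `|f x|%:E) mfn mf.
  - apply: aeW => x _; apply: cvg_near_cst; near=> n.
    rewrite /fn patchE ifT// inE/= in_itv/= -ler_norml (@le_trans _ _ n%:R) ?ler_nat//.
    by near: n; exact: nbhs_infty_ger.
  - exact: integrable_abse fi.
  - by apply: aeW => x n _; rewrite /fn patchE; case: ifPn => _; rewrite ?lee_fin ?normr0.
have : (\int[leb]_x (f x)%:E = 0%:E)%E.
  have limF : (F n.+1%:R - F (- n.+1%:R))%R%:E @[n --> \oo] --> (\int[leb]_x (f x)%:E)%E.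
    by under eq_fun do rewrite -FTC; exact: limf.
  by apply: cvg_unique limF lim0; exact: ereal_hausdorff.
move=> /(congr1 fine) /=; rewrite -/(Rintegral _ _ _) RintegralB// RintegralZl//;
  last exact: integrable_gauss_cos.
rewrite RintegralZl//; last exact: integrable_gauss_mulr_sin.
by move/eqP; rewrite subr_eq0 => /eqP.
Unshelve. all: by end_near. Qed.

Lemma is_derive_gauss_cos_integral (w : R) :
  is_derive w (1 : R) (fun w => \int[leb]_x (g x * cos (w * x)))
    (- (\int[leb]_x (g x * x * sin (w * x)))).
Proof.
(* The bound [g x * |x|] on the derivative does not depend on w, so any open interval around w will
   do. *)
have Iw : `](w - 1), (w + 1)[%classic w by rewrite /= in_itv/=; apply/andP; split; lra.
pose f (w x : R) := g x * cos (w * x).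
have pf w' x : partial1of2 f w' x = - (g x * x * sin (w' * x)).
  by rewrite partial1of2E; case: (is_derive_gauss_cos w' x).
have h1 w' : `](w - 1), (w + 1)[%classic w' -> leb.-integrable setT (EFin \o f w').
  by move=> _; exact: integrable_gauss_cos.
have h2 w' x : `](w - 1), (w + 1)[%classic w' -> setT x -> derivable (f^~ x) w' 1.
  by move=> _ _; case: (is_derive_gauss_cos w' x).
have h3 x : 0 <= g x * `|x| by rewrite mulr_ge0 ?gauss_fun_ge0.
have h4 w' x : `](w - 1), (w + 1)[%classic w' -> setT x -> `|partial1of2 f w' x| <= g x * `|x|.
  move=> _ _; rewrite pf normrN !normrM ger0_norm ?gauss_fun_ge0//.
  by rewrite ler_piMr ?mulr_ge0 ?gauss_fun_ge0// ler_norml sin_geN1 sin_le1.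
have D := @derivable_under_integral _ _ _ leb f setT measurableT w _ _ Iw h1 h2 _ h3
  integrable_gauss_mulr h4.
have E := @differentiation_under_integral _ _ _ leb f setT measurableT w _ _ Iw h1 h2 _ h3
  integrable_gauss_mulr h4.
apply: DeriveDef => //; rewrite -derive1E E.
under eq_Rintegral do rewrite pf -mulN1r.
by rewrite RintegralZl//; [rewrite mulN1r|exact: integrable_gauss_mulr_sin].
Qed.

(** Differentiation under the integral and [gauss_by_parts] give [J' = -(w/2) J] for the integral J.
    Hence [J(w) exp(w^2/4)] is constant, and its value at 0 is the Gaussian integral. *)
Lemma Rintegral_gauss_cos (w : R) :
  \int[leb]_x (g x * cos (w * x)) = Num.sqrt pi * expR (- (w ^+ 2 / 4)).
Proof.
pose J w := \int[leb]_x (g x * cos (w * x)).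
pose H w := J w * expR (w ^+ 2 / 4).
have J0 : J 0 = Num.sqrt pi.
  rewrite /J; under eq_Rintegral do rewrite mul0r cos0 mulr1.
  by rewrite /Rintegral integralT_gauss.
have dH (x : R) : is_derive x (1 : R) H 0.
  have h1 : is_derive x (1 : R) (fun w : R => w ^+ 2 / 4) (x / 2).
    by apply: is_derive_eq; rewrite /GRing.scale/=; field.
  have h2 := @is_derive1_comp R expR _ x _ _ (is_derive_expR _) h1.
  apply: (is_derive_eq (is_deriveM (is_derive_gauss_cos_integral x) h2)).
  rewrite /GRing.scale /=.
  have := gauss_by_parts x; set A := \int[_]_x0 _; set B := \int[_]_x0 _ => AB.
  have -> : A = x * B / 2 by rewrite -AB; field.
  by ring.
have : H w = H 0 by apply: is_derive_0_is_cst.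
rewrite /H J0 expr0n/= mul0r expR0 mulr1 => <-.
by rewrite -mulrA -expRD subrr expR0 mulr1.
Qed.

End gauss_fourier1.

(** * Gaussians on R^n and their transforms *)

Section gauss_rV.
Variables (R : realType) (n : nat).
Local Notation V := 'rV[R]_n.
Local Notation mu := (@lebesgue_rV R n).
Local Notation normc := (@Normc.normc R).
Implicit Types (x y w t : V) (a : R).

Lemma dotC x y : dot x y = dot y x.
Proof. by apply: eq_bigr => i _; rewrite mulrC. Qed.

Lemma dotDr x y w : dot w (x + y) = dot w x + dot w y.
Proof. by rewrite /dot -big_split; apply: eq_bigr => i _; rewrite mxE mulrDr. Qed.

Lemma dotZr a x w : dot w (a *: x) = a * dot w x.
Proof. by rewrite /dot big_distrr; apply: eq_bigr => i _; rewrite mxE /=; ring. Qed.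

Lemma dotNr x w : dot w (- x) = - dot w x.
Proof. by rewrite -scaleN1r dotZr mulN1r. Qed.

Lemma dotBr x y w : dot w (x - y) = dot w x - dot w y.
Proof. by rewrite dotDr dotNr. Qed.

Lemma dotZl a x w : dot (a *: w) x = a * dot w x.
Proof. by rewrite dotC dotZr dotC. Qed.

Lemma dotBl x y w : dot (x - y) w = dot x w - dot y w.
Proof. by rewrite dotC dotBr !(dotC w). Qed.

Lemma dot_ge0 x : 0 <= dot x x.
Proof. by apply: sumr_ge0 => i _; rewrite -expr2 sqr_ge0. Qed.

Lemma measurable_dot {d} {T : measurableType d} (f g : T -> V) :
  measurable_fun setT f -> measurable_fun setT g ->
  measurable_fun setT (fun p => dot (f p) (g p)).
Proof.
move=> mf mg; apply: measurable_sum => i; apply: measurable_funM.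
  exact: (measurableT_comp (measurable_rV_coord i) mf).
exact: (measurableT_comp (measurable_rV_coord i) mg).
Qed.

(** The normalization is that of [gauss_fun], so that [gauss] is a product over the coordinates. It
    is not its own transform: a dilation by pi and the constant [gauss_peak] appear. *)
Definition gauss x : R := expR (- dot x x).

Lemma gauss_gt0 x : 0 < gauss x. Proof. exact: expR_gt0. Qed.
Lemma gauss_ge0 x : 0 <= gauss x. Proof. exact: expR_ge0. Qed.

Lemma gauss_le1 x : gauss x <= 1.
Proof. by rewrite -[leRHS]expR0 ler_expR oppr_le0 dot_ge0. Qed.

Lemma gauss_prod x : gauss x = \prod_(i < n) gauss_fun (x ord0 i).
Proof.
rewrite /gauss /dot -sumrN expR_sum; apply: eq_bigr => i _.
by rewrite /gauss_fun expr2.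
Qed.

Lemma measurable_gauss : measurable_fun setT gauss.
Proof.
apply: (measurableT_comp (@measurable_expR R)).
by apply: measurable_funN; apply: measurable_dot; exact: measurable_id.
Qed.

(** This is pi^(n/2), the integral of [gauss] and the value of its transform at 0. *)
Definition gauss_peak : R := Num.sqrt pi ^+ n.

Lemma gauss_peak_gt0 : 0 < gauss_peak.
Proof. by rewrite exprn_gt0// sqrtr_gt0 pi_gt0. Qed.

Lemma measurable_expi_dot {d} {T : measurableType d} (f g : T -> V) :
  measurable_fun setT f -> measurable_fun setT g ->
  cmeasurable_fun (fun p => expi (- (2 * pi * dot (f p) (g p)))).
Proof.
move=> mf mg; apply: cmeasurable_expi; apply: measurable_funN.
by apply: measurable_funM => //; exact: measurable_dot.
Qed.

Lemma fourier1E (f : V -> R[i]) w :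
  fourier1 f w = cint mu (fun x => f x * expi (- (2 * pi * dot w x))).
Proof. by []. Qed.

(** The exponential of a dot product splits over the coordinates, as [gauss] does. In each
    coordinate the cosine integral at frequency [2 pi w_i] gives [exp(-(2 pi w_i)^2 / 4)], which is
    [gauss_fun (pi w_i)], and the sine integral is odd. *)
Lemma fourier1_gauss_aux w :
  cintegrable mu (fun x => real_complex R (gauss x) * expi (- (2 * pi * dot w x))) /\
  fourier1 (fun x => real_complex R (gauss x)) w =
    real_complex R (gauss_peak * gauss (pi *: w)).
Proof.
pose h (i : 'I_n) (r : R) : R[i] :=
  real_complex R (gauss_fun r) * expi (- (2 * pi * (w ord0 i * r))).
have hE i r : h i r = Complex (gauss_fun r * cos (2 * pi * w ord0 i * r))
    (- (gauss_fun r * sin (2 * pi * w ord0 i * r))).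
  by rewrite /h mulrA /expi cosN sinN; apply: complex_eq; rewrite /= ?mulrN; ring.
have ih i : cintegrable lebesgue_measure (h i).
  split; under eq_fun do rewrite hE/=; first exact: integrable_gauss_cos.
  under eq_fun do rewrite EFinN.
  by apply: integrableN => //; exact: integrable_gauss_sin.
have ch i : cint lebesgue_measure (h i) =
    real_complex R (Num.sqrt pi * gauss_fun (pi * w ord0 i)).
  rewrite (funext (hE i)); apply: complex_eq => /=.
    rewrite Rintegral_gauss_cos /gauss_fun; congr (_ * expR (- _)).
    by field.
  apply: Rintegral_odd => [|r].
    under eq_fun do rewrite EFinN.
    by apply: integrableN => //; exact: integrable_gauss_sin.
  by rewrite /gauss_fun sqrrN mulrN sinN mulrN.
have [iP cP] := cint_prod ih.
have fE : (fun x => real_complex R (gauss x) * expi (- (2 * pi * dot w x))) =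
    (fun x => \prod_(i < n) h i (x ord0 i)).
  apply/funext => x; rewrite big_split/= gauss_prod rmorph_prod; congr (_ * _).
  rewrite /dot big_distrr -sumrN/=.
  by elim/big_ind2 : _ => [|a b c e <- <-|//]; rewrite ?expi0// expiD.
rewrite fourier1E fE; split=> //; rewrite cP.
under eq_bigr do rewrite ch; rewrite -rmorph_prod big_split/= gauss_prod.
congr (real_complex _ (_ * _)); first by rewrite prodr_const card_ord.
by apply: eq_bigr => i _; rewrite mxE.
Qed.

(** Read off from the transform at frequency 0, where the exponential factor is 1; the total mass is
    obtained in the same way below. *)
Lemma integrable_gauss : mu.-integrable setT (fun x => (gauss x)%:E).
Proof.
have [[+ _] _] := fourier1_gauss_aux 0; apply: eq_integrable => // x _.
by rewrite ReM /= dotC -(scale0r x) dotZr mul0r mulr0 oppr0 cos0 mulr1 mul0r subr0.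
Qed.

Lemma integral_gauss : (\int[mu]_x (gauss x)%:E = gauss_peak%:E)%E.
Proof.
have [_] := fourier1_gauss_aux 0; rewrite scaler0 => /(congr1 (@complex.Re R)) /=.
have -> : gauss 0 = 1 by rewrite /gauss -(scale0r (0 : V)) dotZr mul0r oppr0 expR0.
rewrite mulr1 => <-; rewrite -[LHS]fineK; last exact: (integrable_fin_num _ integrable_gauss).
congr EFin; apply: eq_Rintegral => x _.
by rewrite dotC -(scale0r x) dotZr mul0r mulr0 oppr0 cos0 mulr1 mul0r subr0.
Qed.

Lemma fourier1_gauss w :
  fourier1 (fun x => real_complex R (gauss x)) w =
    real_complex R (gauss_peak * gauss (pi *: w)).
Proof. by have [] := fourier1_gauss_aux w. Qed.

Lemma integrable_gauss_affine a t : a != 0 ->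
  mu.-integrable setT (fun x => (gauss (a *: x + t))%:E).
Proof. by move=> a0; exact: (integrable_rV_affine t a0 integrable_gauss). Qed.

Lemma integrable_gauss_shift a t : a != 0 ->
  mu.-integrable setT (fun x => (gauss (a *: (x - t)))%:E).
Proof.
move=> a0; under eq_fun do rewrite scalerBr -scalerN.
by apply: integrable_gauss_affine.
Qed.

Lemma cintegrable_gauss_shift a t : a != 0 ->
  cintegrable mu (fun x => real_complex R (gauss (a *: (x - t)))).
Proof. by move=> a0; apply: cintegrable_real; exact: integrable_gauss_shift. Qed.

Lemma integral_gauss_scale a : a != 0 ->
  (\int[mu]_x (gauss (a *: x))%:E = (`|a| ^- n * gauss_peak)%:E)%E.
Proof.
move=> a0; have mg : measurable_fun setT (fun x => (gauss x)%:E).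
  by apply/measurable_EFinP; exact: measurable_gauss.
have := integral_gauss; rewrite (ge0_integral_rV_affine 0 a0)//; last first.
  by move=> x; rewrite lee_fin gauss_ge0.
under eq_integral do rewrite addr0.
have := integrable_fin_num measurableT (integrable_gauss_affine 0 a0).
under eq_integral do rewrite addr0.
move=> /fineK <-; rewrite -EFinM => -[<-]; congr EFin.
by rewrite mulKf// expf_neq0// normr_eq0.
Qed.

Lemma measurable_gauss_affine a t : measurable_fun setT (fun x => gauss (a *: x + t)).
Proof. exact: (measurableT_comp measurable_gauss (measurable_rV_affine a t)). Qed.

Lemma fourier1_gauss_shift a t w : 0 < a ->
  fourier1 (fun x => real_complex R (gauss (a *: (x - t)))) w =
  real_complex R (a ^- n * gauss_peak * gauss ((pi / a) *: w)) *
  expi (- (2 * pi * dot w t)).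
Proof.
move=> a0; have an : a^-1 != 0 by rewrite invr_eq0 gt_eqF.
rewrite fourier1E (cint_rV_affine t an); last first.
  apply: (@cintegrableM _ _ _ _ _ _ 1); first exact: (cintegrable_gauss_shift _ (lt0r_neq0 a0)).
    exact: measurable_expi_dot.
  by move=> x; rewrite normc_expi.
transitivity (real_complex R (`|a^-1| ^+ n) *
    (cint mu (fun x => expi (- (2 * pi * dot w t)) * (real_complex R (gauss x) *
      expi (- (2 * pi * dot (a^-1 *: w) x)))))).
  congr (_ * cint mu _); apply/funext => x.
  rewrite addrK scalerA divff ?gt_eqF// scale1r dotDr dotZr dotZl.
  rewrite mulrDr opprD expiD; ring.
rewrite cintZl; last by have [] := fourier1_gauss_aux (a^-1 *: w).
rewrite -fourier1E fourier1_gauss scalerA.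
rewrite gtr0_norm ?invr_gt0// exprVn !mulr_real_complex; ring.
Qed.

End gauss_rV.

(** * The Fourier transform of integrable functions *)

Section fourier1_theory.
Variables (R : realType) (n : nat).
Local Notation V := 'rV[R]_n.
Local Notation mu := (@lebesgue_rV R n).
Local Notation normc := (@Normc.normc R).
Implicit Types (f g : V -> R[i]).

(** Tonelli makes the integrals of the positive and negative parts measurable, and [fine] of their
    difference is measurable as well, including at points where a section fails to be integrable and
    [fine] returns its default. *)
Lemma measurable_Rintegral {d1 d2} {T1 : measurableType d1} {T2 : measurableType d2}
    (m2 : {sigma_finite_measure set T2 -> \bar R}) (f : T1 -> T2 -> R) :
  measurable_fun setT (fun p : T1 * T2 => f p.1 p.2) ->
  measurable_fun setT (fun x => \int[m2]_y f x y).
Proof.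
move=> mf; pose F := fun p : T1 * T2 => (f p.1 p.2)%:E.
have mF : measurable_fun setT F by exact/measurable_EFinP.
apply: (measurableT_comp (fine_measurable measurableT)).
under eq_fun do rewrite integralE.
apply: emeasurable_funB.
  apply: (eq_measurable_fun (fubini_F m2 (F^\+)%E)) => [x _|].
    by apply: eq_integral => y _; rewrite !funeposE.
  exact: (@measurable_fun_fubini_tonelli_F _ _ _ _ _ m2 _ (measurable_funepos mF) (funepos_ge0 F)).
apply: (eq_measurable_fun (fubini_F m2 (F^\-)%E)) => [x _|].
  by apply: eq_integral => y _; rewrite !funenegE.
exact: (@measurable_fun_fubini_tonelli_F _ _ _ _ _ m2 _ (measurable_funeneg mF) (funeneg_ge0 F)).
Qed.

Lemma cmeasurable_cint {d1 d2} {T1 : measurableType d1} {T2 : measurableType d2}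
    (m2 : {sigma_finite_measure set T2 -> \bar R}) (f : T1 -> T2 -> R[i]) :
  cmeasurable_fun (fun p : T1 * T2 => f p.1 p.2) ->
  cmeasurable_fun (fun x => cint m2 (f x)).
Proof. by move=> [mr mi]; split; exact: measurable_Rintegral. Qed.

Lemma cintegrable_fourier f (w : V) : cintegrable mu f ->
  cintegrable mu (fun x => f x * expi (- (2 * pi * dot w x))).
Proof.
move=> cf; apply: (@cintegrableM _ _ _ _ _ _ 1 cf).
  exact: measurable_expi_dot.
by move=> x; rewrite normc_expi.
Qed.

Lemma cmeasurable_fourier1 f : cmeasurable_fun f -> cmeasurable_fun (fourier1 f).
Proof.
move=> mf; apply: (@cmeasurable_cint _ _ _ _ mu (fun w x => f x * expi (- (2 * pi * dot w x)))).
apply: cmeasurableM; first exact: (cmeasurable_comp mf measurable_snd).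
exact: (measurable_expi_dot measurable_fst measurable_snd).
Qed.

Lemma cintegrable_norm_fine f : cintegrable mu f ->
  (\int[mu]_x (normc (f x))%:E = (\int[mu]_x normc (f x))%R%:E)%E.
Proof. by move=> cf; rewrite -[LHS]fineK//;
  exact: (integrable_fin_num _ (integrable_normc cf)). Qed.

Lemma normc_fourier1 f w : cintegrable mu f ->
  normc (fourier1 f w) <= 2 * \int[mu]_x normc (f x).
Proof.
move=> cf; have := le_normc_cint (cintegrable_fourier w cf).
under eq_integral do rewrite Normc.normcM normc_expi mulr1.
by rewrite cintegrable_norm_fine// -EFinM lee_fin.
Qed.

Lemma fourier1B f g w : cintegrable mu f -> cintegrable mu g ->
  fourier1 (fun x => f x - g x) w = fourier1 f w - fourier1 g w.
Proof.
move=> cf cg; rewrite !fourier1E.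
by under eq_fun do rewrite mulrBl; rewrite cintB//; exact: cintegrable_fourier.
Qed.

(** The common source of the multiplication formula, of the modulation formula and of the averaging
    of Gaussians over their centres: with a kernel bounded by M the double integral of the modulus
    is at most M times the product of the two L^1 norms. *)
Lemma cint_Fubini_kernel (u v : V -> R[i]) (k : V -> V -> R[i]) (M : R) :
  cintegrable mu u -> cintegrable mu v ->
  cmeasurable_fun (fun p : V * V => k p.1 p.2) -> (forall x y, normc (k x y) <= M) ->
  cintegrable mu (fun x => u x * cint mu (fun y => v y * k x y)) /\
  cint mu (fun x => u x * cint mu (fun y => v y * k x y)) =
  cint mu (fun y => v y * cint mu (fun x => u x * k x y)).
Proof.
move=> iu iv mk kM; have mu_ := cintegrable_measurable iu; have mv := cintegrable_measurable iv.
have mkx x : cmeasurable_fun (k x).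
  exact: (cmeasurable_comp mk (pair1_measurable x)).
have mky y : cmeasurable_fun (k^~ y).
  exact: (cmeasurable_comp mk (pair2_measurable y)).
have M0 : 0 <= M by apply: le_trans (kM 0 0); exact: normc_ge0.
have ivk x : cintegrable mu (fun y => v y * k x y).
  by apply: (cintegrableM iv (mkx x)) => y; exact: kM.
have iuk y : cintegrable mu (fun x => u x * k x y).
  by apply: (cintegrableM iu (mky y)) => x; exact: kM.
pose f x y := u x * (v y * k x y).
have mf : cmeasurable_fun (fun p : V * V => f p.1 p.2).
  apply: cmeasurableM; first exact: (cmeasurable_comp mu_ measurable_fst).
  by apply: cmeasurableM => //; exact: (cmeasurable_comp mv measurable_snd).
have h1 : (\int[mu]_x \int[mu]_y (normc (f x y))%:E < +oo)%E.
  have iU := (cintegrableP mu mu_).1 iu; have iV := (cintegrableP mu mv).1 iv.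
  have nmu : measurable_fun setT (fun x => (normc (u x))%:E).
    exact/measurable_EFinP/measurable_normc.
  have nmv : measurable_fun setT (fun x => (normc (v x))%:E).
    exact/measurable_EFinP/measurable_normc.
  apply: (@le_lt_trans _ _ (\int[mu]_x ((normc (u x))%:E * (M%:E * \int[mu]_y (normc (v
    y))%:E)))%E).
    apply: ge0_le_integral => //.
    + by move=> x _; apply: integral_ge0 => y _; rewrite lee_fin normc_ge0.
    + apply: (@measurable_fun_fubini_tonelli_F _ _ _ _ _ mu (fun p => (normc (f p.1 p.2))%:E)).
        exact/measurable_EFinP/measurable_normc.
      by move=> p; rewrite lee_fin normc_ge0.
    + by apply: emeasurable_funM => //; exact: measurable_cst.
    + move=> x _; rewrite -ge0_integralZl_EFin//; last by move=> y _; rewrite lee_fin normc_ge0.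
      rewrite -ge0_integralZl_EFin ?normc_ge0//; last 2 first.
      * by move=> y _; rewrite -EFinM lee_fin mulr_ge0 ?normc_ge0.
      * exact: measurable_funeM.
      apply: ge0_le_integral => //.
      * by move=> y _; rewrite lee_fin normc_ge0.
      * apply/measurable_EFinP/measurable_normc.
        exact: (cmeasurable_comp mf (pair1_measurable x)).
      * by apply: measurable_funeM; exact: measurable_funeM.
      * move=> y _; rewrite -!EFinM lee_fin !Normc.normcM ler_wpM2l ?normc_ge0//.
        by rewrite mulrC ler_wpM2r ?normc_ge0.
  have v0 : (0 <= \int[mu]_y (normc (v y))%:E)%E.
    by apply: integral_ge0 => y _; rewrite lee_fin normc_ge0.
  rewrite ge0_integralZr//; last 2 first.
  + by move=> x _; rewrite lee_fin normc_ge0.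
  + by rewrite mule_ge0// lee_fin.
  rewrite lte_mul_pinfty//.
  + by apply: integral_ge0 => y _; rewrite lee_fin normc_ge0.
  + by rewrite ge0_fin_numE//; apply: integral_ge0 => y _; rewrite lee_fin normc_ge0.
  + by rewrite lte_mul_pinfty// lee_fin.
have h2 x : cintegrable mu (fun y => f x y) by exact: cintegrableZl.
have h3 y : cintegrable mu (fun x => f x y).
  by rewrite /f; under eq_fun do rewrite mulrCA; exact: cintegrableZl.
have [i1 _ _ E] := cint_Fubini mf h1 h2 h3.
have E1 : (fun x => u x * cint mu (fun y => v y * k x y)) =
    (fun x => cint mu (fun y => f x y)).
  by apply/funext => x; rewrite /f (cintZl (u x) (ivk x)).
have E2 : (fun y => v y * cint mu (fun x => u x * k x y)) =
    (fun y => cint mu (fun x => f x y)).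
  apply/funext => y; rewrite -(cintZl (v y) (iuk y)).
  by congr cint; apply/funext => x; rewrite /f mulrCA.
rewrite E1 E2; split; [exact: i1|exact: E].
Qed.

Lemma fourier1_mult f g : cintegrable mu f -> cintegrable mu g ->
  cint mu (fun w => g w * fourier1 f w) = cint mu (fun x => f x * fourier1 g x).
Proof.
move=> cf cg.
have k1 (w x : V) : normc (expi (- (2 * pi * dot w x))) <= 1 by rewrite normc_expi.
have [_] := @cint_Fubini_kernel g f (fun w x => expi (- (2 * pi * dot w x))) 1 cg cf
  (measurable_expi_dot measurable_fst measurable_snd) k1.
move=> E; under eq_fun do rewrite fourier1E; rewrite E; congr cint; apply/funext => x.
by rewrite fourier1E; congr (_ * cint _ _); apply/funext => w; rewrite dotC.
Qed.

End fourier1_theory.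

(** * The L^2 norm *)

Section nrm2_theory.
Variables (R : realType) (n : nat).
Local Notation V := 'rV[R]_n.
Local Notation mu := (@lebesgue_rV R n).
Local Notation normc := (@Normc.normc R).
Implicit Types (f g : V -> R[i]).

(** The L^2 norm as a real number. [fine] sends an infinite norm to 0, so the value is meaningful
    only together with [memLp 2]. *)
Definition nrm2 f : R := fine (cnorm 2%:E f).

Lemma cnorm_ge0 p f : (0 <= cnorm p f)%E.
Proof. exact: Lnorm_ge0. Qed.

Lemma nrm2_ge0 f : 0 <= nrm2 f.
Proof. by rewrite fine_ge0// cnorm_ge0. Qed.

Lemma memL2_nrm f : memLp 2%:E f -> cnorm 2%:E f = (nrm2 f)%:E.
Proof. by move=> [_ foo]; rewrite /nrm2 fineK// ge0_fin_numE// cnorm_ge0. Qed.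

Lemma integral_normc_sqr_ge0 f : (0 <= \int[mu]_x (normc (f x) ^+ 2)%:E)%E.
Proof. by apply: integral_ge0 => x _; rewrite lee_fin sqr_ge0. Qed.

Lemma cnorm2E f : cnorm 2%:E f = sqrte (\int[mu]_x (normc (f x) ^+ 2)%:E)%E.
Proof.
rewrite -poweR12_sqrt ?integral_normc_sqr_ge0// /cnorm unlock; congr (_ `^ _)%E.
apply: eq_integral => x _.
by rewrite abse_EFin ger0_norm ?normc_ge0// poweR_EFin powR_mulrn ?normc_ge0.
Qed.

Lemma cnorm1E f : cnorm 1%:E f = (\int[mu]_x (normc (f x))%:E)%E.
Proof.
rewrite /cnorm Lnorm1; apply: eq_integral => x _.
by rewrite abse_EFin ger0_norm ?normc_ge0.
Qed.

Lemma cnorm2_sqr f : (cnorm 2%:E f ^+ 2 = \int[mu]_x (normc (f x) ^+ 2)%:E)%E.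
Proof. by rewrite cnorm2E sqr_sqrte ?integral_normc_sqr_ge0. Qed.

Lemma nrm2_sqr f : memLp 2%:E f ->
  (\int[mu]_x (normc (f x) ^+ 2)%:E = (nrm2 f ^+ 2)%:E)%E.
Proof. by move=> Lf; rewrite -cnorm2_sqr memL2_nrm// EFin_expe. Qed.

Lemma memL2P f : cmeasurable_fun f ->
  memLp 2%:E f <-> (\int[mu]_x (normc (f x) ^+ 2)%:E < +oo)%E.
Proof.
move=> mf; split => [/nrm2_sqr ->|foo]; first exact: ltry.
split=> //; rewrite cnorm2E -poweR12_sqrt ?integral_normc_sqr_ge0//.
exact: poweR_lty.
Qed.

Lemma memL1P f : cmeasurable_fun f -> memLp 1%:E f <-> cintegrable mu f.
Proof.
move=> mf; split=> [[_ foo]|/(cintegrableP mu mf) foo].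
  by apply/(cintegrableP mu mf); rewrite -cnorm1E.
by split=> //; rewrite cnorm1E.
Qed.

Lemma measurable_memLp p f : memLp p f -> cmeasurable_fun f.
Proof. by case. Qed.

Lemma le_memL2 f g : cmeasurable_fun f -> memLp 2%:E g ->
  (forall x, normc (f x) <= normc (g x)) -> memLp 2%:E f /\ nrm2 f <= nrm2 g.
Proof.
move=> mf Lg fg; have mg := measurable_memLp Lg.
have le : (\int[mu]_x (normc (f x) ^+ 2)%:E <= \int[mu]_x (normc (g x) ^+ 2)%:E)%E.
  apply: ge0_le_integral => //.
  - by move=> x _; rewrite lee_fin sqr_ge0.
  - by apply/measurable_EFinP; apply: measurable_funX; exact: measurable_normc.
  - by apply/measurable_EFinP; apply: measurable_funX; exact: measurable_normc.
  - by move=> x _; rewrite lee_fin lerXn2r ?nnegrE ?normc_ge0.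
have Lf : memLp 2%:E f.
  by apply/(memL2P mf); apply: (le_lt_trans le); rewrite (nrm2_sqr Lg) ltry.
split => //; rewrite -(ler_pXn2r (_ : 0 < 2)%N) ?nnegrE ?nrm2_ge0//.
by rewrite -lee_fin -!nrm2_sqr.
Qed.

Lemma memL2D f g : memLp 2%:E f -> memLp 2%:E g ->
  memLp 2%:E (fun x => f x + g x) /\ nrm2 (fun x => f x + g x) <= nrm2 f + nrm2 g.
Proof.
move=> Lf Lg; have mf := measurable_memLp Lf; have mg := measurable_memLp Lg.
have nf := measurable_normc mf; have ng := measurable_normc mg.
(* Minkowski's inequality is applied to the moduli of f and g; their sum [h] dominates [f + g]
   pointwise, and [le_memL2] concludes. *)
pose h x := real_complex R (normc (f x) + normc (g x)).
have le : (cnorm 2%:E h <= cnorm 2%:E f + cnorm 2%:E g)%E.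
  have := @minkowski_EFin _ _ R mu _ _ 2 nf ng (ler1n _ _).
  apply: le_trans; rewrite le_eqVlt; apply/orP; left; apply/eqP.
  apply: eq_Lnorm => x; rewrite normc_real ger0_norm//.
  by rewrite addr_ge0 ?normc_ge0.
have Lh : memLp 2%:E h.
  split; first by apply: cmeasurable_real; exact: measurable_funD.
  by apply: (le_lt_trans le); rewrite !memL2_nrm// -EFinD ltry.
have fgh x : normc (f x + g x) <= normc (h x).
  by rewrite normc_real ger0_norm ?addr_ge0 ?normc_ge0// le_normcD.
have [Lfg nfg] := le_memL2 (cmeasurableD mf mg) Lh fgh.
split=> //; apply: (le_trans nfg).
by rewrite -lee_fin EFinD -!memL2_nrm.
Qed.

Lemma memL2M f g : cmeasurable_fun f -> (forall x, normc (f x) <= 1) ->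
  memLp 2%:E g ->
  memLp 2%:E (fun x => f x * g x) /\ nrm2 (fun x => f x * g x) <= nrm2 g.
Proof.
move=> mf f1 Lg; apply: le_memL2 => //.
  exact: (cmeasurableM mf (measurable_memLp Lg)).
by move=> x; rewrite Normc.normcM ler_piMl ?normc_ge0.
Qed.

Lemma memL2J f : memLp 2%:E f ->
  memLp 2%:E (fun x => conjc (f x)) /\ nrm2 (fun x => conjc (f x)) <= nrm2 f.
Proof.
move=> Lf; apply: le_memL2 => //; first exact: (cmeasurableJ (measurable_memLp Lf)).
by move=> x; rewrite normcJ.
Qed.

Lemma memL2N f : memLp 2%:E f ->
  memLp 2%:E (fun x => - f x) /\ nrm2 (fun x => - f x) <= nrm2 f.
Proof.
move=> Lf; apply: le_memL2 => //; last by move=> x; rewrite normcN.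
have := cmeasurableB (cmeasurable_cst 0) (measurable_memLp Lf).
by under eq_fun do rewrite sub0r.
Qed.

Lemma memL2B f g : memLp 2%:E f -> memLp 2%:E g ->
  memLp 2%:E (fun x => f x - g x) /\ nrm2 (fun x => f x - g x) <= nrm2 f + nrm2 g.
Proof.
move=> Lf Lg; have [LNg Ng] := memL2N Lg; have [Lfg fg] := memL2D Lf LNg.
by split => //; apply: (le_trans fg); rewrite lerD2l.
Qed.

Lemma nrm2_le_dist f g : memLp 2%:E f -> memLp 2%:E g ->
  nrm2 f <= nrm2 (fun x => f x - g x) + nrm2 g.
Proof.
move=> Lf Lg; have [Lfg _] := memL2B Lf Lg.
have [_] := memL2D Lfg Lg.
by have -> : (fun x => f x - g x + g x) = f by apply/funext => x; rewrite subrK.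
Qed.

Lemma memL2_affine (a : R) (t : V) f : a != 0 -> memLp 2%:E f ->
  memLp 2%:E (fun x => f (a *: x + t)) /\
  nrm2 (fun x => f (a *: x + t)) = Num.sqrt (`|a| ^- n) * nrm2 f.
Proof.
move=> a0 Lf; have mf := measurable_memLp Lf.
have mfa : cmeasurable_fun (fun x : V => f (a *: x + t)).
  exact: (cmeasurable_comp mf (measurable_rV_affine a t)).
have an : 0 < `|a| ^+ n by rewrite exprn_gt0// normr_gt0.
have := nrm2_sqr Lf.
rewrite (ge0_integral_rV_affine t a0)//; last 2 first.
- by apply/measurable_EFinP; apply: measurable_funX; exact: measurable_normc.
- by move=> x; rewrite lee_fin sqr_ge0.
move=> E; have La : memLp 2%:E (fun x => f (a *: x + t)).
  apply/(memL2P mfa); rewrite ltNge leye_eq; apply/eqP => E'.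
  by move: E; rewrite E' mulry gtr0_sg// mul1e.
split => //; move: E; rewrite (nrm2_sqr La) -EFinM => -[E].
apply/eqP; rewrite -(eqrXn2 (_ : 0 < 2)%N) ?nrm2_ge0 ?mulr_ge0 ?sqrtr_ge0 ?nrm2_ge0//.
rewrite exprMn sqr_sqrtr ?invr_ge0 ?(ltW an)//.
by rewrite -E mulKf// gt_eqF.
Qed.

Lemma cauchy_schwarz f g : memLp 2%:E f -> memLp 2%:E g ->
  cintegrable mu (fun x => f x * g x) /\
  (\int[mu]_x (normc (f x * g x))%:E <= (nrm2 f * nrm2 g)%:E)%E.
Proof.
move=> Lf Lg; have mf := measurable_memLp Lf; have mg := measurable_memLp Lg.
have le : (\int[mu]_x (normc (f x * g x))%:E <= (nrm2 f * nrm2 g)%:E)%E.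
  have h2 : 2^-1 + 2^-1 = 1 :> R by field.
  have := @hoelder _ _ R mu _ _ 2 2 (measurable_normc mf) (measurable_normc mg)
    (ltr0Sn _ _) (ltr0Sn _ _) h2.
  rewrite EFinM -(memL2_nrm Lf) -(memL2_nrm Lg) Lnorm1; apply: le_trans.
  rewrite le_eqVlt; apply/orP; left; apply/eqP; apply: eq_integral => x _ /=.
  by rewrite ger0_norm ?mulr_ge0 ?normc_ge0// Normc.normcM.
split => //; apply/(cintegrableP mu (cmeasurableM mf mg)).
by apply: (le_lt_trans le); rewrite ltry.
Qed.

Lemma normc_cint_mul f g : memLp 2%:E f -> memLp 2%:E g ->
  normc (cint mu (fun x => f x * g x)) <= 2 * (nrm2 f * nrm2 g).
Proof.
move=> Lf Lg; have [ifg le] := cauchy_schwarz Lf Lg.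
rewrite -lee_fin; apply: (le_trans (le_normc_cint ifg)).
by rewrite EFinM; apply: lee_wpmul2l.
Qed.

(** Continuity of the bilinear pairing on L^2, in quantitative form. It compares approximants with
    their limits twice: for the wavelet coefficients and for the pairing of the transforms. *)
Lemma normc_cint_mulB f g f' g' : memLp 2%:E f -> memLp 2%:E g ->
  memLp 2%:E f' -> memLp 2%:E g' ->
  normc (cint mu (fun x => f x * g x) - cint mu (fun x => f' x * g' x)) <=
  2 * (nrm2 (fun x => f x - f' x) * nrm2 g + nrm2 f' * nrm2 (fun x => g x - g' x)).
Proof.
move=> Lf Lg Lf' Lg'.
have [Lff _] := memL2B Lf Lf'; have [Lgg _] := memL2B Lg Lg'.
have [i1 _] := cauchy_schwarz Lf Lg; have [i2 _] := cauchy_schwarz Lf' Lg'.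
have [i3 _] := cauchy_schwarz Lff Lg; have [i4 _] := cauchy_schwarz Lf' Lgg.
rewrite -(cintB i1 i2).
have -> : (fun x => f x * g x - f' x * g' x) =
    (fun x => (f x - f' x) * g x + f' x * (g x - g' x)).
  by apply/funext => x; ring.
rewrite (cintD i3 i4) mulrDr; apply: (le_trans (le_normcD _ _)); apply: lerD.
  exact: normc_cint_mul.
exact: normc_cint_mul.
Qed.

Lemma cvg_nrm2 (f_ : nat -> V -> R[i]) f :
  cnorm 2%:E (f_ k - f) @[k --> \oo] --> 0%E ->
  nrm2 (fun x => f_ k x - f x) @[k --> \oo] --> 0.
Proof. by move=> /fine_cvg. Qed.

End nrm2_theory.

(** * The wavelet correlation and its Fourier transform *)

Section parseval.
Variables (R : realType) (n : nat).
Local Notation V := 'rV[R]_n.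
Local Notation mu := (@lebesgue_rV R n).
Local Notation normc := (@Normc.normc R).
Implicit Types (f g h : V -> R[i]).

Lemma conjcM (z w : R[i]) : conjc (z * w) = conjc z * conjc w.
Proof. by rewrite rmorphM. Qed.

Lemma measurable_rV_scale (s : R) : measurable_fun setT (fun x : V => s *: x).
Proof. by have := measurable_rV_affine s (0 : V); under eq_fun do rewrite addr0. Qed.

Lemma measurable_rV_sub {d} {T : measurableType d} (u v : T -> V) (a : R) :
  measurable_fun setT u -> measurable_fun setT v ->
  measurable_fun setT (fun p => a *: (u p - v p)).
Proof.
move=> /measurable_fun_rVP mu_ /measurable_fun_rVP mv; apply/measurable_fun_rVP => i.
under eq_fun do rewrite !mxE.
by apply: measurable_funM => //; apply: measurable_funB.
Qed.

(** Expanding the conjugated transform of g and exchanging the integrals joins the phases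
    [exp(2 pi i s w.y)] and [exp(-2 pi i x.w)] into the one that defines the transform of h at
    [x - s y]. *)
Lemma fourier1_modulated g h (s : R) (x : V) : cintegrable mu g -> cintegrable mu h ->
  fourier1 (fun w => conjc (fourier1 g (s *: w)) * h w) x =
  cint mu (fun y => conjc (g y) * fourier1 h (x - s *: y)).
Proof.
move=> ig ih; pose k (w y : V) : R[i] :=
  expi (2 * pi * (s * dot w y)) * expi (- (2 * pi * dot x w)).
have mk : cmeasurable_fun (fun p : V * V => k p.1 p.2).
  apply: cmeasurableM; last first.
    exact: (measurable_expi_dot (@measurable_cst _ _ _ _ _ x) measurable_fst).
  apply: cmeasurable_expi; apply: measurable_funM => //; apply: measurable_funM => //.
  by apply: measurable_dot; [exact: measurable_fst|exact: measurable_snd].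
have k1 w y : normc (k w y) <= 1 by rewrite Normc.normcM !normc_expi mulr1.
have [_ E] := cint_Fubini_kernel ih (cintegrableJ ig) mk k1.
rewrite fourier1E; transitivity (cint mu (fun w => h w * cint mu (fun y => conjc (g y) * k w y))).
  congr cint; apply/funext => w; rewrite fourier1E (cintJ (cintegrable_fourier _ ig)).
  have i1 : cintegrable mu (fun y => conjc (g y * expi (- (2 * pi * dot (s *: w) y)))).
    exact/cintegrableJ/cintegrable_fourier.
  rewrite mulrAC -(cintZr _ i1) mulrC; congr (_ * cint _ _); apply/funext => y.
  by rewrite /k mulrA conjcM conj_expi opprK dotZl.
rewrite E; congr cint; apply/funext => y; rewrite fourier1E.
congr (_ * cint _ _); apply/funext => w; congr (_ * _).
by rewrite /k -expiD dotBl dotZl (dotC y w); congr expi; ring.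
Qed.

Lemma cmeasurable_fourier1_scale g (s : R) : cmeasurable_fun g ->
  cmeasurable_fun (fun w : V => conjc (fourier1 g (s *: w))).
Proof.
move=> mg; apply: cmeasurableJ.
exact: (cmeasurable_comp (cmeasurable_fourier1 mg) (measurable_rV_scale s)).
Qed.

Lemma fourier1_correlation f g h (s : R) :
  cintegrable mu f -> cintegrable mu g -> cintegrable mu h ->
  cint mu (fun w => conjc (fourier1 g (s *: w)) * h w * fourier1 f w) =
  cint mu (fun x => f x * cint mu (fun y => conjc (g y) * fourier1 h (x - s *: y))).
Proof.
move=> i_f ig ih.
have igh : cintegrable mu (fun w => conjc (fourier1 g (s *: w)) * h w).
  apply: (cintegrableMl ih).
    exact: (cmeasurable_fourier1_scale s (cintegrable_measurable ig)).
  by move=> w; rewrite normcJ; exact: normc_fourier1.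
rewrite (fourier1_mult i_f igh); congr cint; apply/funext => x.
by rewrite (fourier1_modulated s x ig ih).
Qed.

(** The substitution [y = (x - t) / s] turns the inner integral of [fourier1_correlation] into one
    over the translation t, and produces the power of s. Exchanging x and t then makes the
    coefficients of f at scale s appear, integrated against the transform of h. *)
Lemma fourier1_correlation_sub f g h (s : R) : 0 < s ->
  cintegrable mu f -> cintegrable mu g -> cintegrable mu h ->
  memLp 2%:E f -> memLp 2%:E g -> cintegrable mu (fourier1 h) ->
  cintegrable mu (fun t => fourier1 h t *
    cint mu (fun x => f x * conjc (g (s^-1 *: (x - t))))) /\
  cint mu (fun w => conjc (fourier1 g (s *: w)) * h w * fourier1 f w) =
  real_complex R (s^-1 ^+ n) * cint mu (fun t => fourier1 h t *
    cint mu (fun x => f x * conjc (g (s^-1 *: (x - t))))).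
Proof.
move=> s0 i_f ig ih Lf Lg iH; rewrite fourier1_correlation//.
have s'0 : - s^-1 != 0 by rewrite oppr_eq0 invr_eq0 gt_eqF.
have s''0 : s^-1 != 0 by rewrite invr_eq0 gt_eqF.
have mf := cintegrable_measurable i_f; have mg := cintegrable_measurable ig.
have mH := cintegrable_measurable iH.
have aff1 x t : - s^-1 *: t + s^-1 *: x = s^-1 *: (x - t) :> V.
  by rewrite scalerBr scaleNr addrC.
have aff2 x t : s^-1 *: x + - (s^-1 *: t) = s^-1 *: (x - t) :> V by rewrite scalerBr.
have aff3 x t : x - s *: (s^-1 *: (x - t)) = t :> V.
  by rewrite scalerA divff ?gt_eqF// scale1r opprB addrC subrK.
pose K (x t : V) := f x * (conjc (g (s^-1 *: (x - t))) * fourier1 h t).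
have mgxt : cmeasurable_fun (fun p : V * V => conjc (g (s^-1 *: (p.1 - p.2)))).
  apply: cmeasurableJ; apply: (cmeasurable_comp mg).
  by apply: measurable_rV_sub; [exact: measurable_fst|exact: measurable_snd].
have mK : cmeasurable_fun (fun p : V * V => K p.1 p.2).
  apply: cmeasurableM; first exact: (cmeasurable_comp mf measurable_fst).
  apply: cmeasurableM; first exact: mgxt.
  exact: (cmeasurable_comp mH measurable_snd).
have ix x : cintegrable mu (fun t => conjc (g (s^-1 *: (x - t))) * fourier1 h t).
  apply: (cintegrableM _ mH (fun t => normc_fourier1 t ih)); apply: cintegrableJ.
  by have := cintegrable_rV_affine (s^-1 *: x) s'0 ig; under eq_fun do rewrite aff1.
have h2 x : cintegrable mu (fun t => K x t) by exact: (cintegrableZl _ (ix x)).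
(* For fixed t the integrand is a product of two L^2 functions of x, so Cauchy-Schwarz gives
   integrability for every t and not only for almost every t, as [cint_Fubini] demands. *)
have h3 t : cintegrable mu (fun x => K x t).
  have [Lgt _] := memL2_affine (- (s^-1 *: t)) s''0 Lg.
  have [Lgtc _] := memL2J Lgt.
  have [+ _] := cauchy_schwarz Lf Lgtc.
  move=> /(cintegrableZl (fourier1 h t)); congr cintegrable.
  by apply/funext => x; rewrite /K aff2; ring.
pose M := 2 * \int[mu]_x normc (h x).
have M0 : 0 <= M by apply: le_trans (normc_fourier1 0 ih); exact: normc_ge0.
(* [M] bounds the transform of h, and the integral over t of [|g((x - t)/s)|] is the same for every
   x; so [|f(x)| * c] bounds the inner integral of [|K|]. *)
pose c := M * (`|- s^-1| ^- n * \int[mu]_x normc (g x)).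
have c0 : 0 <= c.
  by rewrite !mulr_ge0 ?invr_ge0 ?exprn_ge0// Rintegral_ge0// => x _; exact: normc_ge0.
have gx x : (\int[mu]_t (normc (g (s^-1 *: (x - t))))%:E = (`|- s^-1| ^- n * \int[mu]_x normc (g
  x))%:E)%E.
  have := cintegrable_norm_fine ig.
  rewrite (integral_rV_affine (s^-1 *: x) s'0 (integrable_normc ig)).
  under eq_integral do rewrite aff1.
  move=> E; rewrite EFinM -E muleA -EFinM mulVf ?mul1e//.
  by rewrite expf_neq0// normr_eq0.
have h1 : (\int[mu]_x \int[mu]_t (normc (K x t))%:E < +oo)%E.
  apply: (@le_lt_trans _ _ (\int[mu]_x (normc (f x) * c)%:E)%E).
    apply: ge0_le_integral.
    - exact: measurableT.
    - by move=> x _; apply: integral_ge0 => t _; rewrite lee_fin normc_ge0.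
    - apply: (@measurable_fun_fubini_tonelli_F _ _ _ _ _ mu (fun p => (normc (K p.1 p.2))%:E)).
        by apply/measurable_EFinP; exact: measurable_normc.
      by move=> p; rewrite lee_fin normc_ge0.
    - apply/measurable_EFinP; apply: measurable_funM => //; exact: measurable_normc.
    move=> x _; apply: (@le_trans _ _ (\int[mu]_t ((normc (f x) * M)%:E * (normc (g (s^-1 *: (x -
      t))))%:E))%E).
      apply: ge0_le_integral.
      - exact: measurableT.
      - by move=> t _; rewrite lee_fin normc_ge0.
      - apply/measurable_EFinP; apply: measurable_normc.
        exact: (cmeasurable_comp mK (pair1_measurable x)).
      - apply: measurable_funeM; apply/measurable_EFinP.
        have := measurable_normc (cmeasurable_comp mgxt (pair1_measurable x)).
        by under eq_fun do rewrite normcJ.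
      - move=> t _; rewrite -EFinM lee_fin /K !Normc.normcM normcJ -mulrA.
        rewrite ler_wpM2l ?normc_ge0// mulrC ler_wpM2r ?normc_ge0//.
        exact: normc_fourier1.
    rewrite ge0_integralZl_EFin.
    - by rewrite gx -EFinM /c lee_fin !mulrA.
    - exact: measurableT.
    - by move=> t _; rewrite lee_fin normc_ge0.
    - apply/measurable_EFinP.
      have := measurable_normc (cmeasurable_comp mgxt (pair1_measurable x)).
      by under eq_fun do rewrite normcJ.
    - by rewrite mulr_ge0 ?normc_ge0.
  have := integrableZr measurableT c (integrable_normc i_f).
  by move=> /integrable_lty; exact.
have h1' : (\int[mu]_t \int[mu]_x (normc (K x t))%:E < +oo)%E.
  have := @fubini_tonelli _ _ _ _ _ mu mu (fun p => (normc (K p.1 p.2))%:E).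
  move=> <-; first exact: h1.
    by apply/measurable_EFinP; exact: measurable_normc.
  by move=> p; rewrite lee_fin normc_ge0.
have mK' : cmeasurable_fun (fun p : V * V => K p.2 p.1).
  exact: (cmeasurable_comp mK (@measurable_swap _ _ V V)).
have [i1 _ _ E] := @cint_Fubini _ _ _ _ _ mu mu (fun t x => K x t) mK' h1' h3 h2.
have EK : (fun t => fourier1 h t * cint mu (fun x => f x * conjc (g (s^-1 *: (x - t))))) =
    (fun t => cint mu (fun x => K x t)).
  apply/funext => t; have [Lgt _] := memL2_affine (- (s^-1 *: t)) s''0 Lg.
  have [Lgtc _] := memL2J Lgt.
  have [+ _] := cauchy_schwarz Lf Lgtc; under eq_fun do rewrite aff2.
  move=> ifg; rewrite -(cintZl _ ifg); congr cint; apply/funext => x; rewrite /K; ring.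
rewrite EK; split; first exact: i1.
have iK : cintegrable mu (fun x => cint mu (fun t => K x t)).
  by have [] := cint_Fubini mK h1 h2 h3.
rewrite E -(cintZl _ iK); congr cint; apply/funext => x.
have iy : cintegrable mu (fun y => conjc (g y) * fourier1 h (x - s *: y)).
  have mHx : cmeasurable_fun (fun y : V => fourier1 h (x - s *: y)).
    have := cmeasurable_comp mH (measurable_rV_affine (- s) x).
    by under eq_fun do rewrite scaleNr addrC.
  by apply: (cintegrableM (cintegrableJ ig) mHx) => y; exact: normc_fourier1.
have sn : `|- s^-1| = s^-1 by rewrite normrN gtr0_norm ?invr_gt0.
have E1 := cint_rV_affine (s^-1 *: x) s'0 iy.
have E2 := cintZl (f x) (ix x).
rewrite sn in E1; rewrite E1 mulrCA; congr (_ * _).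
rewrite /K E2; congr (_ * cint _ _).
by apply/funext => t; rewrite aff1 aff3.
Qed.

(** Only a bound on the coefficients that is uniform in t is assumed, so the estimate applies to
    approximants of f and psi as well as to the autocorrelation of a single function. *)
Lemma normc_fourier1_correlation f g h (s eta : R) : 0 < s ->
  cintegrable mu f -> cintegrable mu g -> cintegrable mu h ->
  memLp 2%:E f -> memLp 2%:E g -> cintegrable mu (fourier1 h) ->
  (forall t, normc (cint mu (fun x => f x * conjc (g (s^-1 *: (x - t))))) <= eta) ->
  normc (cint mu (fun w => conjc (fourier1 g (s *: w)) * h w * fourier1 f w)) <=
  s^-1 ^+ n * (2 * ((\int[mu]_t normc (fourier1 h t)) * eta)).
Proof.
move=> s0 i_f ig ih Lf Lg iH le_eta.
have [iP ->] := fourier1_correlation_sub s0 i_f ig ih Lf Lg iH.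
rewrite Normc.normcM normc_real [X in X * _]ger0_norm; last first.
  by rewrite exprn_ge0// invr_ge0 ltW.
apply: ler_wpM2l; first by rewrite exprn_ge0// invr_ge0 ltW.
rewrite -lee_fin.
apply: (le_trans (le_normc_cint iP)); rewrite EFinM lee_wpmul2l//.
rewrite EFinM -(cintegrable_norm_fine iH).
rewrite -ge0_integralZr//; last 3 first.
- by apply/measurable_EFinP; exact: (measurable_normc (cintegrable_measurable iH)).
- by move=> x _; rewrite lee_fin normc_ge0.
- by rewrite lee_fin (le_trans _ (le_eta 0))// normc_ge0.
apply: ge0_le_integral.
- exact: measurableT.
- by move=> t _; rewrite lee_fin normc_ge0.
- by apply/measurable_EFinP; exact: (measurable_normc (cintegrable_measurable iP)).
- rewrite /=; under eq_fun do rewrite -EFinM.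
  apply/measurable_EFinP; apply: measurable_funM => //.
  exact: (measurable_normc (cintegrable_measurable iH)).
- by move=> t _; rewrite -EFinM lee_fin Normc.normcM ler_wpM2l ?normc_ge0.
Qed.

End parseval.

(** * The L^2 bound for the transform, and the multiplication formula on L^2 *)

Section plancherel.
Variables (R : realType) (n : nat).
Local Notation V := 'rV[R]_n.
Local Notation mu := (@lebesgue_rV R n).
Local Notation normc := (@Normc.normc R).
Implicit Types (f g h : V -> R[i]).

Lemma le0_cvg0 (e : R^nat) (x : R) : (forall k, x <= e k) -> e k @[k --> \oo] --> 0 -> x <= 0.
Proof.
move=> xe e0; rewrite -(cvg_lim (@Rhausdorff R) e0).
by apply: limr_ge; [apply/cvg_ex; exists 0|exact: nearW].
Qed.

Lemma eq_complex_normc_le0 (z w : R[i]) : normc (z - w) <= 0 -> z = w.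
Proof.
move=> zw; apply/eqP; rewrite -subr_eq0; apply/eqP; apply: Normc.eq0_normc.
by apply/eqP; rewrite eq_le zw normc_ge0.
Qed.

Lemma gauss_scaleE (a : R) (x : V) : gauss (a *: x) = expR (- (a ^+ 2 * dot x x)).
Proof. by rewrite /gauss dotZl dotZr mulrA -expr2. Qed.

Lemma cvg_gauss_harmonic (x : V) : gauss (harmonic k *: x) @[k --> \oo] --> (1 : R).
Proof.
under eq_fun do rewrite gauss_scaleE.
rewrite -expR0; apply: continuous_cvg; first exact: continuous_expR.
rewrite -[X in _ --> X]oppr0; apply: cvgN.
rewrite -(mul0r (dot x x)); apply: cvgM; last exact: cvg_cst.
by rewrite -(mul0r 0); under eq_fun do rewrite expr2; apply: cvgM; exact: cvg_harmonic.
Qed.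

(** Up to a phase the transform is a positive Gaussian, whose integral is the value of h at its
    centre t, that is 1. In the computation the factors [a^n] cancel and the two square roots of
    [pi^n] multiply to [pi^n]. *)
Lemma fourier1_gauss_shift_integral (a : R) (t : V) : 0 < a ->
  let h := fun x => real_complex R (gauss (a *: (x - t))) in
  cintegrable mu (fourier1 h) /\ \int[mu]_w normc (fourier1 h w) = 1.
Proof.
move=> a0 h; have pa : 0 < pi / a by rewrite divr_gt0 ?pi_gt0.
have E w : normc (fourier1 h w) = a ^- n * gauss_peak R n * gauss ((pi / a) *: w).
  rewrite fourier1_gauss_shift// Normc.normcM normc_real normc_expi mulr1 ger0_norm//.
  apply: mulr_ge0; last exact: gauss_ge0.
  by rewrite mulr_ge0 ?invr_ge0 ?exprn_ge0 ?(ltW a0)// ltW// gauss_peak_gt0.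
have ig := integrable_gauss_affine (0 : V) (lt0r_neq0 pa).
have mh : cmeasurable_fun h.
  apply: cmeasurable_real; have := measurable_gauss_affine a (- (a *: t)).
  by under eq_fun do rewrite -scalerBr.
have I : (\int[mu]_w (normc (fourier1 h w))%:E = 1%E)%E.
  under eq_integral do rewrite E EFinM -[(pi / a) *: _]addr0.
  rewrite integralZl//; under eq_integral do rewrite addr0.
  rewrite (integral_gauss_scale _ (lt0r_neq0 pa)) -EFinM; congr EFin.
  rewrite gtr0_norm// expr_div_n invf_div /gauss_peak.
  have s2 : Num.sqrt pi ^+ n * Num.sqrt pi ^+ n = pi ^+ n :> R.
    by rewrite -exprMn -expr2 sqr_sqrtr// pi_ge0.
  have an : a ^+ n != 0 by rewrite expf_neq0// gt_eqF.
  have pn : pi ^+ n != 0 :> R by rewrite expf_neq0// gt_eqF// pi_gt0.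
  transitivity ((Num.sqrt pi ^+ n * Num.sqrt pi ^+ n) * (pi ^+ n)^-1 :> R).
    by field; rewrite an pn.
  by rewrite s2 divff.
split.
  by apply/cintegrableP; [exact: cmeasurable_fourier1|rewrite I ltry].
by rewrite /Rintegral I.
Qed.

(** For the correlation of f with itself at scale 1, Cauchy-Schwarz and [le_normc_cint] give
    [eta = 2 * nrm2 f ^+ 2]; the correlation bound contributes another 2, and the product is
    [(2 * nrm2 f) ^+ 2]. The Gaussians of width [k.+1] increase to 1, so monotone convergence
    removes them. *)
Lemma plancherel_le f : cintegrable mu f -> memLp 2%:E f ->
  memLp 2%:E (fourier1 f) /\ nrm2 (fourier1 f) <= 2 * nrm2 f.
Proof.
move=> i_f Lf; have mf := cintegrable_measurable i_f.
have mF := cmeasurable_fourier1 mf.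
pose G (k : nat) (w : V) := (normc (fourier1 f w) ^+ 2 * gauss (harmonic k *: w))%:E.
have har0 k : 0 < @harmonic R k by rewrite invr_gt0.
have mG k : measurable_fun setT (G k).
  apply/measurable_EFinP; apply: measurable_funM.
    by apply: measurable_funX; exact: measurable_normc.
  by have := measurable_gauss_affine (@harmonic R k) (0 : V); under eq_fun do rewrite addr0.
have G0 k w : setT w -> (0 <= G k w)%E.
  by move=> _; rewrite lee_fin mulr_ge0 ?sqr_ge0 ?gauss_ge0.
have ndG w : setT w -> nondecreasing_seq (G ^~ w).
  move=> _ k l kl; rewrite lee_fin ler_wpM2l ?sqr_ge0//.
  rewrite !gauss_scaleE ler_expR lerN2 ler_wpM2r ?dot_ge0//.
  have kl' : @harmonic R l <= harmonic k by rewrite lef_pV2 ?posrE ?ltr0Sn// ler_nat.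
  by rewrite ler_pXn2r// nnegrE ltW.
have bnd k : (\int[mu]_w G k w <= ((2 * nrm2 f) ^+ 2)%:E)%E.
  pose h := fun w : V => real_complex R (gauss (harmonic k *: (w - 0))).
  have ih : cintegrable mu h by exact: (cintegrable_gauss_shift _ (lt0r_neq0 (har0 k))).
  have [iH H1] := fourier1_gauss_shift_integral (0 : V) (har0 k).
  have eta t : normc (cint mu (fun x => f x * conjc (f (1^-1 *: (x - t))))) <= 2 * (nrm2 f * nrm2
    f).
    have [Lt nt] := memL2_affine (- t) (oner_neq0 R) Lf.
    have [Lc nc] := memL2J Lt.
    have -> : (fun x => f x * conjc (f (1^-1 *: (x - t)))) =
        (fun x => f x * conjc (f (1 *: x + - t))).
      by apply/funext => x; rewrite invr1 !scale1r.
    apply: (le_trans (normc_cint_mul Lf Lc)).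
    rewrite ler_pM2l// ler_wpM2l ?nrm2_ge0//.
    by apply: (le_trans nc); rewrite nt normr1 expr1n invr1 sqrtr1 mul1r.
  have := normc_fourier1_correlation ltr01 i_f i_f ih Lf Lf iH eta.
  rewrite H1 invr1 expr1n !mul1r => le1.
  have ic : cintegrable mu (fun w => conjc (fourier1 f (1 *: w)) * h w * fourier1 f w).
    apply: (cintegrableM _ mF (fun w => normc_fourier1 w i_f)).
    apply: (cintegrableMl ih (cmeasurable_fourier1_scale 1 mf)) => w.
    by rewrite normcJ; exact: normc_fourier1.
  have GE w : G k w = (complex.Re (conjc (fourier1 f (1 *: w)) * h w * fourier1 f w))%:E.
    rewrite /G /h subr0 scale1r normc_sqr; case: (fourier1 f w) => a b /=.
    by congr EFin; ring.
  under eq_integral do rewrite GE.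
  rewrite -[leLHS]fineK; last exact: (integrable_fin_num _ ic.1).
  rewrite lee_fin; apply: (le_trans (ler_norm _)).
  apply: (le_trans _ (le_trans le1 _)); first exact: (ler_Re_normc (cint mu _)).
  by rewrite le_eqVlt; apply/orP; left; apply/eqP; ring.
have le2 : (\int[mu]_w (normc (fourier1 f w) ^+ 2)%:E <= ((2 * nrm2 f) ^+ 2)%:E)%E.
  have -> : (\int[mu]_w (normc (fourier1 f w) ^+ 2)%:E = \int[mu]_w limn (G ^~ w))%E.
    apply: eq_integral => w _; apply/esym/cvg_lim; first exact: ereal_hausdorff.
    apply: cvg_EFin; first exact: nearW.
    rewrite -[X in _ --> X]mulr1; apply: cvgM; first exact: cvg_cst.
    exact: cvg_gauss_harmonic.
  rewrite (monotone_convergence mu measurableT mG G0 ndG).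
  apply: lime_le; last exact: nearW.
  apply: ereal_nondecreasing_is_cvgn => k l kl; apply: ge0_le_integral.
  - exact: measurableT.
  - by move=> w _; exact: G0.
  - exact: mG.
  - exact: mG.
  - by move=> w _; exact: ndG.
have LF : memLp 2%:E (fourier1 f).
  by apply/(memL2P mF); apply: (le_lt_trans le2); rewrite ltry.
split => //; rewrite -(ler_pXn2r (_ : 0 < 2)%N) ?nnegrE ?nrm2_ge0 ?mulr_ge0 ?nrm2_ge0//.
by rewrite -lee_fin -(nrm2_sqr LF).
Qed.

Lemma memL1_cintegrable f : memLp 1%:E f -> cintegrable mu f.
Proof. by move=> Lf; apply/(memL1P (measurable_memLp Lf)). Qed.

(** Both sides are continuous in the L^2 norm, because h and its transform lie in L^2. The formula
    for integrable functions therefore passes to the limit along the approximants of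
    [is_fourier2]. *)
Lemma fourier2_mult f F h : memLp 2%:E f -> is_fourier2 f F ->
  cintegrable mu h -> memLp 2%:E h -> memLp 2%:E (fourier1 h) ->
  cint mu (fun w => h w * F w) = cint mu (fun x => f x * fourier1 h x).
Proof.
move=> Lf [LF [f_ [f_L /cvg_nrm2 a0 /cvg_nrm2 c0]]] ih Lh LH.
pose a := fun k => nrm2 (fun x => f_ k x - f x).
pose c := fun k => nrm2 (fun x => fourier1 (f_ k) x - F x).
rewrite -/a in a0; rewrite -/c in c0.
apply: eq_complex_normc_le0.
apply: (@le0_cvg0 (fun k => 2 * (nrm2 h * c k) + 2 * (a k * nrm2 (fourier1 h)))); last first.
  rewrite -[X in _ --> X]addr0; apply: cvgD.
    rewrite -[X in _ --> X](mulr0 2); apply: cvgM; first exact: cvg_cst.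
    by rewrite -[X in _ --> X](mulr0 (nrm2 h)); apply: cvgM => //; exact: cvg_cst.
  rewrite -[X in _ --> X](mulr0 2); apply: cvgM; first exact: cvg_cst.
  by rewrite -[X in _ --> X](mul0r (nrm2 (fourier1 h))); apply: cvgM => //; exact: cvg_cst.
move=> k; have [/memL1_cintegrable ik Lk] := f_L k.
have [LFk _] := plancherel_le ik Lk.
have [LFB _] := memL2B LFk LF; have [LfB _] := memL2B Lk Lf.
have [i1 _] := cauchy_schwarz Lh LF; have [i2 _] := cauchy_schwarz Lh LFk.
have [i3 _] := cauchy_schwarz Lf LH; have [i4 _] := cauchy_schwarz Lk LH.
have E : cint mu (fun w => h w * F w) - cint mu (fun x => f x * fourier1 h x) =
   - (cint mu (fun w => h w * (fourier1 (f_ k) w - F w))) +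
   cint mu (fun x => (f_ k x - f x) * fourier1 h x).
  have -> : (fun w => h w * (fourier1 (f_ k) w - F w)) =
      (fun w => h w * fourier1 (f_ k) w - h w * F w).
    by apply/funext => w; ring.
  have -> : (fun x => (f_ k x - f x) * fourier1 h x) =
      (fun x => f_ k x * fourier1 h x - f x * fourier1 h x).
    by apply/funext => w; ring.
  rewrite (cintB i2 i1) (cintB i4 i3) (fourier1_mult ik ih); ring.
rewrite E; apply: (le_trans (le_normcD _ _)); rewrite normcN; apply: lerD.
  exact: (normc_cint_mul Lh LFB).
exact: (normc_cint_mul LfB LH).
Qed.

End plancherel.

(** * From vanishing wavelet coefficients to the transforms of f and psi *)

Section wavelet_fourier.
Variables (R : realType) (n : nat).
Local Notation V := 'rV[R]_n.
Local Notation mu := (@lebesgue_rV R n).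
Local Notation normc := (@Normc.normc R).
Implicit Types (f g h : V -> R[i]).

Lemma memL2_scale (a : R) f : a != 0 -> memLp 2%:E f ->
  memLp 2%:E (fun x => f (a *: x)) /\
  nrm2 (fun x => f (a *: x)) = Num.sqrt (`|a| ^- n) * nrm2 f.
Proof.
move=> a0 Lf; have := memL2_affine (0 : V) a0 Lf.
by have -> : (fun x => f (a *: x + 0)) = (fun x => f (a *: x))
  by apply/funext => x; rewrite addr0.
Qed.

Lemma memL2_window (a : R) (t : V) f : a != 0 -> memLp 2%:E f ->
  memLp 2%:E (fun x => conjc (f (a *: (x - t)))) /\
  nrm2 (fun x => conjc (f (a *: (x - t)))) <= Num.sqrt (`|a| ^- n) * nrm2 f.
Proof.
move=> a0 Lf; have [La na] := memL2_affine (- (a *: t)) a0 Lf.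
have [Lc nc] := memL2J La; rewrite na in nc.
by have <- : (fun x => conjc (f (a *: x + - (a *: t)))) =
    (fun x => conjc (f (a *: (x - t)))) by apply/funext => x; rewrite scalerBr.
Qed.

Lemma memL2_conj_scaleM (a : R) h f : a != 0 -> memLp 2%:E f ->
  cmeasurable_fun h -> (forall x, normc (h x) <= 1) ->
  memLp 2%:E (fun x => conjc (f (a *: x)) * h x) /\
  nrm2 (fun x => conjc (f (a *: x)) * h x) <= Num.sqrt (`|a| ^- n) * nrm2 f.
Proof.
move=> a0 Lf mh h1; have [La na] := memL2_scale a0 Lf.
have [Lc nc] := memL2J La; have [Lh nh] := memL2M mh h1 Lc.
have <- : (fun x => h x * conjc (f (a *: x))) = (fun x => conjc (f (a *: x)) * h x).
  by apply/funext => x; rewrite mulrC.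
by split => //; rewrite -na (le_trans nh).
Qed.

(* t |-> <f, psi_(s,t)> has Fourier transform conj(psi^(s .)) f^ up to a
   constant, and it vanishes identically. *)
Lemma fourier2_wavelet0 f psi F G h (s : R) : 0 < s ->
  memLp 2%:E f -> memLp 2%:E psi -> is_fourier2 f F -> is_fourier2 psi G ->
  (forall t, cint mu (fun x => f x * conjc (psi (s^-1 *: (x - t)))) = 0) ->
  cintegrable mu h -> (forall w, normc (h w) <= 1) -> cintegrable mu (fourier1 h) ->
  cint mu (fun w => conjc (G (s *: w)) * h w * F w) = 0.
Proof.
move=> s0 Lf Lpsi [LF [f_ [f_L /cvg_nrm2 a0 /cvg_nrm2 c0]]].
move=> [LG [p_ [p_L /cvg_nrm2 b0 /cvg_nrm2 e0]]] orth ih h1 iH.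
have sn0 : s != 0 by rewrite gt_eqF.
have sV0 : s^-1 != 0 by rewrite invr_eq0.
have mh := cintegrable_measurable ih.
pose a := fun k => nrm2 (fun x => f_ k x - f x).
pose b := fun k => nrm2 (fun x => p_ k x - psi x).
pose c := fun k => nrm2 (fun x => fourier1 (f_ k) x - F x).
pose e := fun k => nrm2 (fun x => fourier1 (p_ k) x - G x).
rewrite -/a in a0; rewrite -/b in b0; rewrite -/c in c0; rewrite -/e in e0.
(* [S] and [T] are the factors by which composition with [x |-> s x] and with [x |-> x / s] changes
   the L^2 norm. *)
pose S := Num.sqrt (`|s| ^- n); pose T := Num.sqrt (`|s^-1| ^- n).
have S0 : 0 <= S by exact: sqrtr_ge0.
have T0 : 0 <= T by exact: sqrtr_ge0.
(* A bound, uniform in t, on the coefficients of the approximants: those of f and psi vanish, so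
   only the approximation errors [a k] and [b k] remain. *)
pose eta k := 2 * (a k * (T * (b k + nrm2 psi)) + nrm2 f * (T * b k)).
pose I := \int[mu]_t normc (fourier1 h t).
(* The first summand is the cost of replacing F and G by the transforms of the approximants; the
   second is the correlation bound for the approximants themselves. *)
pose E k := 2 * (S * e k * (c k + nrm2 F) + S * nrm2 G * c k) + s^-1 ^+ n * (2 * (I * eta k)).
have eta0 : eta k @[k --> \oo] --> 0.
  have -> : 0 = 2 * (0 * (T * (0 + nrm2 psi)) + nrm2 f * (T * 0)) by ring.
  apply: cvgM; first exact: cvg_cst.
  apply: cvgD; apply: cvgM => //; first last.
  - by apply: cvgM => //; exact: cvg_cst.
  - exact: cvg_cst.
  - by apply: cvgM; [exact: cvg_cst|apply: cvgD => //; exact: cvg_cst].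
have E0 : E k @[k --> \oo] --> 0.
  have -> : 0 = 2 * (S * 0 * (0 + nrm2 F) + S * nrm2 G * 0) + s^-1 ^+ n * (2 * (I * 0)) by ring.
  apply: cvgD.
    apply: cvgM; first exact: cvg_cst.
    apply: cvgD; last by apply: cvgM => //; exact: cvg_cst.
    apply: cvgM; last by apply: cvgD => //; exact: cvg_cst.
    by apply: cvgM => //; exact: cvg_cst.
  do 3 (apply: cvgM; first exact: cvg_cst).
  exact: eta0.
have bound k : normc (cint mu (fun w => conjc (G (s *: w)) * h w * F w)) <= E k.
  have [/memL1_cintegrable ifk Lfk] := f_L k; have [/memL1_cintegrable ipk Lpk] := p_L k.
  have [LFk _] := plancherel_le ifk Lfk; have [LGk _] := plancherel_le ipk Lpk.
  have [Lfb _] := memL2B Lfk Lf; have [Lpb _] := memL2B Lpk Lpsi.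
  have [LFB _] := memL2B LFk LF; have [LGB _] := memL2B LGk LG.
  have [LGh nGh] := memL2_conj_scaleM sn0 LG mh h1.
  have [LGkh _] := memL2_conj_scaleM sn0 LGk mh h1.
  have [LGBh nGBh] := memL2_conj_scaleM sn0 LGB mh h1.
  have nFk : nrm2 (fourier1 (f_ k)) <= c k + nrm2 F by exact: nrm2_le_dist.
  have npk : nrm2 (p_ k) <= b k + nrm2 psi by exact: nrm2_le_dist.
  pose Lk := cint mu (fun w => conjc (fourier1 (p_ k) (s *: w)) * h w * fourier1 (f_ k) w).
  have le_eta t : normc (cint mu (fun x => f_ k x * conjc (p_ k (s^-1 *: (x - t))))) <= eta k.
    have [Lw nw] := memL2_window t sV0 Lpk; have [Lw' nw'] := memL2_window t sV0 Lpsi.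
    have [Lwb nwb] := memL2_window t sV0 Lpb.
    have := normc_cint_mulB Lfk Lw Lf Lw'; rewrite orth subr0.
    have -> : (fun x => conjc (p_ k (s^-1 *: (x - t))) - conjc (psi (s^-1 *: (x - t)))) =
        (fun x => conjc (p_ k (s^-1 *: (x - t)) - psi (s^-1 *: (x - t)))).
      by apply/funext => x; rewrite rmorphB.
    move/le_trans; apply; rewrite /eta ler_pM2l//; apply: lerD.
      apply: ler_wpM2l; first exact: nrm2_ge0.
      by apply: (le_trans nw); apply: ler_wpM2l.
    by apply: ler_wpM2l => //; exact: nrm2_ge0.
  have := normc_fourier1_correlation s0 ifk ipk ih Lfk Lpk iH le_eta.
  rewrite -/Lk -/I => le2.
  have le1 := normc_cint_mulB LGkh LFk LGh LF; rewrite -/Lk in le1.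
  have eqB : (fun x => conjc (fourier1 (p_ k) (s *: x)) * h x - conjc (G (s *: x)) * h x) =
     (fun x => conjc (fourier1 (p_ k) (s *: x) - G (s *: x)) * h x).
    by apply/funext => x; rewrite rmorphB mulrBl.
  rewrite eqB in le1.
  set L := cint mu _ in le1 *.
  have -> : L = - (Lk - L) + Lk by ring.
  apply: (le_trans (le_normcD _ _)); rewrite normcN; apply: lerD; last exact: le2.
  apply: (le_trans le1); rewrite ler_pM2l//; apply: lerD.
    apply: ler_pM => //; exact: nrm2_ge0.
  by apply: ler_pM => //; exact: nrm2_ge0.
apply: eq_complex_normc_le0; rewrite subr0.
exact: le0_cvg0 bound E0.
Qed.

End wavelet_fourier.

(** * Gaussians determine integrable functions *)

Section gauss_determining.
Variables (R : realType) (n : nat).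
Local Notation V := 'rV[R]_n.
Local Notation mu := (@lebesgue_rV R n).
Local Notation normc := (@Normc.normc R).

(** Translated open orthants are closed under intersection, by coordinatewise maxima of the corners,
    and generate the sigma-algebra. Their indicators are products of one-variable functions, hence
    easy to approximate by continuous ones. *)
Definition octant (a : V) : set V := [set x | forall i, a ord0 i < x ord0 i].

Lemma measurable_octant (a : V) : measurable (octant a).
Proof.
have -> : octant a = \bigcap_(i in [set: 'I_n]) ((fun x : V => x ord0 i) @^-1` `]a ord0 i,
  +oo[%classic).
  apply/seteqP; split => [x ax i _ /=|x ax i]; first by rewrite in_itv/= andbT.
  by have := ax i I; rewrite /= in_itv/= andbT.
apply: fin_bigcap_measurable; first exact: finite_finset.
move=> i _; rewrite -[X in measurable X]setTI; apply: measurable_rV_coord => //.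
Qed.

Lemma measurable_sub_sigma_octant (A : set V) : measurable A -> <<s range octant >> A.
Proof.
pose S := g_sigma_algebraType (range octant).
have mcoord (i : 'I_n) : measurable_fun [set: S] (fun x : S => (x : V) ord0 i).
  apply: (measurability _ (RGenOInfty.measurableE R)) => _ [_ [r ->] <-].
  rewrite setTI.
  (* The half-space [r < x_i] is the union of the octants whose corner has [r] in coordinate i and
     [-k] elsewhere. *)
  pose b (k : nat) : V := \row_j (if j == i then r else - k%:R).
  rewrite (_ : _ @^-1` _ = \bigcup_k (octant (b k) : set S)).
    apply: bigcupT_measurable => k; apply: sub_sigma_algebra; by exists (b k).
  apply/seteqP; split => [x /=|x [k _ xk] /=]; rewrite in_itv/= andbT; last first.
    by have := xk i; rewrite mxE eqxx.
  move=> rx; pose M := \sum_j `|(x : V) ord0 j|.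
  (* A natural number above the sum of all [|x_j|] exceeds each [-x_j]. *)
  exists (Num.truncn M).+1 => // j; rewrite mxE; case: eqP => [->//|_].
  rewrite ltrNl; apply: (@le_lt_trans _ _ M); last exact: truncnS_gt.
  apply: (@le_trans _ _ `|(x : V) ord0 j|); first by rewrite -normrN ler_norm.
  by rewrite /M (bigD1 j)//= lerDl sumr_ge0.
have mid : measurable_fun [set: S] (fun x : S => (x : V)) by exact/measurable_fun_rVP.
by move=> mA; have := mid measurableT A mA; rewrite setTI.
Qed.

Lemma integrable_indicM (H : V -> R) (A : set V) : measurable A ->
  mu.-integrable setT (fun x => (H x)%:E) ->
  mu.-integrable setT (fun x => (H x * \1_A x)%:E).
Proof.
move=> mA iH; have /measurable_EFinP mH := measurable_int _ iH.
apply: le_integrable iH => //.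
  by apply/measurable_EFinP; apply: measurable_funM => //; exact: measurable_indic.
move=> x _; rewrite lee_fin normrM ler_piMr//.
by rewrite indicE; case: (x \in A); rewrite ?normr1 ?normr0.
Qed.

Lemma dominated_Rcvg (f_ : nat -> V -> R) (f g : V -> R) :
  (forall k, measurable_fun setT (f_ k)) -> measurable_fun setT f ->
  (forall x, f_ k x @[k --> \oo] --> f x) ->
  mu.-integrable setT (fun x => (g x)%:E) ->
  (forall k x, `|f_ k x| <= g x) ->
  (\int[mu]_x f_ k x) @[k --> \oo] --> \int[mu]_x f x.
Proof.
move=> mf_ mf cf ig fg; apply: fine_cvg; rewrite fineK.
  apply: (@dominated_cvg _ _ _ mu setT measurableT _ _ (fun x => (g x)%:E)) => //.
  - by move=> k; exact/measurable_EFinP.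
  - by move=> x _; apply: cvg_EFin; [exact: nearW|exact: cf].
  - by move=> k x _; rewrite lee_fin.
have fgx x : `|f x| <= g x.
  have : `|f_ k x| @[k --> \oo] --> `|f x| by apply: cvg_norm; exact: cf.
  move=> h; rewrite -(cvg_lim (@Rhausdorff R) h); apply: limr_le.
    by apply/cvg_ex; exists `|f x|.
  by apply: nearW => k; exact: fg.
apply: integrable_fin_num => //; apply: le_integrable ig => //; first exact/measurable_EFinP.
by move=> x _; rewrite lee_fin (le_trans (fgx x))// ler_norm.
Qed.

(** Dynkin's argument: the measurable sets over which [H] has integral 0 form a lambda-system
    containing the octants, hence all measurable sets, and this forces [H] to vanish almost
    everywhere. *)
Lemma octant_integral_ae0 (H : V -> R) :
  mu.-integrable setT (fun x => (H x)%:E) ->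
  (forall a, \int[mu]_x (H x * \1_(octant a) x) = 0) ->
  {ae mu, forall x, H x = 0}.
Proof.
move=> iH H0; have /measurable_EFinP mH := measurable_int _ iH.
pose D := [set A : set V | measurable A /\ \int[mu]_x (H x * \1_A x) = 0].
have lim (F : nat -> set V) (A : set V) : (forall k, measurable (F k)) -> measurable A ->
    nondecreasing_seq F -> \bigcup_k F k = A ->
    (forall k, \int[mu]_x (H x * \1_(F k) x) = 0) -> \int[mu]_x (H x * \1_A x) = 0.
  move=> mF mA ndF FA F0.
  suff h : (\int[mu]_x (H x * \1_(F k) x)) @[k --> \oo] --> \int[mu]_x (H x * \1_A x).
    have E : (fun k => \int[mu]_x (H x * \1_(F k) x)) = cst 0 by apply/funext.
    by rewrite E in h; exact: (cvg_unique (@Rhausdorff R) h (cvg_cst 0)).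
  apply: (@dominated_Rcvg _ _ (fun x => `|H x|)).
  - by move=> k; apply: measurable_funM => //; exact: measurable_indic.
  - by apply: measurable_funM => //; exact: measurable_indic.
  - move=> x; apply: cvgM; first exact: cvg_cst.
    apply: cvg_near_cst; have [Ax|nAx] := boolP (x \in A).
      have [k _ Fkx] : (\bigcup_k F k) x by rewrite FA; exact: set_mem.
      near=> l; have kl : (k <= l)%N by near: l; exact: nbhs_infty_ge.
      have /subsetPset FkFl := ndF _ _ kl.
      by rewrite !indicE Ax (mem_set (FkFl _ Fkx)).
    near=> l; rewrite !indicE (negbTE nAx) memNset// => Flx.
    by move/negP: nAx; apply; rewrite inE -FA; exists l.
  - exact: integrable_abse iH.
  - move=> k x; rewrite normrM ler_piMr//.
    by rewrite indicE; case: (x \in F k); rewrite ?normr1 ?normr0.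
(* The whole space enters the lambda-system as the increasing union of the octants with corner
   [(-k, ..., -k)]. *)
have DT : \int[mu]_x (H x * \1_[set: V] x) = 0.
  apply: (lim (fun k => octant (const_mx (- k%:R)))) => //.
  - by move=> k; exact: measurable_octant.
  - move=> k l kl; apply/subsetPset => x xk i; apply: le_lt_trans (xk i).
    by rewrite !mxE lerN2 ler_nat.
  - rewrite -subTset => x _; pose M := \sum_j `|x ord0 j|.
    exists (Num.truncn M).+1 => // j; rewrite mxE.
    rewrite ltrNl; apply: (@le_lt_trans _ _ M); last exact: truncnS_gt.
    apply: (@le_trans _ _ `|x ord0 j|); first by rewrite -normrN ler_norm.
    by rewrite /M (bigD1 j)//= lerDl sumr_ge0.
have sub : <<s range octant >> `<=` D.
  apply: lambda_system_subset.
  - move=> _ _ [a _ <-] [b _ <-]; exists (\row_i Num.max (a ord0 i) (b ord0 i)) => //.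
    apply/seteqP; split => [x xab|x [xa xb] i]; last by rewrite mxE gt_max xa xb.
    by split=> i; have := xab i; rewrite mxE gt_max => /andP[].
  - split => //.
    + move=> A B BA [mA A0] [mB B0]; split; first exact: measurableD.
      have -> : (fun x => H x * \1_(A `\` B) x) = (fun x => H x * \1_A x - H x * \1_B x).
        apply/funext => x; rewrite -mulrBr; congr (_ * _); rewrite !indicE in_setD.
        have [xB|xB] := boolP (x \in B); last by rewrite andbT subr0.
        by rewrite (mem_set (BA _ (set_mem xB))) andbF subrr.
      by rewrite RintegralB ?A0 ?B0 ?subrr//; exact: integrable_indicM.
    + move=> F ndF DF; have mF k : measurable (F k) by case: (DF k).
      have mU : measurable (\bigcup_k F k) by exact: bigcupT_measurable.
      by split => //; apply: (lim F) => // k; case: (DF k).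
  - by move=> _ [a _ <-]; split; [exact: measurable_octant|exact: H0].
  - by [].
have : ae_eq mu setT (fun x => (H x)%:E) (cst 0%E).
  apply: integral_ae_eq => // E _ mE; rewrite integral0.
  have [_ E0] := sub _ (measurable_sub_sigma_octant mE).
  transitivity (\int[mu]_x (H x * \1_E x))%R%:E; last by rewrite E0.
  rewrite fineK; last by apply: integrable_fin_num => //; exact: integrable_indicM.
  rewrite integral_mkcond; apply: eq_integral => x _.
  by rewrite patchE indicE; case: (x \in E); rewrite ?mulr1 ?mulr0.
by apply: filterS => x /(_ I) [].
Unshelve. all: by end_near. Qed.

End gauss_determining.

(** * From Gaussian tests to octants *)

Section gauss_determining_L1.
Variables (R : realType) (n : nat).
Local Notation V := 'rV[R]_n.
Local Notation mu := (@lebesgue_rV R n).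
Local Notation normc := (@Normc.normc R).

Lemma cint0 : cint mu (fun=> 0 : R[i]) = 0.
Proof. by apply: complex_eq; rewrite /= /Rintegral integral0. Qed.

Lemma cint_real (h : V -> R) :
  cint mu (fun x => real_complex R (h x)) = real_complex R (\int[mu]_x h x).
Proof. by apply: complex_eq; rewrite //= /Rintegral integral0. Qed.

(** The inner integral is an average of v around w with Gaussian weight of width [harmonic k]; it
    tends to [v w * gauss_peak]. Dominated convergence is used in z with bound [gauss], then in w
    with bound [|h| * gauss_peak]. Convergence along the sequences [- harmonic k *: z + y] is all
    the continuity of v that this requires. *)
Lemma mollify_Rintegral0 (h v : V -> R) :
  mu.-integrable setT (fun x => (h x)%:E) -> measurable_fun setT v ->
  (forall x, `|v x| <= 1) ->
  (forall y z, v (- harmonic k *: z + y) @[k --> \oo] --> v y) ->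
  (forall k, \int[mu]_w (h w *
    (harmonic k ^+ n * \int[mu]_z (v (- harmonic k *: z + w) * gauss z))) = 0) ->
  \int[mu]_w (h w * v w) = 0.
Proof.
move=> ih mv v1 cv h0; have /measurable_EFinP mh := measurable_int _ ih.
have ig := @integrable_gauss R n; have mg := @measurable_gauss R n.
pose W k (w : V) := \int[mu]_z (v (- harmonic k *: z + w) * gauss z).
have mvk k (w : V) : measurable_fun setT (fun z : V => v (- harmonic k *: z + w)).
  exact: (measurableT_comp mv (measurable_rV_affine _ _)).
have vg k (w z : V) : `|v (- harmonic k *: z + w) * gauss z| <= gauss z.
  by rewrite normrM (ger0_norm (gauss_ge0 z)) ler_piMl ?gauss_ge0.
have G : \int[mu]_z gauss z = gauss_peak R n by rewrite /Rintegral integral_gauss.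
have ivg k (w : V) : mu.-integrable setT (fun z : V => (v (- harmonic k *: z + w) * gauss z)%:E).
  apply: le_integrable ig => //; first by apply/measurable_EFinP; exact: measurable_funM.
  by move=> z _; rewrite lee_fin (le_trans (vg k w z))// ler_norm.
have mW k : measurable_fun setT (W k).
  apply: (@measurable_Rintegral _ _ _ _ _ mu (fun w z : V => v (- harmonic k *: z + w) * gauss z)).
  apply: measurable_funM; last exact: (measurableT_comp mg measurable_snd).
  apply: (measurableT_comp mv).
  apply/measurable_fun_rVP => i; under eq_fun do rewrite !mxE.
  apply: measurable_funD; last exact: (measurableT_comp (measurable_rV_coord i) measurable_fst).
  by apply: measurable_funM => //; exact: (measurableT_comp (measurable_rV_coord i) measurable_snd).
have Wb k w : `|W k w| <= gauss_peak R n.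
  rewrite -G; apply: (le_trans (le_normr_Rintegral measurableT (ivg k w))).
  by apply: le_Rintegral => //; exact: (integrable_norm (ivg k w)).
have cW w : W k w @[k --> \oo] --> v w * gauss_peak R n.
  rewrite -G -RintegralZl//.
  apply: (dominated_Rcvg (f := fun z => v w * gauss z) (g := @gauss R n)) => //.
  - by move=> k; exact: measurable_funM.
  - exact: measurable_funM.
  - by move=> z; apply: cvgM; [exact: cv|exact: cvg_cst].
have lim : (\int[mu]_w (h w * W k w)) @[k --> \oo] --> \int[mu]_w (h w * (v w * gauss_peak R n)).
  apply: (dominated_Rcvg (g := fun w => `|h w| * gauss_peak R n)).
  - by move=> k; exact: measurable_funM.
  - by apply: measurable_funM => //; exact: measurable_funM.
  - by move=> w; apply: cvgM; [exact: cvg_cst|exact: cW].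
  - by under eq_fun do rewrite EFinM; apply: integrableZr => //; exact: integrable_abse ih.
  - by move=> k w; rewrite normrM ler_wpM2l.
(* The Jacobian [harmonic k ^+ n] is cancelled before passing to the limit, since for positive n it
   tends to 0. *)
have E : (fun k => \int[mu]_w (h w * W k w)) = cst 0.
  apply/funext => k; have := h0 k; under eq_Rintegral do rewrite mulrCA -/(W k _).
  rewrite RintegralZl//; last first.
    have := integrableZr measurableT (gauss_peak R n) (integrable_abse ih).
    apply: le_integrable => //; first by apply/measurable_EFinP; exact: measurable_funM.
    move=> w _; rewrite /= lee_fin !normrM normr_id ler_wpM2l//.
    by rewrite (le_trans (Wb k w))// ler_norm.
  by move/eqP; rewrite mulf_eq0 expf_eq0 invr_eq0 pnatr_eq0 andbF => /eqP.
rewrite E in lim.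
have E0 : \int[mu]_w (h w * (v w * gauss_peak R n)) = 0.
  exact: (cvg_unique (@Rhausdorff R) lim (cvg_cst 0)).
have ihv : mu.-integrable setT (fun w => (h w * v w)%:E).
  apply: le_integrable ih => //; first by apply/measurable_EFinP; exact: measurable_funM.
  by move=> w _; rewrite lee_fin normrM ler_piMr.
have : (\int[mu]_w (h w * v w)) * gauss_peak R n = 0.
  rewrite -RintegralZr// -[RHS]E0; apply: eq_Rintegral => w _; by rewrite mulrA.
by move=> /eqP; rewrite mulf_eq0 (gt_eqF (gauss_peak_gt0 R n)) orbF => /eqP.
Qed.

(** Integrating the vanishing Gaussian pairings over the centre t with weight v, by Fubini, pairs
    [H] with a mollified v; letting the width shrink leaves v itself. *)
Lemma gauss_test (H : V -> R[i]) (v : V -> R) : cintegrable mu H ->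
  (forall (a : R) t, 0 < a -> cint mu (fun w => H w * real_complex R (gauss (a *: (w - t)))) = 0) ->
  mu.-integrable setT (fun x => (v x)%:E) -> (forall x, `|v x| <= 1) ->
  (forall y z, v (- harmonic k *: z + y) @[k --> \oo] --> v y) ->
  \int[mu]_w (complex.Re (H w) * v w) = 0 /\ \int[mu]_w (complex.Im (H w) * v w) = 0.
Proof.
move=> iH H0 iv v1 cv; have /measurable_EFinP mv := measurable_int _ iv.
have har0 k : 0 < @harmonic R k by rewrite invr_gt0.
(* The dilation [k.+1] is the inverse of [harmonic k], so the substitution [t = w - harmonic k z]
   turns the kernel into [gauss z]. *)
pose g k (w t : V) := real_complex R (gauss (k.+1%:R *: (w - t))).
have W0 k : cint mu (fun w => H w * cint mu (fun t => real_complex R (v t) * g k w t)) = 0.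
  have mg : cmeasurable_fun (fun p : V * V => g k p.1 p.2).
    apply: cmeasurable_real; apply: (measurableT_comp (@measurable_gauss R n)).
    by apply: measurable_rV_sub; [exact: measurable_fst|exact: measurable_snd].
  have g1 w t : normc (g k w t) <= 1.
    by rewrite normc_real ger0_norm ?gauss_ge0// gauss_le1.
  have [_ ->] := cint_Fubini_kernel iH (cintegrable_real iv) mg g1.
  rewrite -[RHS]cint0; congr cint; apply/funext => t.
  by rewrite H0 ?mulr0// ltr0Sn.
have WE k w : cint mu (fun t => real_complex R (v t) * g k w t) =
    real_complex R (harmonic k ^+ n) *
    real_complex R (\int[mu]_z (v (- harmonic k *: z + w) * gauss z)).
  have N0 : - @harmonic R k != 0 by rewrite oppr_eq0 gt_eqF.
  have ivg : cintegrable mu (fun t => real_complex R (v t) * g k w t).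
    apply: (cintegrableM (M := 1) (cintegrable_real iv)).
      apply: cmeasurable_real; apply: (measurableT_comp (@measurable_gauss R n)).
      by apply: measurable_rV_sub; [exact: measurable_cst|exact: measurable_id].
    by move=> t; rewrite normc_real ger0_norm ?gauss_ge0// gauss_le1.
  rewrite (cint_rV_affine w N0 ivg) normrN gtr0_norm//; congr (_ * _).
  rewrite -cint_real; congr cint; apply/funext => z.
  rewrite /g mulr_real_complex; congr (_ * real_complex _ (gauss _)).
  rewrite opprD addrCA subrr addr0 scaleNr opprK scalerA.
  by rewrite mulfV ?scale1r// pnatr_eq0.
have W0' k : cint mu (fun w => H w * real_complex R (harmonic k ^+ n *
    \int[mu]_z (v (- harmonic k *: z + w) * gauss z))) = 0.
  by rewrite -[RHS](W0 k); congr cint; apply/funext => w; rewrite WE mulr_real_complex.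
have [iRe iIm] := iH.
split; apply: mollify_Rintegral0 => // k.
  have := congr1 (@complex.Re R) (W0' k); rewrite /=; apply: etrans.
  by apply: eq_Rintegral => w _; rewrite ReM /= mulr0 subr0.
have := congr1 (@complex.Im R) (W0' k); rewrite /=; apply: etrans.
by apply: eq_Rintegral => w _; rewrite ImM /= mulr0 add0r.
Qed.

(** The factor [gauss] makes the tests integrable, which an octant indicator alone need not be; it
    is divided out at the end. The last clause is independent of the index m. *)
Lemma octant_test (a : V) : exists v : nat -> V -> R, forall m,
  [/\ mu.-integrable setT (fun x => (v m x)%:E), forall x, `|v m x| <= gauss x,
      forall y z, v m (- harmonic k *: z + y) @[k --> \oo] --> v m y &
      forall x, v k x @[k --> \oo] --> \1_(octant a) x * gauss x].
Proof.
(* This is [exp(-max(r, 0))]: equal to 1 for [r <= 0] and smaller than 1 for [r > 0]. Hence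
   [1 - q(r) ^ m] is continuous and tends to the indicator of [r > 0] as m grows. *)
pose q (r : R) := expR (- ((r + `|r|) / 2)).
have q01 r : 0 <= q r <= 1.
  rewrite expR_ge0 -[leRHS]expR0 ler_expR oppr_le0 divr_ge0//.
  by rewrite -lerBlDl sub0r -normrN ler_norm.
have cq : continuous q.
  move=> r; apply: continuous_comp; last exact: continuous_expR.
  apply: cvgN; apply: cvgM; last exact: cvg_cst.
  by apply: cvgD; [exact: cvg_id|exact: norm_continuous].
pose p m i (r : R) := (1 - q (r - a ord0 i) ^+ m) * gauss_fun r.
have cp m i : continuous (p m i).
  move=> r; apply: cvgM; last exact: continuous_gauss_fun.
  apply: cvgB; first exact: cvg_cst.
  apply: (@continuous_comp _ _ _ (fun r => q (r - a ord0 i)) (fun x => x ^+ m)).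
    apply: (@continuous_comp _ _ _ (fun r => r - a ord0 i) q); last exact: cq.
    by apply: cvgB; [exact: cvg_id|exact: cvg_cst].
  exact: exprn_continuous.
have pb m i r : 0 <= p m i r <= gauss_fun r.
  have /andP[q0 q1] := q01 (r - a ord0 i).
  rewrite mulr_ge0 ?gauss_fun_ge0 ?subr_ge0 ?exprn_ile1//=.
  by rewrite ler_piMl ?gauss_fun_ge0// gerBl exprn_ge0.
pose v m (x : V) := \prod_(i < n) p m i (x ord0 i).
have vb m x : `|v m x| <= gauss x.
  rewrite normr_prod gauss_prod; apply: ler_prod => i _.
  by have /andP[p0 p1] := pb m i (x ord0 i); rewrite normr_ge0 ger0_norm.
have mv m : measurable_fun setT (v m).
  apply: measurable_prod => i _.
  apply: (measurableT_comp (continuous_measurable_fun (cp m i))).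
  exact: measurable_rV_coord.
have cvM : continuous (fun x : R * R => x.1 * x.2) by exact: mul_continuous.
exists v => m; split => //.
- apply: le_integrable (@integrable_gauss R n) => //; first exact/measurable_EFinP.
  by move=> x _; rewrite lee_fin (le_trans (vb m x))// ler_norm.
- move=> y z; apply: (cvg_big cvM) => i _.
  have -> : (fun k => p m i ((- harmonic k *: z + y) ord0 i)) =
      (fun k => p m i (- harmonic k * z ord0 i + y ord0 i)).
    by apply/funext => k; rewrite !mxE.
  apply: (@continuous_cvg _ _ _ _ _ (fun k => - harmonic k * z ord0 i + y ord0 i) (p m i)).
    exact: cp.
  have h : - @harmonic R k * z ord0 i + y ord0 i @[k --> \oo] --> - 0 * z ord0 i + y ord0 i.
    apply: cvgD; last exact: cvg_cst.
    by apply: cvgM; [apply: cvgN; exact: cvg_harmonic|exact: cvg_cst].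
  by rewrite oppr0 mul0r add0r in h.
- move=> x; have -> : \1_(octant a) x * gauss x =
      \prod_(i < n) ((a ord0 i < x ord0 i)%R%:R * gauss_fun (x ord0 i)).
    rewrite big_split/= gauss_prod; congr (_ * _); rewrite indicE.
    have [xa|xa] := boolP (x \in octant a).
      by rewrite big1// => i _; rewrite (set_mem xa i).
    apply/esym/eqP/prodf_eq0.
    have /existsNP[i /negP ai] : ~ octant a x by move=> h; rewrite mem_set in xa.
    by exists i => //; rewrite (negbTE ai).
  apply: (cvg_big cvM) => i _; apply: cvgM; last exact: cvg_cst.
  have -> : (a ord0 i < x ord0 i)%R%:R = 1 - (~~ (a ord0 i < x ord0 i)%R)%:R :> R.
    by case: (_ < _); rewrite ?subr0 ?subrr.
  apply: cvgB; first exact: cvg_cst.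
  case: ltP => ax /=.
    apply: cvg_expr; have /andP[q0 _] := q01 (x ord0 i - a ord0 i).
    rewrite ger0_norm// -expR0 ltr_expR oppr_lt0 divr_gt0//.
    by rewrite ltr_pwDl ?subr_gt0.
  rewrite /q ler0_norm ?subr_le0// subrr mul0r oppr0 expR0.
  by apply: cvg_near_cst; apply: nearW => k; rewrite expr1n.
Qed.

(** The tests converge to octant indicators multiplied by [gauss], so [octant_integral_ae0] is
    applied to [h * gauss]; since [gauss] is positive, h vanishes as well. Real and imaginary parts
    are treated separately. *)
Lemma gauss_determining (H : V -> R[i]) : cintegrable mu H ->
  (forall (a : R) t, 0 < a -> cint mu (fun w => H w * real_complex R (gauss (a *: (w - t)))) = 0) ->
  {ae mu, forall x, H x = 0}.
Proof.
move=> iH H0.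
have aux (h : V -> R) : mu.-integrable setT (fun x => (h x)%:E) ->
    (forall v : V -> R, mu.-integrable setT (fun x => (v x)%:E) -> (forall x, `|v x| <= 1) ->
      (forall y z, v (- harmonic k *: z + y) @[k --> \oo] --> v y) -> \int[mu]_w (h w * v w) = 0) ->
    {ae mu, forall x, h x = 0}.
  move=> ih hv; have /measurable_EFinP mh := measurable_int _ ih.
  have mg := @measurable_gauss R n.
  have ihg : mu.-integrable setT (fun x => (h x * gauss x)%:E).
    apply: le_integrable ih => //; first by apply/measurable_EFinP; exact: measurable_funM.
    by move=> x _; rewrite lee_fin normrM ler_piMr// ger0_norm ?gauss_ge0// gauss_le1.
  suff : {ae mu, forall x, h x * gauss x = 0}.
    by apply: filterS => x /eqP; rewrite mulf_eq0 (gt_eqF (gauss_gt0 x)) orbF => /eqP.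
  apply: octant_integral_ae0 => // a.
  have [v hv'] := octant_test a.
  have lim : (\int[mu]_w (h w * v k w)) @[k --> \oo] --> \int[mu]_w (h w * (\1_(octant a) w *
    gauss w)).
    apply: (dominated_Rcvg (g := fun w => `|h w|)).
    - by move=> k; have [/measurable_int/measurable_EFinP ? _ _ _] := hv' k; exact: measurable_funM.
    - apply: measurable_funM => //; apply: measurable_funM => //.
      by apply: measurable_indic; exact: measurable_octant.
    - by move=> w; apply: cvgM; [exact: cvg_cst|have [_ _ _] := hv' 0%N; exact].
    - exact: integrable_abse ih.
    - move=> k w; have [_ vb _ _] := hv' k.
      by rewrite normrM ler_piMr// (le_trans (vb w))// gauss_le1.
  have E : (fun k => \int[mu]_w (h w * v k w)) = cst 0.
    apply/funext => k; have [iv vb cv _] := hv' k; apply: hv => // x.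
    by rewrite (le_trans (vb x))// gauss_le1.
  rewrite E in lim; rewrite -[RHS](cvg_unique (@Rhausdorff R) lim (cvg_cst 0)).
  by apply: eq_Rintegral => w _; ring.
have hRe := aux _ iH.1 (fun v iv v1 cv => (gauss_test iH H0 iv v1 cv).1).
have hIm := aux _ iH.2 (fun v iv v1 cv => (gauss_test iH H0 iv v1 cv).2).
by apply: filterS2 hRe hIm => x hr hi; apply: complex_eq.
Qed.

End gauss_determining_L1.

(** * Completeness of L^2 and the Fourier transform on L^2 *)

Section L2_completeness.
Variables (R : realType) (n : nat).
Local Notation V := 'rV[R]_n.
Local Notation mu := (@lebesgue_rV R n).
Local Notation normc := (@Normc.normc R).
Implicit Types (f g : V -> R[i]).

(** The increments are absolutely summable, and the sequence is their telescoping series up to its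
    first term. *)
Lemma bounded_variation_cvg (r : R^nat) (c : R) :
  (forall N, \sum_(0 <= k < N) `|r k.+1 - r k| <= c) -> cvgn r.
Proof.
move=> rc; have : cvgn (series (fun k => r k.+1 - r k)).
  apply: normed_cvg; apply: nondecreasing_is_cvgn.
    apply: nondecreasing_series => k _ _; exact: normr_ge0.
  by exists c => _ [N _ <-]; exact: rc.
have -> : series (fun k => r k.+1 - r k) = (fun N => r N - r 0%N).
  by apply/funext => N; rewrite /series/= telescope_sumr.
move=> /cvg_ex[l lP]; apply/cvg_ex; exists (l + r 0%N).
have h : (r N - r 0%N) + r 0%N @[N --> \oo] --> l + r 0%N.
  by apply: cvgD => //; exact: cvg_cst.
have E : (fun N => (r N - r 0%N) + r 0%N) = r by apply/funext => N; rewrite subrK.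
by rewrite E in h.
Qed.

Lemma nneseries_le (u : nat -> \bar R) (c : R) : (forall k, 0 <= u k)%E ->
  (forall N, \sum_(0 <= k < N) u k <= c%:E)%E -> (\sum_(0 <= k <oo) u k <= c%:E)%E.
Proof.
move=> u0 uc; apply: lime_le; first by apply: is_cvg_nneseries => k _ _; exact: u0.
by apply: nearW => N; exact: uc.
Qed.

Lemma geometric_half_le (N : nat) : \sum_(0 <= k < N) 2^-1 ^+ k <= 2 :> R.
Proof.
have -> : \sum_(0 <= k < N) 2^-1 ^+ k = 2 - 2 * 2^-1 ^+ N :> R.
  elim: N => [|N IH]; first by rewrite big_geq// expr0; ring.
  by rewrite big_nat_recr//= IH exprS; field.
by rewrite gerBl mulr_ge0// exprn_ge0.
Qed.

(** The geometric rate is part of the hypothesis, so no subsequence has to be extracted: the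
    sequence itself converges almost everywhere, and Fatou's lemma turns this into the norm
    estimate. *)
Lemma L2_complete (u : nat -> V -> R[i]) : (forall k, memLp 2%:E (u k)) ->
  (forall j k, (k <= j)%N -> nrm2 (fun x => u j x - u k x) <= 2^-1 ^+ k) ->
  exists F, memLp 2%:E F /\
    forall k, nrm2 (fun x => u k x - F x) <= 2^-1 ^+ k.
Proof.
move=> Lu cu; have mu_ k := measurable_memLp (Lu k).
pose D k x := u k.+1 x - u k x.
have LD k : memLp 2%:E (D k) by have [] := memL2B (Lu k.+1) (Lu k).
(* The weight [2^k] keeps the integrals summable, as [2^k * (2^-k)^2 = 2^-k], and still controls the
   increments d, since [(2^k d - 1)^2 >= 0] gives [d <= 2^-k + 2^k d^2]. *)
pose e k x := (2 ^+ k * normc (D k x) ^+ 2)%:E.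
have e0 k x : (0 <= e k x)%E by rewrite lee_fin mulr_ge0 ?sqr_ge0 ?exprn_ge0.
have mn k : measurable_fun setT (fun x => (normc (D k x) ^+ 2)%:E).
  by apply/measurable_EFinP; apply: measurable_funX;
    exact: (measurable_normc (measurable_memLp (LD k))).
have me k : measurable_fun setT (e k).
  by rewrite /e; under eq_fun do rewrite EFinM; exact: measurable_funeM.
pose S x := (\sum_(0 <= k <oo) e k x)%E.
have mS : measurable_fun setT S by apply: ge0_emeasurable_sum => // k x _ _; exact: e0.
have S0 x : (0 <= S x)%E by apply: nneseries_ge0 => k _ _; exact: e0.
have IS : (\int[mu]_x S x <= 2%:E)%E.
  rewrite integral_nneseries//; apply: nneseries_le.
    by move=> k; apply: integral_ge0 => x _.
  move=> N; apply: le_trans (_ : (\sum_(0 <= k < N) (2^-1 ^+ k)%:E <= 2%:E)%E); last first.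
    by rewrite sumEFin lee_fin geometric_half_le.
  apply: lee_sum => k _; under eq_integral do rewrite /e EFinM.
  rewrite ge0_integralZl_EFin ?exprn_ge0//; last first.
    by move=> x _; rewrite lee_fin sqr_ge0.
  rewrite (nrm2_sqr (LD k)) -EFinM lee_fin.
  have := cu _ _ (leqnSn k); rewrite -/(D k) => cD.
  apply: (@le_trans _ _ (2 ^+ k * (2^-1 ^+ k) ^+ 2)).
    by rewrite ler_wpM2l ?exprn_ge0// lerXn2r ?nnegrE ?nrm2_ge0 ?exprn_ge0.
  by rewrite expr2 mulrA -exprMn divff ?expr1n ?mul1r// pnatr_eq0.
pose A := [set x | (S x < +oo)%E].
have mA : measurable A.
  by rewrite -[A]setTI; exact: emeasurable_fun_infty_o.
have aeA : {ae mu, forall x, A x}.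
  have iS : mu.-integrable setT S.
    apply/integrableP; split => //; apply: le_lt_trans (ltry 2).
    by under eq_integral do rewrite gee0_abs//.
  have := integrable_ae measurableT iS; apply: filterS => x /(_ Logic.I).
  by rewrite ge0_fin_numE.
have bD x N : A x -> \sum_(0 <= k < N) normc (D k x) <= 2 + fine (S x).
  move=> Ax; apply: (@le_trans _ _ (\sum_(0 <= k < N) (2^-1 ^+ k + 2 ^+ k * normc (D k x) ^+ 2))).
    apply: ler_sum => k _; set d := normc _; set p := 2 ^+ k.
    have p0 : 0 < p by rewrite exprn_gt0.
    rewrite exprVn -/p; have := sqr_ge0 (p * d - 1).
    rewrite -(ler_pM2l p0) mulrDr divff ?gt_eqF// => h.
    have d0 : 0 <= d by exact: normc_ge0.
    by nra.
  rewrite big_split/= lerD ?geometric_half_le//.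
  rewrite -lee_fin fineK ?ge0_fin_numE// -sumEFin.
  by apply: nneseries_lim_ge => k _ _; exact: e0.
have cRe x : A x -> cvgn (fun k => complex.Re (u k x)).
  move=> Ax; apply: (@bounded_variation_cvg _ (2 + fine (S x))) => N.
  apply: le_trans (bD x N Ax); apply: ler_sum => k _.
  by rewrite -ReB; exact: ler_Re_normc.
have cIm x : A x -> cvgn (fun k => complex.Im (u k x)).
  move=> Ax; apply: (@bounded_variation_cvg _ (2 + fine (S x))) => N.
  apply: le_trans (bD x N Ax); apply: ler_sum => k _.
  by rewrite -ImB; exact: ler_Im_normc.
(* Outside [A] the sequence is replaced by 0; it then converges at every point, and [F] is
   measurable as a pointwise limit. *)
pose v k x := real_complex R (\1_A x) * u k x.
pose F x := Complex (limn (fun k => complex.Re (v k x))) (limn (fun k => complex.Im (v k x))).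
have mv k : cmeasurable_fun (v k).
  by apply: cmeasurableM => //; apply: cmeasurable_real; exact: measurable_indic.
have vE x k : A x -> v k x = u k x by move=> Ax; rewrite /v indicE mem_set// mul1r.
have v0 x k : ~ A x -> v k x = 0 by move=> Ax; rewrite /v indicE memNset// mul0r.
have vRe x : complex.Re (v k x) @[k --> \oo] --> complex.Re (F x).
  suff : cvgn (fun k => complex.Re (v k x)) by [].
  have [Ax|nAx] := pselect (A x).
    have -> : (fun k => complex.Re (v k x)) = (fun k => complex.Re (u k x)).
      by apply/funext => k; rewrite vE.
    exact: cRe.
  have -> : (fun k => complex.Re (v k x)) = cst 0 by apply/funext => k; rewrite v0.
  exact: is_cvg_cst.
have vIm x : complex.Im (v k x) @[k --> \oo] --> complex.Im (F x).
  suff : cvgn (fun k => complex.Im (v k x)) by [].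
  have [Ax|nAx] := pselect (A x).
    have -> : (fun k => complex.Im (v k x)) = (fun k => complex.Im (u k x)).
      by apply/funext => k; rewrite vE.
    exact: cIm.
  have -> : (fun k => complex.Im (v k x)) = cst 0 by apply/funext => k; rewrite v0.
  exact: is_cvg_cst.
have mF : cmeasurable_fun F.
  split.
    apply: (measurable_fun_cvg (h := fun k x => complex.Re (v k x))) => [k|x _].
      by case: (mv k).
    exact: vRe.
  apply: (measurable_fun_cvg (h := fun k x => complex.Im (v k x))) => [k|x _].
    by case: (mv k).
  exact: vIm.
have le k : (\int[mu]_x (normc (u k x - F x) ^+ 2)%:E <= ((2^-1 ^+ k) ^+ 2)%:E)%E.
  (* Fatou's lemma is applied as j grows. Almost everywhere [G j] is the squared modulus of
     [u (k + j) - u k], whose norm is at most [2^-k] for every j. *)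
  pose G j x := (normc (u k x - v (k + j)%N x) ^+ 2)%:E.
  have mG j : measurable_fun setT (G j).
    apply/measurable_EFinP; apply: measurable_funX; apply: measurable_normc.
    exact: cmeasurableB.
  have cG x : G j x @[j --> \oo] --> (normc (u k x - F x) ^+ 2)%:E.
    suff h : normc (u k x - v (k + j)%N x) ^+ 2 @[j --> \oo] --> normc (u k x - F x) ^+ 2.
      by apply: cvg_EFin; [exact: nearW|exact: h].
    have sh (w : nat -> R) (l : R) : w j @[j --> \oo] --> l -> w (k + j)%N @[j --> \oo] --> l.
      move=> wl; have -> : (fun j => w (k + j)%N) = [sequence w (j + k)%N]_j.
        by apply/funext => j; rewrite addnC.
      by rewrite cvg_shiftn.
    have cR := sh _ _ (vRe x); have cI := sh _ _ (vIm x).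
    have cR' : complex.Re (u k x) - complex.Re (v (k + j)%N x) @[j --> \oo] -->
        complex.Re (u k x) - complex.Re (F x) by apply: cvgB => //; exact: cvg_cst.
    have cI' : complex.Im (u k x) - complex.Im (v (k + j)%N x) @[j --> \oo] -->
        complex.Im (u k x) - complex.Im (F x) by apply: cvgB => //; exact: cvg_cst.
    rewrite normc_sqr ReB ImB !expr2.
    have -> : (fun j => normc (u k x - v (k + j)%N x) ^+ 2) = (fun j =>
        (complex.Re (u k x) - complex.Re (v (k + j)%N x)) * (complex.Re (u k x) - complex.Re (v
          (k + j)%N x)) +
        (complex.Im (u k x) - complex.Im (v (k + j)%N x)) * (complex.Im (u k x) - complex.Im (v
          (k + j)%N x))).
      by apply/funext => j; rewrite normc_sqr ReB ImB !expr2.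
    by apply: cvgD; apply: cvgM.
  have -> : (\int[mu]_x (normc (u k x - F x) ^+ 2)%:E = \int[mu]_x limn_einf (G ^~ x))%E.
    by apply: eq_integral => x _; have [-> _] := cvg_limn_einf_sup (cG x).
  apply: (le_trans (fatou mu measurableT mG _)).
    by move=> j x _; rewrite lee_fin sqr_ge0.
  rewrite limn_einf_lim; apply: lime_le; first exact: is_cvg_einfs.
  apply: nearW => j; apply: (@le_trans _ _ (\int[mu]_x G j x)%E).
    by apply: ereal_inf_lbound; exists j => /=.
  have [Ljk _] := memL2B (Lu (k + j)%N) (Lu k).
  have := nrm2_sqr Ljk => E.
  have -> : (\int[mu]_x G j x = (nrm2 (fun x => u (k + j)%N x - u k x) ^+ 2)%:E)%E.
    rewrite -E; apply: ge0_ae_eq_integral => //.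
    - apply/measurable_EFinP; apply: measurable_funX; apply: measurable_normc.
      exact: cmeasurableB.
    - by move=> x _; rewrite lee_fin sqr_ge0.
    - by move=> x _; rewrite lee_fin sqr_ge0.
    - by apply: filterS aeA => x Ax _; rewrite /G vE// -normcN opprB.
  by rewrite lee_fin lerXn2r ?nnegrE ?nrm2_ge0 ?exprn_ge0// cu// leq_addr.
have LB k : memLp 2%:E (fun x => u k x - F x).
  by apply/(memL2P (cmeasurableB (mu_ k) mF)); apply: le_lt_trans (le k) (ltry _).
have LF : memLp 2%:E F.
  have [L0 _] := memL2B (Lu 0%N) (LB 0%N).
  by have -> : F = (fun x => u 0%N x - (u 0%N x - F x)) by apply/funext => x; rewrite subKr.
exists F; split => // k.
rewrite -(ler_pXn2r (_ : 0 < 2)%N) ?nnegrE ?nrm2_ge0 ?exprn_ge0//.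
by rewrite -lee_fin -(nrm2_sqr (LB k)).
Qed.

End L2_completeness.

(** * Existence and injectivity of the Fourier transform on L^2 *)

Section fourier2_theory.
Variables (R : realType) (n : nat).
Local Notation V := 'rV[R]_n.
Local Notation mu := (@lebesgue_rV R n).
Local Notation normc := (@Normc.normc R).
Implicit Types (f g : V -> R[i]).

(** Cutting f off to sets of finite measure that exhaust the space is enough: the indicator of such
    a set is in L^2, so its product with f is integrable by Cauchy-Schwarz, and the error tends to 0
    by dominated convergence with bound [|f|^2]. *)
Lemma L1L2_dense f (eps : R) : memLp 2%:E f -> 0 < eps ->
  exists g, [/\ cintegrable mu g, memLp 2%:E g & nrm2 (fun x => g x - f x) <= eps].
Proof.
move=> Lf eps0; have mf := measurable_memLp Lf.
have /sigma_finiteP[E [ET ndE Eoo]] := sigma_finiteT mu.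
pose I k x := real_complex R (\1_(E k) x).
have mE k : measurable (E k) by case: (Eoo k).
have mI k : cmeasurable_fun (I k) by apply: cmeasurable_real; exact: measurable_indic.
have I1 k x : normc (I k x) <= 1.
  by rewrite normc_real indicE; case: (x \in E k); rewrite ?normr1 ?normr0.
have LI k : memLp 2%:E (I k).
  apply/(memL2P (mI k)); have [_] := Eoo k.
  rewrite -[X in (mu X < _)%E]setIT -integral_indic//; apply: le_lt_trans.
  rewrite le_eqVlt; apply/orP; left; apply/eqP; apply: eq_integral => x _.
  by rewrite normc_real indicE; case: (x \in E k); rewrite ?normr1 ?normr0 ?expr1n ?expr0n.
have LIf k : memLp 2%:E (fun x => I k x * f x) by have [] := memL2M (mI k) (I1 k) Lf.
have LB k : memLp 2%:E (fun x => I k x * f x - f x) by have [] := memL2B (LIf k) Lf.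
have mnf : measurable_fun setT (fun x => normc (f x) ^+ 2).
  by apply: measurable_funX; exact: measurable_normc.
have lim : (\int[mu]_x normc (I k x * f x - f x) ^+ 2) @[k --> \oo] --> \int[mu]_x (cst 0 x : R).
  apply: (dominated_Rcvg (g := fun x => normc (f x) ^+ 2)).
  - by move=> k; apply: measurable_funX; apply: measurable_normc; exact: (measurable_memLp (LB k)).
  - exact: measurable_cst.
  - move=> x; apply: cvg_near_cst.
    have [k _ Ekx] : (\bigcup_k E k) x by rewrite -ET.
    near=> l; have kl : (k <= l)%N by near: l; exact: nbhs_infty_ge.
    have /subsetPset EkEl := ndE _ _ kl.
    by rewrite /I indicE mem_set ?mul1r ?subrr ?normc_real ?normr0 ?expr0n//; exact: EkEl.
  - by apply/integrableP; split; [exact/measurable_EFinP|under eq_integral do rewrite gee0_abs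
    ?lee_fin ?sqr_ge0//; exact: (memL2P mf).1].
  - move=> k x; rewrite ger0_norm ?sqr_ge0// lerXn2r ?nnegrE ?normc_ge0//.
    rewrite /I indicE; case: (x \in E k) => /=; rewrite ?mul1r ?mul0r ?subrr ?sub0r ?normcN//.
    by rewrite normc_real normr0 normc_ge0.
rewrite /Rintegral integral0 /= in lim.
have e20 : 0 < eps ^+ 2 by rewrite exprn_gt0.
have /cvgr0Pnorm_le/(_ _ e20)[k _ /(_ k (leqnn k))] := lim.
rewrite (nrm2_sqr (LB k)) /= ger0_norm ?sqr_ge0// => le_e.
exists (fun x => I k x * f x); split => //; first by have [] := cauchy_schwarz (LI k) Lf.
by rewrite -(ler_pXn2r (_ : 0 < 2)%N) ?nnegrE ?nrm2_ge0// ltW.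
Unshelve. all: by end_near. Qed.

Lemma cvg_cnorm2 (f_ : nat -> V -> R[i]) f (e : R^nat) :
  (forall k, memLp 2%:E (fun x => f_ k x - f x)) ->
  (forall k, nrm2 (fun x => f_ k x - f x) <= e k) -> e k @[k --> \oo] --> 0 ->
  cnorm 2%:E (f_ k - f) @[k --> \oo] --> 0%E.
Proof.
move=> Lff fe e0.
have -> : (fun k => cnorm 2%:E (f_ k - f)) = (fun k => (nrm2 (fun x => f_ k x - f x))%:E).
  by apply/funext => k; exact: (memL2_nrm (Lff k)).
apply: cvg_EFin; first exact: nearW.
apply: (@squeeze_cvgr _ _ _ _ (cst 0) e) => //; last exact: cvg_cst.
by apply: nearW => k; rewrite nrm2_ge0 fe.
Qed.

Lemma is_fourier2_exists f : memLp 2%:E f -> exists F, is_fourier2 f F.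
Proof.
(* The quarter pays for two doublings: the triangle inequality for [g j - g k], and the constant of
   [plancherel_le]. The rate left is at most the [2^-k] that [L2_complete] asks for. *)
move=> Lf; pose e k : R := 2^-1 ^+ k / 4.
have e0 k : 0 < e k by rewrite divr_gt0// exprn_gt0.
have /choice[g gP] : forall k, exists g, [/\ cintegrable mu g, memLp 2%:E g &
    nrm2 (fun x => g x - f x) <= e k] by move=> k; exact: L1L2_dense.
have ig k : cintegrable mu (g k) by case: (gP k).
have Lg k : memLp 2%:E (g k) by case: (gP k).
have ge k : nrm2 (fun x => g k x - f x) <= e k by case: (gP k).
have LG k : memLp 2%:E (fourier1 (g k)) by have [] := plancherel_le (ig k) (Lg k).
have [|F [LF Fe]] := @L2_complete _ _ (fun k => fourier1 (g k)) LG.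
  move=> j k kj; have [Lgjk _] := memL2B (Lg j) (Lg k).
  have -> : (fun x => fourier1 (g j) x - fourier1 (g k) x) =
      fourier1 (fun x => g j x - g k x).
    by apply/funext => x; rewrite fourier1B.
  have [_ le] := plancherel_le (cintegrableB (ig j) (ig k)) Lgjk.
  apply: (le_trans le).
  have [Lgj _] := memL2B (Lg j) Lf; have [Lgk _] := memL2B (Lg k) Lf.
  have [_] := memL2B Lgj Lgk.
  have -> : (fun x => g j x - f x - (g k x - f x)) = (fun x => g j x - g k x).
    by apply/funext => x; ring.
  have ejk : e j <= e k.
    by rewrite ler_pM2r// ler_wiXn2l// invf_le1// ler1n.
  have := ge j; have := ge k; rewrite /e in ejk *; lra.
have half0 : (2^-1 : R) ^+ k @[k --> \oo] --> 0.
  by apply: cvg_expr; rewrite ger0_norm// invf_lt1// ltr1n.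
exists F; split => //; exists g; split.
- by move=> k; split => //; apply/memL1P => //; exact: (cintegrable_measurable (ig k)).
- apply: (cvg_cnorm2 (e := e)) => //; first by move=> k; have [] := memL2B (Lg k) Lf.
  rewrite -(mul0r 4^-1); apply: cvgM => //; exact: cvg_cst.
- apply: (cvg_cnorm2 (e := fun k => 2^-1 ^+ k)) => //.
  by move=> k; have [] := memL2B (LG k) LF.
Qed.

Lemma fourier2P f : memLp 2%:E f -> is_fourier2 f (fourier2 f).
Proof. by move=> /is_fourier2_exists; exact: xgetPex. Qed.

Lemma memL2_bounded (h : V -> R[i]) : cintegrable mu h -> (forall x, normc (h x) <= 1) ->
  memLp 2%:E h.
Proof.
move=> ih h1; have mh := cintegrable_measurable ih.
apply/(memL2P mh); apply: le_lt_trans ((cintegrableP mu mh).1 ih).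
apply: ge0_le_integral.
- exact: measurableT.
- by move=> x _; rewrite lee_fin sqr_ge0.
- by apply/measurable_EFinP; apply: measurable_funX; exact: measurable_normc.
- by apply/measurable_EFinP; exact: measurable_normc.
- by move=> x _; rewrite lee_fin expr2 ler_piMr ?normc_ge0.
Qed.

Lemma normc_gauss_le1 (x : V) : normc (real_complex R (gauss x)) <= 1.
Proof. by rewrite normc_real ger0_norm ?gauss_ge0// gauss_le1. Qed.

Lemma memL2_gauss_shift (a : R) (t : V) : a != 0 ->
  memLp 2%:E (fun x => real_complex R (gauss (a *: (x - t)))).
Proof.
move=> a0; apply: memL2_bounded; first exact: cintegrable_gauss_shift.
by move=> x; exact: normc_gauss_le1.
Qed.

(** Completing the square. Up to a constant, multiplication by [gauss] maps the family of shifted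
    and dilated Gaussians into itself. *)
Lemma gauss_mul (a : R) (t x : V) : gauss x * gauss (a *: (x - t)) =
  expR (- (a ^+ 2 / (1 + a ^+ 2) * dot t t)) *
  gauss (Num.sqrt (1 + a ^+ 2) *: (x - (a ^+ 2 / (1 + a ^+ 2)) *: t)).
Proof.
have b0 : 0 < 1 + a ^+ 2 by rewrite ltr_pwDl// sqr_ge0.
rewrite !gauss_scaleE sqr_sqrtr ?(ltW b0)// /gauss -!expRD; congr expR.
rewrite !dotBl !dotBr !dotZl !dotZr (dotC t x); field.
by rewrite gt_eqF.
Qed.

(** A function in L^2 need not be integrable, but [f * gauss] is. By [gauss_mul] it is again
    orthogonal to all the Gaussians, so the integrable case applies to it. *)
Lemma gauss_determining_L2 f : memLp 2%:E f ->
  (forall (a : R) t, 0 < a -> cint mu (fun w => f w * real_complex R (gauss (a *: (w - t)))) = 0) ->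
  {ae mu, forall x, f x = 0}.
Proof.
move=> Lf f0; have Lg : memLp 2%:E (fun x : V => real_complex R (gauss x)).
  have -> : (fun x : V => real_complex R (gauss x)) =
      (fun x : V => real_complex R (gauss (1 *: (x - 0)))).
    by apply/funext => x; rewrite scale1r subr0.
  exact: memL2_gauss_shift (oner_neq0 R).
have [ifg _] := cauchy_schwarz Lf Lg.
have : {ae mu, forall x, f x * real_complex R (gauss x) = 0}.
  apply: gauss_determining => // a t a0.
  have b0 : 0 < Num.sqrt (1 + a ^+ 2) by rewrite sqrtr_gt0 ltr_pwDl// sqr_ge0.
  have [ifg' _] := cauchy_schwarz Lf (memL2_gauss_shift ((a ^+ 2 / (1 + a ^+ 2)) *: t) (lt0r_neq0
    b0)).
  have -> : (fun w => f w * real_complex R (gauss w) * real_complex R (gauss (a *: (w - t)))) =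
      (fun w => real_complex R (expR (- (a ^+ 2 / (1 + a ^+ 2) * dot t t))) *
        (f w * real_complex R (gauss (Num.sqrt (1 + a ^+ 2) *: (w - (a ^+ 2 / (1 + a ^+ 2)) *:
          t))))).
    apply/funext => w; rewrite -mulrA -mulr_real_complex gauss_mul mulr_real_complex.
    by rewrite mulrCA.
  by rewrite (cintZl _ ifg') f0// mulr0.
apply: filterS => x /eqP; rewrite mulf_eq0 => /orP[/eqP//|/eqP/(congr1 (@complex.Re R)) /= g0].
by have := gauss_gt0 x; rewrite g0 ltxx.
Qed.

Lemma cint_ae0 f : cmeasurable_fun f -> {ae mu, forall x, f x = 0} -> cint mu f = 0.
Proof.
move=> [mr mi] f0; apply: complex_eq; rewrite /= /Rintegral.
  rewrite (ae_eq_integral (cst 0%E))//; first by rewrite integral0.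
    exact/measurable_EFinP.
  by apply: filterS f0 => x -> _.
rewrite (ae_eq_integral (cst 0%E))//; first by rewrite integral0.
  exact/measurable_EFinP.
by apply: filterS f0 => x -> _.
Qed.

(** Every Gaussian is a transform up to a positive constant. The dilation [pi / b] of g turns into
    b, because [pi / (pi / b) = b], and the modulation by [exp(2 pi i t.w)] turns into the
    translation by t. *)
Lemma fourier2_inj f F : memLp 2%:E f -> is_fourier2 f F ->
  {ae mu, forall w, F w = 0} -> {ae mu, forall x, f x = 0}.
Proof.
move=> Lf fF F0; apply: gauss_determining_L2 => // b t b0.
have a0 : 0 < pi / b by rewrite divr_gt0 ?pi_gt0.
pose g w := real_complex R (gauss ((pi / b) *: (w - 0 : V))).
pose h w := g w * expi (2 * pi * dot t w).
have ig : cintegrable mu g by exact: (cintegrable_gauss_shift _ (lt0r_neq0 a0)).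
have me : cmeasurable_fun (fun w : V => expi (2 * pi * dot t w)).
  apply: cmeasurable_expi; apply: measurable_funM => //.
  by apply: measurable_dot; [exact: measurable_cst|exact: measurable_id].
have ih : cintegrable mu h.
  by apply: (cintegrableM (M := 1) ig me) => w; rewrite normc_expi.
have Lh : memLp 2%:E h.
  apply: memL2_bounded => // w.
  by rewrite Normc.normcM normc_expi mulr1; exact: normc_gauss_le1.
have [LH _] := plancherel_le ih Lh.
have hE x : fourier1 h x = real_complex R ((pi / b) ^- n * gauss_peak R n) *
    real_complex R (gauss (b *: (x - t))).
  have -> : fourier1 h x = fourier1 g (x - t).
    rewrite !fourier1E; congr cint; apply/funext => w.
    by rewrite /h -mulrA -expiD dotBl; congr (_ * expi _); ring.
  rewrite (fourier1_gauss_shift _ _ a0) -(scale0r (0 : V)) dotZr mul0r mulr0 oppr0 expi0 mulr1.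
  have -> : pi / (pi / b) = b by rewrite invf_div mulrC divfK// gt_eqF// pi_gt0.
  exact: mulr_real_complex.
have := fourier2_mult Lf fF ih Lh LH.
rewrite cint_ae0; last 2 first.
- case: fF => LF _; exact: (cmeasurableM (cintegrable_measurable ih) (measurable_memLp LF)).
- by apply: filterS F0 => w ->; rewrite mulr0.
have [ifg _] := cauchy_schwarz Lf (memL2_gauss_shift t (lt0r_neq0 b0)).
have -> : (fun x => f x * fourier1 h x) = (fun x => real_complex R ((pi / b) ^- n * gauss_peak R
  n) *
    (f x * real_complex R (gauss (b *: (x - t))))).
  by apply/funext => x; rewrite hE mulrCA.
rewrite (cintZl _ ifg) => /esym/eqP; rewrite mulf_eq0 => /orP[|/eqP//].
have C0 : 0 < (pi / b) ^- n * gauss_peak R n.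
  by rewrite mulr_gt0 ?gauss_peak_gt0// invr_gt0 exprn_gt0.
by move=> /eqP/(congr1 (@complex.Re R))/= E; rewrite E ltxx in C0.
Qed.

End fourier2_theory.

(** * Radial energies and directions *)

Section enorm_null.
Variable R : realType.

(** The origin lies in the hyperplane where the first coordinate is 0, which is null by integrating
    over that coordinate. In dimension 0 the measure is instead a point mass at the origin. *)
Lemma lebesgue_rV_enorm0 n : (0 < n)%N -> {ae @lebesgue_rV R n, forall x, 0 < enorm x}.
Proof.
case: n => // n _; pose Z := [set x : 'rV[R]_n.+1 | x ord0 ord0 = 0].
have mZ : measurable Z.
  have -> : Z = setT `&` ((fun x : 'rV[R]_n.+1 => x ord0 ord0) @^-1` [set 0]) by rewrite setTI.
  by apply: measurable_rV_coord => //; exact: measurable_set1.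
exists Z; split => //.
  rewrite -[Z]setIT -integral_indic// ge0_integral_rVS;
    [|by apply/measurable_EFinP; exact: measurable_indic|by move=> x; rewrite lee_fin].
  transitivity (\int[lebesgue_measure]_(r in [set (0 : R)%R]) (\int[lebesgue_rV n]_x
      (\1_Z (rV_cons ((r : measurableTypeR R), x)))%:E))%E.
    rewrite [RHS]integral_mkcond; apply: eq_integral => r _; rewrite patchE.
    case: ifPn => // r0; apply: integral0_eq => x _; rewrite indicE memNset// /Z /=.
    by rewrite mxE unlift_none/= => r0'; move/negP: r0; apply; exact: mem_set.
  exact: integral_set1.
move=> x /= /negP; rewrite -leNgt => x0.
have : enorm x = 0 by apply/eqP; rewrite eq_le x0 sqrtr_ge0.
move=> /eqP; rewrite sqrtr_eq0 => d0; apply/eqP; rewrite -sqrf_eq0 eq_le sqr_ge0 andbT.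
apply: le_trans d0; rewrite /dot (bigD1 ord0)//= -expr2 lerDl sumr_ge0// => i _.
by rewrite -expr2 sqr_ge0.
Qed.

End enorm_null.

Section radial.
Variables (R : realType) (n : nat).
Local Notation V := 'rV[R]_n.
Local Notation mu := (@lebesgue_rV R n).
Local Notation leb := (@lebesgue_measure R).
Local Notation normc := (@Normc.normc R).
Implicit Types (F G : V -> R[i]) (x : V).

Lemma lebesgue_rV_scale (a : R) (A : set V) : a != 0 -> measurable A ->
  (mu A = (`|a| ^+ n)%:E * mu ((fun x => a *: x) @^-1` A))%E.
Proof.
move=> a0 mA.
have mA' : measurable ((fun x : V => a *: x) @^-1` A).
  by rewrite -[X in measurable X]setTI; exact: (@measurable_rV_scale R n a).
rewrite -[A in LHS]setIT -integral_indic// -[X in mu X]setIT -integral_indic//.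
rewrite (ge0_integral_rV_affine 0 a0)//; last first.
  by apply/measurable_EFinP; exact: measurable_indic.
congr (_ * _)%E; apply: eq_integral => x _; rewrite addr0 !indicE.
by congr ((nat_of_bool _)%:R%:E); apply/idP/idP; rewrite !inE.
Qed.

Lemma ae_scale (a : R) (P : V -> Prop) : a != 0 ->
  {ae mu, forall x, P x} -> {ae mu, forall x, P (a *: x)}.
Proof.
move=> a0 [A [mA A0 PA]]; exists ((fun x => a *: x) @^-1` A); split.
- by rewrite -[X in measurable X]setTI; exact: (@measurable_rV_scale R n a).
- have := lebesgue_rV_scale a0 mA; rewrite A0 => /esym/eqP.
  rewrite mule_eq0 => /orP[|/eqP//].
  by rewrite eqe expf_eq0 normr_eq0 (negbTE a0) andbF.
- by move=> x Px; exact: PA.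
Qed.

(** The integrand of [radial_energy] extended by 0 to the whole line, so that Tonelli applies on the
    full product of the space with the line. *)
Definition ray_density F x (r : R) : \bar R :=
  (normc (F (r *: x)) ^+ 2 * r ^+ n.-1 * \1_`]0, +oo[%classic r)%:E.

Lemma ray_density_ge0 F x r : (0 <= ray_density F x r)%E.
Proof.
rewrite /ray_density indicE; case: (boolP (r \in _)) => [|_]; last by rewrite mulr0.
rewrite inE/= in_itv/= andbT => r0.
by rewrite mulr1 lee_fin mulr_ge0 ?sqr_ge0 ?exprn_ge0 ?ltW.
Qed.

Lemma radial_energyE F x : radial_energy F x = (\int[leb]_r ray_density F x r)%E.
Proof.
rewrite /radial_energy integral_mkcond; apply: eq_integral => r _.
by rewrite /ray_density patchE indicE; case: (r \in _); rewrite ?mulr1 ?mulr0.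
Qed.

Lemma radial_energy_ge0 F x : (0 <= radial_energy F x)%E.
Proof. by rewrite radial_energyE; apply: integral_ge0 => r _; exact: ray_density_ge0. Qed.

Lemma measurable_ray_density F : cmeasurable_fun F ->
  measurable_fun setT (fun p : V * measurableTypeR R => ray_density F p.1 p.2).
Proof.
move=> mF; apply/measurable_EFinP; apply: measurable_funM.
  apply: measurable_funM; last first.
    by apply: measurable_funX; exact: measurable_snd.
  apply: measurable_funX; apply: measurable_normc; apply: (cmeasurable_comp mF).
  apply/measurable_fun_rVP => i; under eq_fun do rewrite mxE.
  apply: measurable_funM; first exact: measurable_snd.
  exact: (measurableT_comp (measurable_rV_coord i) measurable_fst).
have m1 : measurable_fun [set: measurableTypeR R] (\1_`]0, +oo[%classic : measurableTypeR R -> R).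
  by apply: measurable_indic; exact: measurable_itv.
exact: (measurableT_comp m1 measurable_snd).
Qed.

Lemma measurable_radial_energy F : cmeasurable_fun F ->
  measurable_fun setT (radial_energy F).
Proof.
move=> mF; rewrite (_ : radial_energy F = fun x => \int[leb]_r ray_density F x r)%E; last first.
  by apply/funext => x; exact: radial_energyE.
apply: (@measurable_fun_fubini_tonelli_F _ _ _ _ _ leb (fun p => ray_density F p.1 p.2)).
  exact: measurable_ray_density.
by move=> p; exact: ray_density_ge0.
Qed.

Lemma ge0_integral0_ae (f : V -> \bar R) : measurable_fun setT f ->
  (forall x, 0 <= f x)%E -> (\int[mu]_x f x = 0)%E -> {ae mu, forall x, f x = 0%E}.
Proof.
move=> mf f0 I0; have := (ae_eq_integral_abs mu measurableT mf).1.
under eq_integral do rewrite gee0_abs//.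
by move=> /(_ I0); apply: filterS => x; apply.
Qed.

(** The null set in the hypothesis may vary with s, so nothing can be read off along a fixed ray.
    Two applications of Tonelli bring x innermost, where one null set for each pair (r, s) is
    enough. *)
Lemma ray_density_mul_ae0 F G :
  cmeasurable_fun F -> cmeasurable_fun G ->
  (forall s : R, 0 < s -> {ae mu, forall x, conjc (G (s *: x)) * F x = 0}) ->
  {ae mu, forall x, (radial_energy F x * radial_energy G x = 0)%E}.
Proof.
move=> mF mG FG; have mRF := measurable_radial_energy mF; have mRG := measurable_radial_energy mG.
apply: ge0_integral0_ae.
- exact: emeasurable_funM.
- by move=> x; rewrite mule_ge0// radial_energy_ge0.
have mdF := measurable_ray_density mF; have mdG := measurable_ray_density mG.
pose K (p : V * measurableTypeR R) := (ray_density F p.1 p.2 * radial_energy G p.1)%E.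
have mK : measurable_fun setT K.
  by apply: emeasurable_funM => //; exact: (measurableT_comp mRG measurable_fst).
have K0 p : (0 <= K p)%E by rewrite mule_ge0 ?ray_density_ge0 ?radial_energy_ge0.
transitivity (\int[mu]_x \int[leb]_r K (x, r))%E.
  apply: eq_integral => x _; rewrite {1}radial_energyE -ge0_integralZr//.
  - exact: (measurable_fun_pair2 x mdF).
  - by move=> r _; exact: ray_density_ge0.
  - exact: radial_energy_ge0.
rewrite (@fubini_tonelli _ _ _ _ _ mu leb _ mK K0); apply: integral0_eq => r _.
pose L (p : V * measurableTypeR R) := (ray_density F p.1 r * ray_density G p.1 p.2)%E.
have mL : measurable_fun setT L.
  apply: emeasurable_funM => //.
  exact: (measurableT_comp (measurable_fun_pair1 r mdF) measurable_fst).
have L0 p : (0 <= L p)%E by rewrite mule_ge0 ?ray_density_ge0.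
transitivity (\int[mu]_x \int[leb]_s L (x, s))%E.
  apply: eq_integral => x _; rewrite /K /= radial_energyE -ge0_integralZl//.
  - exact: (measurable_fun_pair2 x mdG).
  - by move=> s _; exact: ray_density_ge0.
  - exact: ray_density_ge0.
rewrite (@fubini_tonelli _ _ _ _ _ mu leb _ mL L0); apply: integral0_eq => s _.
have [r0|r0] := ltP 0 r; last first.
  apply: integral0_eq => x _; rewrite /L /ray_density /= indicE memNset ?mulr0 ?mul0e//=.
  by rewrite in_itv/= andbT; apply/negP; rewrite -leNgt.
have [s0|s0] := ltP 0 s; last first.
  apply: integral0_eq => x _; rewrite /L /ray_density /= [\1__ s]indicE memNset ?mulr0 ?mule0//=.
  by rewrite in_itv/= andbT; apply/negP; rewrite -leNgt.
have r00 : r != 0 by rewrite gt_eqF.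
have aeL : {ae mu, forall x, L (x, s) = 0%E}.
  (* The hypothesis is used at scale [s / r] and at the point [r x], where the argument of G becomes
     [s x]. *)
  have := ae_scale r00 (FG (s / r) (divr_gt0 s0 r0)); apply: filterS => x.
  rewrite scalerA divfK// /L /ray_density => /eqP; rewrite mulf_eq0 => /orP[|] /eqP E /=.
    have -> : normc (G (s *: x)) = 0 by rewrite -normcJ E Normc.normc0.
    by rewrite expr0n/= !mul0r mule0.
  by rewrite E Normc.normc0 expr0n/= !mul0r mul0e.
rewrite (ae_eq_integral (cst 0%E))//; first by rewrite integral0.
  exact: (measurable_fun_pair1 s mL).
by apply: filterS aeL => x -> _.
Qed.

Lemma measurable_ray_density_line F x : cmeasurable_fun F ->
  measurable_fun [set: measurableTypeR R] (ray_density F x).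
Proof. by move=> mF; exact: (measurable_fun_pair2 x (measurable_ray_density mF)). Qed.

(** Replacing r by [c r] yields one factor c from dr and [c^(n-1)] from the weight; [n > 0] makes
    them add up to [c^n]. *)
Lemma radial_energy_scale F (c : R) x : cmeasurable_fun F -> (0 < n)%N -> 0 < c ->
  (radial_energy F x = (c ^+ n)%:E * radial_energy F (c *: x))%E.
Proof.
move=> mF n0 c0; have c00 : c != 0 by rewrite gt_eqF.
rewrite !radial_energyE (ge0_integral_affine 0 c00);
  [|exact: measurable_ray_density_line|by move=> r; exact: ray_density_ge0].
have -> : c ^+ n = c * c ^+ n.-1 by rewrite -exprS prednK.
rewrite gtr0_norm// EFinM -muleA; congr (_ * _)%E.
rewrite -ge0_integralZl_EFin ?exprn_ge0 ?ltW//; last 2 first.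
- by move=> r _; exact: ray_density_ge0.
- exact: measurable_ray_density_line.
apply: eq_integral => r _; rewrite /ray_density addr0 -EFinM exprMn scalerA (mulrC r c) !indicE.
have -> : (c * r \in `]0, +oo[%classic) = (r \in `]0, +oo[%classic).
  by apply/idP/idP; rewrite !inE/= !in_itv/= !andbT pmulr_rgt0.
by congr EFin; ring.
Qed.

Lemma enorm_scale (c : R) x : 0 <= c -> enorm (c *: x) = c * enorm x.
Proof.
move=> c0; rewrite /enorm dotZl dotZr mulrA -expr2 sqrtrM ?sqr_ge0//.
by rewrite sqrtr_sqr ger0_norm.
Qed.

Lemma enorm_ge0 x : 0 <= enorm x. Proof. exact: sqrtr_ge0. Qed.

(** The exceptional set is the complement of [Q]. By homogeneity a point of the punctured ball whose
    direction is outside [Q] is itself outside [Q], so the cone measured by [surface_measure] is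
    null. *)
Lemma ae_unit_vector_homogeneous (Q : set V) : measurable Q ->
  (forall (c : R) x, 0 < c -> Q x -> Q (c *: x)) ->
  {ae mu, forall x, Q x} -> ae_unit_vector Q.
Proof.
move=> mQ hQ aeQ; exists (~` Q); split.
- exact: measurableC.
- rewrite /surface_measure /pushforward /mscale /= /mrestr.
  have -> : mu ((@normalize R n @^-1` (~` Q)) `&` @punctured_ball R n) = 0%E.
    apply: subset_measure0 (_ : mu (~` Q) = 0%E).
    - apply: measurableI; last exact: measurable_punctured_ball.
      rewrite -[X in measurable X]setTI; apply: measurable_normalize => //.
      exact: measurableC.
    - exact: measurableC.
    - move=> x [/= nQ /andP[x0 _]] Qx; apply: nQ.
      by apply: hQ => //; rewrite invr_gt0.
    - by apply/negligibleP; [exact: measurableC|exact: aeQ].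
  by rewrite mule0.
- by move=> x /= /not_implyP[].
Qed.

(** Within the unit ball the cone over the bad directions is null, because [surface_measure] is n
    times the measure of that cone and [n > 0]. Dilations by [k.+1] spread this over the whole space
    at the cost of countably many null sets; the origin is discarded by [lebesgue_rV_enorm0]. *)
Lemma ae_unit_vectorW (Q : V -> Prop) : (0 < n)%N ->
  (forall (c : R) x, 0 < c -> Q x -> Q (c *: x)) ->
  ae_unit_vector Q -> {ae mu, forall x, Q x}.
Proof.
move=> n0 hQ [A [mA A0 QA]].
have {}A0 : mu ((@normalize R n @^-1` A) `&` @punctured_ball R n) = 0%E.
  move: A0; rewrite /surface_measure /pushforward /mscale /= /mrestr => /eqP.
  by rewrite mule_eq0 eqe pnatr_eq0 -[n == 0%N]negbK -lt0n n0/= => /eqP.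
have aeB : {ae mu, forall x, 0 < enorm x <= 1 -> Q x}.
  exists ((@normalize R n @^-1` A) `&` @punctured_ball R n); split.
  - apply: measurableI; last exact: measurable_punctured_ball.
    by rewrite -[X in measurable X]setTI; exact: measurable_normalize.
  - exact: A0.
  - move=> x /= /not_implyP[xb nQ]; split => //; apply: QA => /=.
    have /andP[x0 _] := xb.
    move=> h; apply: nQ.
    have n1 : enorm (normalize x) = 1.
      by rewrite /normalize enorm_scale ?invr_ge0 ?enorm_ge0// mulVf// gt_eqF.
    have := hQ (enorm x) _ x0 (h n1).
    by rewrite /normalize scalerA divff ?scale1r// gt_eqF.
have h (k : nat) : (k.+1%:R : R)^-1 != 0 by rewrite invr_eq0 pnatr_eq0.
have aek := ae_foralln (fun k => ae_scale (h k) aeB).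
apply: filterS2 aek (lebesgue_rV_enorm0 R n0) => x Hx x0.
have k0 : (0 : R) < (Num.truncn (enorm x)).+1%:R by rewrite ltr0Sn.
have e1 : 0 < enorm ((Num.truncn (enorm x)).+1%:R^-1 *: x) <= 1.
  rewrite enorm_scale; last by rewrite invr_ge0 ltW.
  apply/andP; split; first by rewrite mulr_gt0// invr_gt0.
  by rewrite mulrC ler_pdivrMr// mul1r ltW// truncnS_gt.
move: (Hx _ e1) => /(hQ _ _ k0).
by rewrite scalerA divff ?scale1r// gt_eqF.
Qed.

(** With the integrals exchanged, [x |-> F (r *: x)] vanishes almost everywhere for almost every
    positive r. A single such r is enough, since dilations preserve null sets. *)
Lemma radial_energy_ae0 F : cmeasurable_fun F ->
  {ae mu, forall x, radial_energy F x = 0%E} -> {ae mu, forall x, F x = 0}.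
Proof.
move=> mF F0; have mdF := measurable_ray_density mF.
pose K (p : V * measurableTypeR R) := ray_density F p.1 p.2.
have K0 p : (0 <= K p)%E by exact: ray_density_ge0.
have : (\int[mu]_x \int[leb]_r K (x, r) = 0)%E.
  rewrite (ae_eq_integral (cst 0%E))//; first by rewrite integral0.
    exact: (@measurable_fun_fubini_tonelli_F _ _ _ _ _ leb K mdF K0).
  by apply: filterS F0 => x; rewrite radial_energyE.
rewrite (@fubini_tonelli _ _ _ _ _ mu leb _ mdF K0) => I0.
pose J r := (\int[mu]_x K (x, r))%E.
have mJ : measurable_fun [set: measurableTypeR R] J.
  exact: (@measurable_fun_fubini_tonelli_G _ _ _ _ _ mu K mdF K0).
have J0 r : (0 <= J r)%E by apply: integral_ge0 => x _; exact: K0.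
have aeJ : ae_eq leb setT J (cst 0%E).
  apply/(ae_eq_integral_abs leb measurableT mJ); rewrite -I0.
  by apply: eq_integral => r _; rewrite gee0_abs.
(* If no positive r worked, the null set [A] would contain []0, 1[], which has measure 1. *)
have [r [r0 Jr]] : exists r : R, 0 < r /\ J r = 0%E.
  apply: contrapT => nr; have [A [mA A0 JA]] := aeJ.
  have sub : `]0, 1[%classic `<=` A.
    move=> r; rewrite /= in_itv/= => /andP[r0 _]; apply: JA => /= h.
    by apply: nr; exists r; split => //; exact: h.
  have : (leb `]0%R, 1%R[%classic <= leb A)%E.
    by apply: le_measure => //; rewrite inE; [exact: measurable_itv|exact: mA].
  by rewrite A0 lebesgue_measure_itv/= lte_fin ltr01 sube0 lee_fin ler10.
have mKr : measurable_fun setT (fun x => K (x, r)) by exact: (measurable_fun_pair1 r mdF).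
have := ge0_integral0_ae mKr (fun x => K0 (x, r)) Jr.
have rV0 : r^-1 != 0 by rewrite invr_eq0 gt_eqF.
move=> /(ae_scale rV0); apply: filterS => x /=.
rewrite /K /ray_density /= scalerA divff ?gt_eqF// scale1r indicE mem_set/=; last first.
  by rewrite in_itv/= r0.
move=> -[] /eqP; rewrite mulr1 mulf_eq0 expf_eq0/= (gt_eqF (exprn_gt0 _ r0)) orbF.
by move=> /eqP/Normc.eq0_normc.
Qed.

Lemma nontrivial_radial_energy F x : cmeasurable_fun F ->
  nontrivial_in_direction F x -> radial_energy F x != 0%E.
Proof.
move=> mF; rewrite /nontrivial_in_direction; apply: contraTN => /eqP I0.
have mdx : measurable_fun [set: measurableTypeR R] (ray_density F x).
  exact: measurable_ray_density_line.
have aex : ae_eq leb setT (ray_density F x) (cst 0%E).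
  apply/(ae_eq_integral_abs leb measurableT mdx); rewrite -I0 radial_energyE.
  by apply: eq_integral => r _; rewrite gee0_abs// ray_density_ge0.
have [A [mA A0 sA]] := aex.
pose B := [set r : R | 0 < r /\ F (r *: x) != 0].
have BA : B `<=` A.
  move=> r [r0 Fr]; apply: sA => /=; apply/not_implyP; split => //.
  rewrite /ray_density indicE mem_set/=; last by rewrite in_itv/= r0.
  move=> -[] /eqP; rewrite mulr1 mulf_eq0 expf_eq0/= (gt_eqF (exprn_gt0 _ r0)) orbF.
  by move=> /eqP/Normc.eq0_normc F0; rewrite F0 eqxx in Fr.
(* Measurability of [B] is what allows its measure to be compared with that of the null set [A]. *)
have mB : measurable (B : set (measurableTypeR R)).
  pose g (r : measurableTypeR R) := normc (F (r *: x)).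
  have mg : measurable_fun [set: measurableTypeR R] g.
    apply: measurable_normc; apply: (cmeasurable_comp mF).
    apply/measurable_fun_rVP => i; under eq_fun do rewrite mxE.
    exact: measurable_funM.
  have -> : B = `]0, +oo[%classic `&` (setT `&` g @^-1` [set~ 0]).
    rewrite setTI; apply/seteqP; split => r /=; rewrite in_itv/= andbT.
      by move=> [r0 Fr]; split => // /Normc.eq0_normc /eqP; exact/negP.
    move=> [r0 gr]; split => //; apply/eqP => Fr.
    by apply: gr; rewrite /g Fr Normc.normc0.
  apply: measurableI; first exact: measurable_itv.
  by apply: mg => //; apply: measurableC; exact: measurable_set1.
by rewrite -leNgt (subset_measure0 mB mA BA A0).
Qed.

End radial.

(** * Assembling the theorem from the orthogonality hypothesis *)

Lemma inner_dilate_translate (R : realType) n (f psi : 'rV[R]_n -> R[i]) (s : R) t :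
  0 < s -> memLp 2%:E f -> memLp 2%:E psi ->
  inner f (dilate_translate psi s t) = real_complex R (s `^ (- (n%:R / 2))) *
    cint (lebesgue_rV n) (fun x => f x * conjc (psi (s^-1 *: (x - t)))).
Proof.
move=> s0 Lf Lpsi; have sV0 : s^-1 != 0 by rewrite invr_eq0 gt_eqF.
have [Lw _] := memL2_window t sV0 Lpsi; have [iw _] := cauchy_schwarz Lf Lw.
have E := cintZl (real_complex R (s `^ (- (n%:R / 2)))) iw.
apply: etrans E; rewrite /inner /dilate_translate; congr (cint _ _); apply/funext => x.
by rewrite conjcM conjc_real mulrCA.
Qed.

(** Both factors lie in L^2, so their product is integrable and [gauss_determining] applies. The
    shifted Gaussians qualify as tests h: they are integrable, bounded by 1, and have integrable
    transforms. *)
Lemma conj_scale_mul_ae0 (R : realType) n (f psi F G : 'rV[R]_n -> R[i]) (s : R) : 0 < s ->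
  memLp 2%:E f -> memLp 2%:E psi -> is_fourier2 f F -> is_fourier2 psi G ->
  (forall t, inner f (dilate_translate psi s t) = 0) ->
  {ae lebesgue_rV n, forall w, conjc (G (s *: w)) * F w = 0}.
Proof.
move=> s0 Lf Lpsi fF psiG orth; have [[LF _] [LG _]] := (fF, psiG).
have sn0 : s != 0 by rewrite gt_eqF.
have orth' t : cint (lebesgue_rV n) (fun x => f x * conjc (psi (s^-1 *: (x - t)))) = 0.
  have := orth t; rewrite inner_dilate_translate// => /eqP; rewrite mulf_eq0.
  by move=> /orP[/eqP[] /eqP|/eqP->//]; rewrite gt_eqF// powR_gt0.
have [Ls _] := memL2_scale sn0 LG; have [Lc _] := memL2J Ls.
have [iH _] := cauchy_schwarz Lc LF; apply: (gauss_determining iH) => a t a0.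
have a00 : a != 0 by rewrite gt_eqF.
have [ih _] := fourier1_gauss_shift_integral t a0.
have := fourier2_wavelet0 s0 Lf Lpsi fF psiG orth' (cintegrable_gauss_shift t a00)
  (fun w => normc_gauss_le1 _) ih.
by move=> <-; congr (cint _ _); apply/funext => w; rewrite mulrAC.
Qed.

Theorem proposition1 (R : realType) (d : nat) (d_ge1 : (1 <= d)%N)
    (f psi : 'rV[R]_d -> R[i])
    (f_L2 : memLp 2%:E f) (psi_L2 : memLp 2%:E psi)
    (orth : forall (s : R) (t : 'rV[R]_d), 0 < s ->
      inner f (dilate_translate psi s t) = 0) :
  ae_unit_vector (fun xi =>
    (radial_energy (fourier2 f) xi * radial_energy (fourier2 psi) xi = 0)%E)
  /\
  (ae_unit_vector (nontrivial_in_direction (fourier2 psi)) ->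
   {ae lebesgue_rV d, forall x, f x = 0}).
Proof.
have fF := fourier2P f_L2; have psiG := fourier2P psi_L2.
have mF : cmeasurable_fun (fourier2 f) by have [[]] := fF.
have mG : cmeasurable_fun (fourier2 psi) by have [[]] := psiG.
(* Whether the energy vanishes depends on the direction alone. This is the homogeneity used both to
   descend to the sphere and to return from it. *)
have RE0 (H : 'rV[R]_d -> R[i]) (c : R) x : cmeasurable_fun H -> 0 < c ->
    (radial_energy H (c *: x) == 0%E) = (radial_energy H x == 0%E).
  move=> mH c0; rewrite (radial_energy_scale x mH d_ge1 c0) mule_eq0.
  by rewrite eqe (gt_eqF (exprn_gt0 _ c0)).
have zero : ae_unit_vector (fun xi =>
    (radial_energy (fourier2 f) xi * radial_energy (fourier2 psi) xi = 0)%E).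
  apply: ae_unit_vector_homogeneous.
  - have mE : measurable_fun setT (fun xi =>
        (radial_energy (fourier2 f) xi * radial_energy (fourier2 psi) xi)%E).
      by apply: emeasurable_funM; exact: measurable_radial_energy.
    by have := mE measurableT _ (emeasurable_set1 0%E); rewrite setTI.
  - move=> c x c0 /eqP; rewrite mule_eq0 => Ex.
    apply/eqP; rewrite mule_eq0.
    by case/orP: Ex => Ex; apply/orP; [left|right]; rewrite RE0.
  - apply: ray_density_mul_ae0 => // s s0.
    exact: (conj_scale_mul_ae0 s0 f_L2 psi_L2 fF psiG (fun t => orth s t s0)).
(* In almost every direction the energy of the transform of psi is nonzero, so that of f vanishes.
   This spreads to almost every point of the space, makes the transform of f vanish almost
   everywhere, and injectivity gives f = 0. *)
split=> // nt; apply: (fourier2_inj f_L2 fF); apply: radial_energy_ae0 => //.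
apply: ae_unit_vectorW => //.
  by move=> c x c0 /eqP Fx; apply/eqP; rewrite RE0.
move: zero nt; rewrite /ae_unit_vector; apply: filterS2 => xi FG0 ntG xi1.
have /eqP := FG0 xi1; rewrite mule_eq0 => /orP[/eqP //|G0].
by have := nontrivial_radial_energy mG (ntG xi1); rewrite G0.
Qed.
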